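(* Let $f(t,y,z)=a_ty+h(t,z)$, where $a:[0,T]\to\mathbb{R}$ is a deterministic bounded measurable function, and suppose that $f:\Omega\times[0,T]\times\mathbb{R}\times\mathbb{R}\to\mathbb{R}$ is such that for each fixed $(y,z)$ the process $f(\cdot,\cdot,y,z)$ is progressively measurable, there is $\lambda>0$ with $|f(t,y,z)-f(t,y',z')|\le\lambda(|y-y'|+|z-z'|)$ for all $t\in[0,T]$ and $y,y',z,z'\in\mathbb{R}$, and $\mathsf{E}\left[\int_0^T|f(t,0,0)|^2dt\right]<\infty$. For $i=1,2$, let $l^i:\Omega\times[0,T]\times\mathbb{R}\to\mathbb{R}$ be measurable with respect to $\mathcal{F}_T\otimes\mathcal{B}([0,T])\otimes\mathcal{B}(\mathbb{R})$ and such that: (1) for each $(\omega,x)$, $t\mapsto l^i(\omega,t,x)$ is continuous; (2) $\mathsf{E}\left[\sup_{t\in[0,T]}|l^i(t,0)|^2\right]<\infty$; (3) for each $(\omega,t)$, $x\mapsto l^i(\omega,t,x)$ is strictly increasing, and there are constants $0<c_{l^i}<C_{l^i}$ such that $c_{l^i}|x-y|\le|l^i(\omega,t,x)-l^i(\omega,t,y)|\le C_{l^i}|x-y|$ for all $(\omega,t)\in\Omega\times[0,T]$ and $x,y\in\mathbb{R}$. For $i=1,2$, let $\mathcal{E}^i:L^2(\mathcal{F}_T)\to\mathbb{R}$ be such that: (1) $X\le Y$ implies $\mathcal{E}^i[X]\le\mathcal{E}^i[Y]$; (2) there is a constant $M_i>0$ such that $\mathcal{E}^i[X_1]-\mathcal{E}^i[X_2]\le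 M_i\,G^{\kappa}_{0,T}[X_1-X_2]$ for all $X_1,X_2\in L^2(\mathcal{F}_T)$. Let $\xi\in L^2(\mathcal{F}_T)$ and $c^1,c^2\in\mathbb{R}$ with $c^1\ge c^2$ and $\mathcal{E}^i[l^i(T,\xi+c^i)]\ge0$, $i=1,2$. Let $(Y^i,Z^i,K^i)\in\mathcal{S}^2\times\mathcal{H}^2\times I[0,T]$ be the solution of $$\begin{cases}Y^i_t=\xi+c^i+\int_t^Tf(s,Y^i_s,Z^i_s)ds-\int_t^TZ^i_sdB_s+K^i_T-K^i_t, & t\in[0,T],\\ \mathcal{E}^i[l^i(t,Y^i_t)]\ge0, & t\in[0,T],\\ K^i\in I[0,T]\ \text{ and }\ \int_0^T\mathcal{E}^i[l^i(t,Y^i_t)]dK^i_t=0.\end{cases}$$ Suppose that for every $(t,x)\in[0,T]\times\mathbb{R}$, $l^1(t,x)\le l^2(t,x)$ a.s., and that $\mathcal{E}^2$ is stronger than $\mathcal{E}^1$, i.e. $\mathcal{E}^2[X]\ge\mathcal{E}^1[X]$ for every $X\in L^2(\mathcal{F}_T)$. Then for every $t\in[0,T]$, $Y^1_t\ge Y^2_t$.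
   Context: Let $T>0$, let $(\Omega,\mathcal{F},\mathbb{F}=(\mathcal{F}_t)_{t\in[0,T]},\mathsf{P})$ be a filtered probability space satisfying the usual conditions and carrying a one-dimensional standard Brownian motion $B$, where $\mathbb{F}$ is the augmented filtration generated by $B$. $\mathsf{E}$ denotes expectation under $\mathsf{P}$; inequalities between random variables are understood a.s. $L^2(\mathcal{F}_T)$ is the set of real $\mathcal{F}_T$-measurable $\xi$ with $\mathsf{E}[|\xi|^2]<\infty$. $\mathcal{S}^2$ is the set of real adapted continuous processes $Y$ on $[0,T]$ with $\mathsf{E}[\sup_{r\in[0,T]}|Y_r|^2]<\infty$. $\mathcal{H}^2$ is the set of real predictable processes $Z$ with $\mathsf{E}[\int_0^T|Z_r|^2dr]<\infty$. $I[0,T]$ is the set of (deterministic) continuous nondecreasing functions $K:[0,T]\to\mathbb{R}$ with $K_0=0$. Fix $\kappa>0$. For $X\in L^2(\mathcal{F}_T)$, $G^{\kappa}_{0,T}[X]:=y_0$, where $(y,z)\in\mathcal{S}^2\times\mathcal{H}^2$ is the unique solution of the BSDE $y_t=X+\int_t^T\kappa(|y_s|+|z_s|)ds-\int_t^Tz_sdB_s$, $t\in[0,T]$. *)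

(* Defs.v *)
From HB Require Import structures.
From mathcomp Require Export all_boot all_order all_algebra.
From mathcomp Require Export all_classical all_reals all_analysis.
Export Order.TTheory GRing.Theory Num.Theory numFieldNormedType.Exports.

Set Implicit Arguments.
Unset Strict Implicit.
Unset Printing Implicit Defensive.

Local Open Scope classical_set_scope.
Local Open Scope ring_scope.

(* Processes on the time interval [0, T] are functions X : R -> Omega -> R with
   the time as first argument, of which only the values X t, 0 <= t <= T,
   matter; a family of sigma-algebras is a function F : R -> set (set Omega),
   again used on [0, T] only. *)

Section Filtrations.
Context d (Omega : measurableType d) (R : realType).
Variables (P : probability Omega R) (T : R).
Implicit Types (F : R -> set (set Omega)) (X Y : R -> Omega -> R).

Definition measurable_wrt (G : set (set Omega)) (X : Omega -> R) : Prop :=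
  measurable_fun setT (X : g_sigma_algebraType G -> R).

Definition filtration F : Prop :=
  [/\ forall t, 0 <= t <= T -> sigma_algebra setT (F t),
      forall t, 0 <= t <= T -> F t `<=` measurable
    & forall s t, 0 <= s -> s <= t -> t <= T -> F s `<=` F t].

Definition usual_conditions F : Prop :=
  [/\ measure_is_complete P, filtration F, P.-negligible `<=` F 0
    & forall t, 0 <= t < T -> \bigcap_(s in `]t, T]) F s = F t].

(* sigma-algebra generated by (B_s)_{s <= t} and the P-null sets *)
Definition augmented_filtration (B : R -> Omega -> R) (t : R) :
    set (set Omega) :=
  <<s [set A | exists s C, [/\ 0 <= s <= t, measurable C & A = B s @^-1` C]]
      `|` P.-negligible >>.

Definition adapted F X : Prop :=
  forall t, 0 <= t <= T -> measurable_wrt (F t) (X t).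

Definition continuous_paths X : Prop :=
  forall w, {within `[0, T], continuous (X ^~ w)}.

Definition progressive F X : Prop :=
  forall t, 0 <= t <= T ->
    measurable_fun (setT `*` `[0, t])
      (fun p : g_sigma_algebraType (F t) * measurableTypeR R => X p.2 p.1).

Definition predictable_rectangles F : set (set (Omega * R)) :=
  [set D | exists2 A, F 0 A & D = A `*` [set 0]] `|`
  [set D | exists s t A,
     [/\ 0 <= s, s <= t, t <= T, F s A & D = A `*` `]s, t]]].

Definition predictable F X : Prop :=
  measurable_fun (setT `*` `[0, T])
    (fun p : g_sigma_algebraType (predictable_rectangles F) => X p.2 p.1).

(* The normal law with parameters 0 and sigma has variance sigma ^+ 2. *)
Definition brownian_motion F (B : R -> Omega -> R) : Prop :=
  [/\ forall t, 0 <= t <= T -> measurable_fun setT (B t),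
      adapted F B,
      continuous_paths B,
      {ae P, forall w, B 0 w = 0}
    & forall s t, 0 <= s -> s < t -> t <= T ->
        forall C : set R, measurable C ->
        let incr := B t \- B s in
        P (incr @^-1` C) = normal_prob 0 (Num.sqrt (t - s)) C /\
        forall A, F s A ->
          P (A `&` incr @^-1` C) = (P A * P (incr @^-1` C))%E].

Definition L2 (G : set (set Omega)) (X : Omega -> R) : Prop :=
  measurable_wrt G X /\ (\int[P]_w ((X w) ^+ 2)%:E < +oo)%E.

Definition S2 F Y : Prop :=
  [/\ adapted F Y, continuous_paths Y
    & (\int[P]_w ereal_sup [set ((Y r w) ^+ 2)%:E | r in `[0%R, T]] < +oo)%E].

Definition H2 F (Z : R -> Omega -> R) : Prop :=
  predictable F Z /\
  (\int[P]_w \int[lebesgue_measure]_(r in `[0%R, T]) ((Z r w) ^+ 2)%:E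
   < +oo)%E.

End Filtrations.

Section ItoIntegral.
Context d (Omega : measurableType d) (R : realType).
Variables (P : probability Omega R) (T : R) (F : R -> set (set Omega))
  (B : R -> Omega -> R).

(* The process \sum_(i < n) coef_i 1_{]time_i, time_{i+1}]}. *)
Record simple_process := SimpleProcess {
  sp_size : nat;
  sp_time : nat -> R;
  sp_coef : nat -> Omega -> R;
  sp_time_itv : forall i, (i <= sp_size)%N -> 0 <= sp_time i <= T;
  sp_time_le : forall i, (i < sp_size)%N -> sp_time i <= sp_time i.+1;
  sp_coef_meas : forall i, (i < sp_size)%N ->
    measurable_wrt (F (sp_time i)) (sp_coef i);
  sp_coef_bnd : forall i, (i < sp_size)%N ->
    exists C : R, forall w, `|sp_coef i w| <= C }.

Definition sp_val (H : simple_process) (t : R) (w : Omega) : R :=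
  \sum_(i < sp_size H)
    sp_coef H i w * \1_(`]sp_time H i, sp_time H i.+1]) t.

Definition sp_integral (H : simple_process) (t : R) (w : Omega) : R :=
  \sum_(i < sp_size H) sp_coef H i w *
    (B (Num.min (sp_time H i.+1) t) w - B (Num.min (sp_time H i) t) w).

(* M_t = \int_0^t Z_s dB_s, 0 <= t <= T: the continuous version of the
   L2-limit of the integrals of simple processes converging to Z in H2. *)
Definition ito_integral (Z M : R -> Omega -> R) : Prop :=
  [/\ adapted T F M, continuous_paths T M
    & exists H : nat -> simple_process,
        ((\int[P]_w \int[lebesgue_measure]_(r in `[0%R, T])
             ((sp_val (H n) r w - Z r w) ^+ 2)%:E)%E
           @[n --> \oo] --> 0%E) /\
        forall t, 0 <= t <= T ->
          (\int[P]_w ((sp_integral (H n) t w - M t w) ^+ 2)%:E)%E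
             @[n --> \oo] --> 0%E].

End ItoIntegral.

Section BSDE.
Context d (Omega : measurableType d) (R : realType).
Variables (P : probability Omega R) (T : R) (F : R -> set (set Omega))
  (B : R -> Omega -> R).

(* (Y, Z) in S2 x H2 and
   Y_t = X + \int_t^T f(s, Y_s, Z_s) ds - \int_t^T Z_s dB_s + K_T - K_t. *)
Definition bsde_solution (X : Omega -> R) (f : Omega -> R -> R -> R -> R)
    (K : R -> R) (Y Z : R -> Omega -> R) : Prop :=
  [/\ S2 P T F Y, H2 P T F Z
    & exists2 M, ito_integral P T F B Z M &
      forall t, 0 <= t <= T -> {ae P, forall w,
        Y t w = X w
          + \int[lebesgue_measure]_(s in `[t, T]) f w s (Y s w) (Z s w)
          - (M T w - M t w) + (K T - K t)}].

(* Since y_0 is measurable for the P-trivial sigma-algebra F_0, it is a.s.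
   equal to a constant, which is the value of the g-expectation. *)
Definition gexp (kappa : R) (X : Omega -> R) : R :=
  xget 0 [set y0 | exists Y Z,
    bsde_solution X (fun _ _ y z => kappa * (`|y| + `|z|)) (fun=> 0) Y Z /\
    {ae P, forall w, Y 0 w = y0}].

(* K belongs to I[0,T]. *)
Definition increasing_function (K : R -> R) : Prop :=
  [/\ {within `[0, T], continuous K},
      forall s t, 0 <= s -> s <= t -> t <= T -> K s <= K t
    & K 0 = 0].

(* \int_0^T phi_t dK_t = v for K in I[0,T]. The library's Stieltjes measure is
   defined for functions on the whole line; k is K extended by constants
   outside [0, T] (it exists as soon as K is in I[0,T], and is unique). *)
Definition stieltjes_integral_is (K phi : R -> R) (v : \bar R) : Prop :=
  exists2 k : cumulative R R,
    (forall t, k t = K (Num.min (Num.max 0 t) T)) &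
    (\int[lebesgue_stieltjes_measure k]_(t in `[0%R, T]) (phi t)%:E)%E = v.

Definition lipschitz_generator (lambda : R) (f : Omega -> R -> R -> R -> R) :
    Prop :=
  [/\ forall y z, progressive T F (fun t w => f w t y z),
      {ae P, forall w, forall t y y' z z', 0 <= t <= T ->
         `|f w t y z - f w t y' z'| <= lambda * (`|y - y'| + `|z - z'|)}
    & (\int[P]_w \int[lebesgue_measure]_(t in `[0%R, T])
         ((f w t 0 0) ^+ 2)%:E < +oo)%E].

Definition loss_function (l : Omega -> R -> R -> R) : Prop :=
  [/\ measurable_fun (setT `*` `[0, T] `*` setT)
        (fun p : g_sigma_algebraType (F T) * measurableTypeR R
                   * measurableTypeR R => l p.1.1 p.1.2 p.2),
      forall w x, {within `[0, T], continuous (fun t => l w t x)},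
      (\int[P]_w ereal_sup [set ((l w t 0) ^+ 2)%:E | t in `[0%R, T]] < +oo)%E,
      forall w t, 0 <= t <= T -> {homo l w t : x y / x < y}
    & exists c C : R, [/\ 0 < c, c < C &
        forall w t x y, 0 <= t <= T ->
          c * `|x - y| <= `|l w t x - l w t y| <= C * `|x - y|]].

(* Functionals on L2(F_T) are given on all functions Omega -> R; only the
   values on L2(F_T) are constrained. By monotonicity these depend only on
   the a.s. class of the argument. *)
Definition nonlinear_expectation (kappa : R) (E : (Omega -> R) -> R) : Prop :=
  (forall X Y, L2 P (F T) X -> L2 P (F T) Y ->
     {ae P, forall w, X w <= Y w} -> E X <= E Y) /\
  (exists2 M : R, 0 < M &
     forall X1 X2, L2 P (F T) X1 -> L2 P (F T) X2 ->
       E X1 - E X2 <= M * gexp kappa (fun w => X1 w - X2 w)).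

Definition mean_reflected_solution (X : Omega -> R)
    (f : Omega -> R -> R -> R -> R) (E : (Omega -> R) -> R)
    (l : Omega -> R -> R -> R) (Y Z : R -> Omega -> R) (K : R -> R) : Prop :=
  [/\ bsde_solution X f K Y Z,
      forall t, 0 <= t <= T -> 0 <= E (fun w => l w t (Y t w)),
      increasing_function K
    & stieltjes_integral_is K (fun t => E (fun w => l w t (Y t w))) 0%E].

End BSDE.

(* Main.v *)
Require Import Defs.
From mathcomp Require Import ring lra measurable_realfun.

(** Write [W = Y1 - Y2].  The generator is affine in [y] with a deterministic
    coefficient [a], and the reflecting terms [K1], [K2] are deterministic, so
    randomness can enter [W] only through its own Lipschitz equation.  This
    forces [W] to be deterministic, and what is left is a comparison for a
    scalar equation.

    _The gap is deterministic._  Let [D t = E(W t)] and [V = W - D], which is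
    centred.  Since [f s y z - f s y' z' - a s * D s] is bounded by
    [L * (|y - y' - D s| + |z - z'|)], the pair [(V, Z1 - Z2)] solves, up to a
    deterministic term [m] in the equation, a backward equation with zero data
    and Lipschitz drift.  The term [m] costs nothing in mean square, because a
    centred variable is at least as close to [0] as to any other constant.
    On a short interval the mean square of [V t] and of [Z1 - Z2] on [[t, T]]
    are thus at most half of themselves, so they vanish, and finitely many
    steps backwards from [T] cover [[0, T]]
    ([energy_tail_step], [lipschitz_uniqueness]).  Hence [W t = D t] almost
    surely, and [m = 0] is a deterministic equation ([bsde_difference]):
      [D t = (c1 - c2) + (K1 T - K1 t) - (K2 T - K2 t) + int_t^T a D].

    _Estimates for the Ito integral._  The short-time argument uses the
    integral only through two inequalities, valid up to a constant: if [eta] is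
    known at time [u] and [I] is the integral over [[u, T]], then both the mean
    square of [eta] and the energy of the integrand are bounded by the mean
    square of [eta + I] ([ito_estimate_eta], [ito_estimate_integrand]).  For
    elementary integrals they follow from the isometry and from orthogonality
    to the past ([elementary_isometry], [elementary_orthogonal]), that is from
    the independence of Brownian increments and the past ([indep_integralM]);
    they pass to the limit because constants are allowed to degrade.

    _The constraint is slack where the gap is negative._  If [D t < 0] then
    [Y2 t = Y1 t + |D t|], so [l2 t (Y2 t)] exceeds [l2 t (Y1 t)], hence
    [l1 t (Y1 t)], by at least a multiple of [|D t|].  Subtracting a constant
    [delta >= 0] lowers [E2] by at least a multiple of [delta], since
    domination by the g-expectation reduces this to the g-expectation of
    [- delta], which solves an ordinary equation and equals
    [- delta * exp(- kappa T)] ([gexp_constant], [expectation_shift]).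
    Therefore [E2 (l2 t (Y2 t)) > 0] with a lower bound proportional to [|D t|]
    ([constraint_slack]), and the flatness condition makes [K2] constant
    wherever [D] stays below a negative number ([stieltjes_flat]).

    _Conclusion._  If [D t0 < 0], let [t1 > t0] be the first time with
    [D t1 >= 0].  Between them [K2] is constant and [K1] only increases, so
    [- D t <= A * int_t^t1 |D|] with [A] a bound of [|a|]; over an interval
    shorter than [1 / A] this contradicts the minimality of [D] at a minimum
    point ([gap_nonneg]). *)

Set Implicit Arguments.
Unset Strict Implicit.
Unset Printing Implicit Defensive.

Local Open Scope classical_set_scope.
Local Open Scope ring_scope.

(** * Integrals of nonnegative functions and moments of the normal law *)

Section Integrals.
Context d (U : measurableType d) (R : realType).
Variable mu : {measure set U -> \bar R}.
Local Open Scope ereal_scope.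
Import HBNNSimple.

(** The integral of a nonnegative function is the supremum of the integrals of
    the simple functions below it, hence monotone for arbitrary functions. *)
Lemma ge0_le_integral_nomeas (D : set U) (f g : U -> \bar R) :
  (forall x, D x -> 0 <= f x) -> (forall x, D x -> f x <= g x) ->
  \int[mu]_(x in D) f x <= \int[mu]_(x in D) g x.
Proof.
move=> f0 fg.
have g0 x : D x -> 0 <= g x by move=> Dx; rewrite (le_trans (f0 _ Dx)) ?fg.
rewrite !ge0_integralE//; apply: le_ereal_sup => _ [h /= hf <-]; exists h => // x.
rewrite (le_trans (hf x))// !patchE; case: ifPn => // /set_mem; exact: fg.
Qed.

Lemma ge0_subset_integral_nomeas (D D' : set U) (f : U -> \bar R) :
  D `<=` D' -> (forall x, 0 <= f x) ->
  \int[mu]_(x in D) f x <= \int[mu]_(x in D') f x.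
Proof.
move=> DD' f0; rewrite [leLHS]integral_mkcond [leRHS]integral_mkcond.
apply: ge0_le_integral_nomeas => x _; rewrite !patchE; first by case: ifPn.
case: ifPn => [/set_mem/DD'/mem_set -> //|_]; by case: ifPn.
Qed.

End Integrals.

Section NormalMoments.
Context (R : realType).
Local Notation mu := (@lebesgue_measure R).
Import HBNNSimple.

Lemma integral_normal_indic (s : R) (A : set (measurableTypeR R)) : measurable A ->
  (\int[normal_prob 0%R s]_x (\1_A x)%:E =
   \int[mu]_x ((\1_A x)%:E * (normal_pdf 0 s x)%:E))%E.
Proof.
move=> mA; rewrite integral_indic// setIT.
transitivity (\int[mu]_(x in A) (normal_pdf 0 s x)%:E)%E; first by [].
rewrite integral_mkcond.
apply: eq_integral => x _; rewrite patchE indicE.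
by case: ifPn => _; rewrite ?mul1e ?mul0e.
Qed.

(** The normal law is given by a density on sets; simple functions and monotone
    convergence carry this over to nonnegative functions. *)
Lemma ge0_integral_normal (s : R) (f : R -> \bar R) :
  measurable_fun [set: measurableTypeR R] f -> (forall x, 0 <= f x)%E ->
  (\int[normal_prob 0%R s]_x f x = \int[mu]_x (f x * (normal_pdf 0 s x)%:E))%E.
Proof.
move=> mf f0; pose f_ := @nnsfun_approx _ (measurableTypeR R) R setT measurableT f mf.
have mp : measurable_fun [set: measurableTypeR R] (fun x => (normal_pdf 0 s x)%:E).
  by apply/measurable_EFinP; exact: measurable_normal_pdf.
have p0 x : (0 <= (normal_pdf 0 s x)%:E)%E by rewrite lee_fin normal_pdf_ge0.
have f_f x : (fun n => (f_ n x)%:E) @ \oo --> f x.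
  exact: cvg_nnsfun_approx.
have nd x m n : (m <= n)%N -> ((f_ m x)%:E <= (f_ n x)%:E)%E.
  by move=> mn; rewrite lee_fin; exact/lefP/nd_nnsfun_approx.
transitivity (limn (fun n => \int[normal_prob 0%R s]_x (f_ n x)%:E))%E.
  rewrite -monotone_convergence//.
  - by apply: eq_integral => x _; apply/esym/cvg_lim => //.
  - by move=> n; exact/measurable_EFinP/measurable_funTS.
  - by move=> n x _; rewrite lee_fin.
  - by move=> x _ m n mn; exact: nd.
transitivity (limn (fun n => \int[mu]_x ((f_ n x)%:E * (normal_pdf 0 s x)%:E)))%E; last first.
  rewrite -monotone_convergence//.
  - apply: eq_integral => x _; apply/cvg_lim => //.
    rewrite (_ : (fun n => _) = (fun n => (normal_pdf 0 s x)%:E * (f_ n x)%:E)%E); last by apply/funext => n; rewrite muleC.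
    by rewrite muleC; apply: cvgeZl => //; exact: f_f.
  - by move=> n; apply: emeasurable_funM => //; exact/measurable_EFinP/measurable_funTS.
  - by move=> n x _; apply: mule_ge0 => //; rewrite lee_fin.
  - by move=> x _ m n mn; rewrite lee_wpmul2r// nd.
congr (limn _); apply/funext => n.
under eq_integral do rewrite fimfunE -fsumEFin//.
transitivity (\int[mu]_x (\sum_(r \in range (f_ n))
    ((r * \1_(f_ n @^-1` [set r]) x)%:E * (normal_pdf 0 s x)%:E)))%E; last first.
  apply: eq_integral => x _; rewrite [in RHS]fimfunE -fsumEFin//.
  by rewrite ge0_mule_fsuml// => r; exact: nnfun_muleindic_ge0.
rewrite ge0_integral_fsum//; last 2 first.
- by move=> r; exact/measurable_EFinP/measurableT_comp.
- by move=> r x _; exact: nnfun_muleindic_ge0.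
rewrite ge0_integral_fsum//; last 2 first.
- move=> r; apply: emeasurable_funM => //; exact/measurable_EFinP/measurableT_comp.
- by move=> r x _; rewrite mule_ge0//; exact: nnfun_muleindic_ge0.
apply: eq_fsbigr => r _.
under eq_integral do rewrite EFinM.
under [RHS]eq_integral do rewrite EFinM -muleA.
have [r0|r0] := leP 0 r; last first.
  have -> : f_ n @^-1` [set r] = set0.
    rewrite -subset0 => x /= fx; have : 0 <= r by rewrite -fx; exact: fun_ge0.
    by rewrite leNgt r0.
  rewrite integral0_eq; last by move=> x _; rewrite indic0 mule0.
  by rewrite integral0_eq// => x _; rewrite indic0 mul0e mule0.
rewrite ge0_integralZl_EFin//; last exact/measurable_EFinP.
have mA : measurable (f_ n @^-1` [set r] : set (measurableTypeR R)) by [].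
rewrite [RHS]ge0_integralZl_EFin ?(integral_normal_indic s mA)//.
  by move=> x _; apply: mule_ge0 => //; rewrite lee_fin.
by apply: emeasurable_funM => //; exact/measurable_EFinP/measurable_indic.
Qed.

Lemma ge0_integral_lebesgueN (f : R -> \bar R) :
  measurable_fun [set: measurableTypeR R] f -> (forall x, 0 <= f x)%E ->
  (\int[mu]_x f x = \int[mu]_x f (- x)%R)%E.
Proof.
move=> mf f0.
transitivity (\int[pushforward mu (-%R : measurableTypeR R -> measurableTypeR R)]_x f x)%E.
  by apply: eq_measure_integral => A mA _; exact/esym/lebesgue_measureN.
by rewrite ge0_integral_pushforward.
Qed.

Lemma normal_pdfN (s x : R) : s != 0 -> normal_pdf 0 s (- x) = normal_pdf 0 s x.
Proof.
by move=> s0; rewrite !normal_pdfE// /normal_fun !subr0 sqrrN.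
Qed.

Lemma normal_pdf_scale (s x : R) : 0 < s ->
  normal_pdf 0 s (s * x) * s = normal_pdf 0 1 x.
Proof.
move=> s0; rewrite !normal_pdfE ?gt_eqF// /normal_peak /normal_fun.
rewrite !subr0 !expr1n mul1r -mulrnAr sqrtrM ?sqr_ge0// sqrtr_sqr gtr0_norm//.
have -> : - (s * x) ^+ 2 / (s ^+ 2 *+ 2) = - x ^+ 2 / (1 *+ 2).
  by field; rewrite gt_eqF.
rewrite mulrAC; congr (_ * _); rewrite invfM mulrAC mulVf ?mul1r// gt_eqF//.
Qed.


Definition normal_moment2 : \bar R := (\int[normal_prob 0%R 1%R]_x (x ^+ 2)%:E)%E.

Let msqr : measurable_fun [set: measurableTypeR R] (fun x : R => (x ^+ 2)%:E).
Proof. by apply/measurable_EFinP; exact: measurable_funX. Qed.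

Let mpdf s : measurable_fun [set: measurableTypeR R] (fun x : R => (normal_pdf 0 s x)%:E).
Proof. by apply/measurable_EFinP; exact: measurable_normal_pdf. Qed.

Lemma integral_normal_sqr (s : R) : 0 < s ->
  (\int[normal_prob 0%R s]_x (x ^+ 2)%:E = (s ^+ 2)%:E * normal_moment2)%E.
Proof.
move=> s0; rewrite /normal_moment2 !ge0_integral_normal//; last 2 first.
  by move=> x; rewrite lee_fin sqr_ge0.
  by move=> x; rewrite lee_fin sqr_ge0.
have sE : derive1 (fun x : R => s * x) = cst s.
  by apply/funext => x; rewrite derive1E derive_val /= scaler1.
under eq_integral do rewrite -EFinM.
rewrite (@increasing_ge0_integration_by_substitutionT _ (fun x : R => s * x)
  (fun x => x ^+ 2 * normal_pdf 0 s x)).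
- rewrite sE -ge0_integralZl_EFin ?sqr_ge0//; last 2 first.
  + by move=> x _; rewrite -EFinM lee_fin mulr_ge0 ?sqr_ge0 ?normal_pdf_ge0.
  + exact: emeasurable_funM.
  apply: eq_integral => x _; rewrite -!EFinM /=; congr EFin.
  rewrite -[LHS]/((s * x) ^+ 2 * normal_pdf 0 s (s * x) * s).
  by rewrite -mulrA normal_pdf_scale// exprMn mulrA.
- by move=> x y xy; rewrite ltr_pM2l.
- by rewrite sE => x; exact: cst_continuous.
- by rewrite sE; exact: is_cvg_cst.
- by rewrite sE; exact: is_cvg_cst.
- by move=> x; exact: derivableM.
- exact: gt0_cvgMrNy.
- exact: gt0_cvgMry.
- move=> x; apply: cvgM; first exact: sqr_continuous.
  by apply: continuous_normal_pdf; rewrite gt_eqF.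
- by move=> x; rewrite mulr_ge0 ?sqr_ge0 ?normal_pdf_ge0.
Qed.

Lemma normal_moment2_gt0 : (0 < normal_moment2)%E.
Proof.
rewrite /normal_moment2 ge0_integral_normal//; last first.
  by move=> x; rewrite lee_fin sqr_ge0.
have p0 : 0 < normal_pdf 0 1 (2 : R).
  by rewrite normal_pdfE// mulr_gt0 ?expR_gt0 ?normal_peak_gt0.
(* On [1, 2] the integrand x ^ 2 * pdf x is at least pdf 2. *)
apply: (@lt_le_trans _ _ (\int[mu]_(x in `[1%R, 2%R]) (normal_pdf 0 1 2)%:E)%E).
  rewrite integral_cst//= lebesgue_measure_itv/= lte_fin ltr1n -EFinB -EFinM lte_fin.
  by rewrite mulr_gt0// subr_gt0 ltr1n.
rewrite integral_mkcond; apply: ge0_le_integral_nomeas => x _; rewrite patchE.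
  by case: ifPn => // _; rewrite lee_fin ltW.
case: ifPn => [/set_mem/=|_]; last first.
  by rewrite -EFinM lee_fin mulr_ge0 ?sqr_ge0 ?normal_pdf_ge0.
rewrite in_itv/= -EFinM lee_fin => /andP[x1 x2].
rewrite -[leLHS]mul1r ler_pM ?normal_pdf_ge0 ?exprn_ege1//.
rewrite !normal_pdfE// ler_pM2l ?normal_peak_gt0// /normal_fun.
rewrite ler_expR !subr0 ler_pM2r ?invr_gt0// lerN2 ler_pXn2r// nnegrE.
by rewrite (le_trans _ x1).
by rewrite ler0n.
Qed.

(** The factor [x ^ 2] is absorbed by half of the Gaussian exponent, which leaves
    a multiple of the density of a normal law of variance [2]. *)
Lemma normal_moment2_lty : (normal_moment2 < +oo)%E.
Proof.
rewrite /normal_moment2 ge0_integral_normal//; last first.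
  by move=> x; rewrite lee_fin sqr_ge0.
pose c : R := Num.sqrt 2; have c0 : c != 0 by rewrite sqrtr_eq0 -ltNge.
pose C : R := 4 * normal_peak 1 / normal_peak c.
have pk0 := normal_peak_gt0 c0.
have C0 : 0 <= C by rewrite divr_ge0 ?mulr_ge0 ?normal_peak_ge0.
apply: (@le_lt_trans _ _ (\int[mu]_x (C%:E * (normal_pdf 0 c x)%:E))%E); last first.
  rewrite ge0_integralZl_EFin//; last by move=> x _; rewrite lee_fin normal_pdf_ge0.
  by rewrite integral_normal_pdf mule1 ltry.
apply: ge0_le_integral_nomeas => x _; rewrite -EFinM lee_fin.
  by rewrite mulr_ge0 ?sqr_ge0 ?normal_pdf_ge0.
rewrite !normal_pdfE// /C [leRHS]mulrA divfK ?gt_eqF//.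
rewrite mulrCA [leRHS]mulrAC [leRHS]mulrC ler_wpM2l ?normal_peak_ge0// /normal_fun !subr0.
rewrite sqr_sqrtr// expr1n.
(* It remains to see that x ^ 2 / 4 <= exp (x ^ 2 / 4). *)
have -> : - x ^+ 2 / (1 *+ 2) = - (x ^+ 2 / 4) + - x ^+ 2 / (2 *+ 2) by field.
rewrite expRD mulrA [leRHS]mulrC [leLHS]mulrC ler_wpM2l ?expR_ge0//.
rewrite expRN ler_pdivrMr ?expR_gt0// -ler_pdivrMl//.
by rewrite mulrC (le_trans _ (expR_ge1Dx _))// lerDr.
Qed.

(** The density is even, so the positive and negative parts of the identity have
    the same integral; it is finite because [x <= 1 + x ^ 2]. *)
Lemma integral_normal_id (s : R) : 0 < s ->
  (\int[normal_prob 0%R s]_x x%:E = 0)%E.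
Proof.
move=> s0; rewrite integralE.
have mp : measurable_fun [set: measurableTypeR R] (EFin : R -> \bar R)^\+%E.
  exact: measurable_funepos.
have mn : measurable_fun [set: measurableTypeR R] (EFin : R -> \bar R)^\-%E.
  exact: measurable_funeneg.
have E : (\int[normal_prob 0%R s]_x (EFin^\+ x) = \int[normal_prob 0%R s]_x (EFin^\- x))%E.
  rewrite !ge0_integral_normal// ge0_integral_lebesgueN//; last 2 first.
    exact: emeasurable_funM.
    by move=> x; rewrite mule_ge0// lee_fin normal_pdf_ge0.
  apply: eq_integral => x _; rewrite normal_pdfN ?gt_eqF//; congr (_ * _)%E.
  by rewrite /= funeposE funenegE EFinN.
have Efin : (\int[normal_prob 0%R s]_x (EFin^\+ x) < +oo)%E.
  apply: (@le_lt_trans _ _ (\int[normal_prob 0%R s]_x (1 + (x ^+ 2)%:E))%E).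
    apply: ge0_le_integral_nomeas; first by [].
    move=> x _; rewrite funeposE /= -EFin_max -EFinD lee_fin; case: (leP x 0) => x0; nra.
  rewrite ge0_integralD//; last by move=> x _; rewrite lee_fin sqr_ge0.
  rewrite integral_cst// [X in (_ * X)%E](@probability_setT _ _ _ (normal_prob 0 s)).
  rewrite mule1 integral_normal_sqr//.
  by rewrite lte_add_pinfty ?ltry// lte_mul_pinfty ?normal_moment2_lty// ?lee_fin ?sqr_ge0.
rewrite /= -E subee// ge0_fin_numE//.
by apply: integral_ge0.
Qed.

End NormalMoments.

(** * Independence, square-integrable variables and parameter integrals *)

Section SubSigmaAlgebra.
Context d (Omega : measurableType d) (R : realType).

Lemma measurable_wrtW (G : set (set Omega)) (X : Omega -> R) :
  G `<=` measurable -> measurable_wrt G X -> measurable_fun setT X.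
Proof.
move=> GM mX _ C mC; have := mX measurableT C mC.
rewrite !setTI => h; apply: smallest_sub h => //.
exact: sigma_algebra_measurable.
Qed.

Lemma measurable_wrt_sub (G H : set (set Omega)) (X : Omega -> R) :
  G `<=` H -> measurable_wrt G X -> measurable_wrt H X.
Proof.
move=> GH mX _ C mC; have := mX measurableT C mC.
exact: sub_smallest2r.
Qed.

Lemma measurable_id_sub (G : set (set Omega)) :
  G `<=` measurable ->
  measurable_fun setT (id : Omega -> g_sigma_algebraType G).
Proof.
move=> GM _ C mC; rewrite setTI; apply: smallest_sub mC => //.
exact: sigma_algebra_measurable.
Qed.

End SubSigmaAlgebra.

Section Independence.
Context d (Omega : measurableType d) (R : realType) (P : probability Omega R).
Variables (G : set (set Omega)) (incr : Omega -> R) (N : probability (measurableTypeR R) R).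
Hypothesis Gsig : sigma_algebra setT G.
Hypothesis GM : G `<=` measurable.
Hypothesis mincr : measurable_fun setT incr.
Hypothesis incr_law : forall C : set R, measurable C -> P (incr @^-1` C) = N C.
Hypothesis incr_indep : forall (A : set Omega) (C : set R), G A -> measurable C ->
  P (A `&` incr @^-1` C) = (P A * P (incr @^-1` C))%E.

Let GT := g_sigma_algebraType G.
Let idG := mfun_Sub (mem_set (measurable_id_sub GM) : (id : Omega -> GT) \in mfun).
Let mpair : measurable_fun setT (fun w : Omega => (w : GT, incr w : measurableTypeR R)).
Proof. by apply: measurable_fun_pair => //; exact: measurable_id_sub. Qed.
Let pairG := mfun_Sub (mem_set mpair : (fun w : Omega => (w : GT, incr w : measurableTypeR R)) \in mfun).
Let PG : probability GT R := distribution P idG.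
Let PQ : probability (GT * measurableTypeR R)%type R := distribution P pairG.

Let GE (A : set GT) : measurable A -> G A.
Proof. by move=> mA; rewrite -(sigma_algebra_id Gsig). Qed.

Lemma joint_law A : measurable A -> (PG \x N)%E A = PQ A.
Proof.
apply: product_measure_unique => {}A C mA mC.
by have := incr_indep (GE mA) mC; rewrite incr_law.
Qed.

(** Independence says that the joint law of the identity, with values in
    [Omega] equipped with [G], and of [incr] is a product measure; Fubini's
    theorem then factors the expectation of a function of the pair. *)
Lemma indep_integralM (X : Omega -> R) (g : R -> R) :
  measurable_wrt G X -> measurable_fun [set: measurableTypeR R] g ->
  P.-integrable setT (EFin \o X) -> N.-integrable setT (EFin \o g) ->
  P.-integrable setT (fun w => (X w * g (incr w))%:E) /\
  (\int[P]_w (X w * g (incr w))%:E = \int[P]_w (X w)%:E * \int[N]_x (g x)%:E)%E.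
Proof.
move=> mX mg iX ig.
pose h (p : GT * measurableTypeR R) : \bar R := (X p.1 * g p.2)%:E.
have mh : measurable_fun setT h.
  apply/measurable_EFinP; apply: measurable_funM.
    by apply: (measurableT_comp mX).
  by apply: (measurableT_comp mg).
have iXG : PG.-integrable setT (EFin \o X : GT -> \bar R).
  apply: integrable_pushforward => //; exact/measurable_EFinP.
have ih : (PG \x N)%E.-integrable setT h.
  apply/integrable12ltyP => //.
  apply: (@le_lt_trans _ _ (\int[PG]_x (`|X x|%:E * \int[N]_y `|g y|%:E))%E).
    apply: ge0_le_integral_nomeas => x _.
      by apply: integral_ge0.
    rewrite -ge0_integralZl_EFin//; last first.
      by apply/measurable_EFinP; exact: measurableT_comp.
    apply: ge0_le_integral_nomeas => y _; first exact: abse_ge0.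
    by rewrite /h /= normrM EFinM.
  have [_ iX'] := integrableP _ _ _ iXG.
  have [_ ig'] := integrableP _ _ _ ig.
  rewrite ge0_integralZr//; last 2 first.
    by apply/measurable_EFinP; exact: measurableT_comp.
    exact: integral_ge0.
  by apply: lte_mul_pinfty => //; [exact: integral_ge0|rewrite ge0_fin_numE//; exact: integral_ge0].
have ihQ : PQ.-integrable setT h.
  apply/integrableP; split => //; have [_ ih'] := integrableP _ _ _ ih.
  apply: le_lt_trans ih'; rewrite le_eqVlt; apply/orP; left; apply/eqP.
  by apply: eq_measure_integral => A mA _; first [exact: joint_law | exact/esym/joint_law].
have iP : P.-integrable setT (fun w => (X w * g (incr w))%:E).
  have [_ ihQ'] := integrableP _ _ _ ihQ.
  apply/integrableP; split; first by apply: (measurableT_comp mh mpair).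
  apply: le_lt_trans ihQ'.
  rewrite ge0_integral_pushforward//.
  exact: measurableT_comp.
split => //.
transitivity (\int[PQ]_p h p)%E.
  by rewrite /PQ integral_pushforward.
transitivity (\int[(PG \x N)%E]_p h p)%E.
  by apply: eq_measure_integral => A mA _; first [exact: joint_law | exact/esym/joint_law].
rewrite -integral12_prod_meas1// /fubini_F /h/=.
transitivity (\int[PG]_x ((X x)%:E * \int[N]_y (g y)%:E))%E.
  apply: eq_integral => x _; rewrite -integralZl//.
have gf : (\int[N]_y (g y)%:E \is a fin_num)%E by exact: integrable_fin_num.
rewrite -(fineK gf) integralZr//; congr (_ * _)%E.
by rewrite integral_pushforward//; exact/measurable_EFinP.
Qed.

End Independence.

Section SquareIntegrable.
Context d (Omega : measurableType d) (R : realType) (P : probability Omega R).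
Implicit Types X Y c : Omega -> R.

Definition square_integrable X :=
  measurable_fun setT X /\ (\int[P]_w ((X w) ^+ 2)%:E < +oo)%E.

Lemma square_integrable_mul X Y : square_integrable X -> square_integrable Y ->
  P.-integrable setT (fun w => (X w * Y w)%:E).
Proof.
move=> [mX iX] [mY iY]; apply/integrableP; split.
  by apply/measurable_EFinP; exact: measurable_funM.
apply: (@le_lt_trans _ _ (\int[P]_w (((X w) ^+ 2)%:E + ((Y w) ^+ 2)%:E))%E).
  apply: ge0_le_integral_nomeas => w _; first exact: abse_ge0.
  rewrite /= -EFinD lee_fin ler_norml; apply/andP; split; nra.
rewrite ge0_integralD//.
- exact: lte_add_pinfty.
- by move=> w _; rewrite lee_fin sqr_ge0.
- by apply/measurable_EFinP; exact: measurable_funX.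
- by move=> w _; rewrite lee_fin sqr_ge0.
- by apply/measurable_EFinP; exact: measurable_funX.
Qed.

Lemma square_integrable_le X Y Z : measurable_fun setT X ->
  (forall w, (X w) ^+ 2 <= 2 * (Y w) ^+ 2 + 2 * (Z w) ^+ 2) ->
  square_integrable Y -> square_integrable Z -> square_integrable X.
Proof.
move=> mX XYZ [mY iY] [mZ iZ]; split => //.
have m2 (V : Omega -> R) : measurable_fun setT V -> measurable_fun setT (fun w : Omega => ((V w) ^+ 2)%:E : \bar R).
  by move=> mV; apply/measurable_EFinP; exact: measurable_funX.
apply: (@le_lt_trans _ _ (\int[P]_w (2%:E * ((Y w) ^+ 2)%:E + 2%:E * ((Z w) ^+ 2)%:E))%E).
  apply: ge0_le_integral_nomeas => w _; first by rewrite lee_fin sqr_ge0.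
  by rewrite -!EFinM -EFinD lee_fin.
have q0 (V : Omega -> R) w : setT w -> (0 <= ((V w) ^+ 2)%:E)%E by rewrite lee_fin sqr_ge0.
rewrite ge0_integralD//; last 4 first.
- by move=> w _; rewrite mule_ge0 ?q0// lee_fin.
- by apply: measurable_funeM; exact: m2.
- by move=> w _; rewrite mule_ge0 ?q0// lee_fin.
- by apply: measurable_funeM; exact: m2.
rewrite !ge0_integralZl_EFin//; [|exact: q0|exact: m2|exact: q0|exact: m2].
by rewrite lte_add_pinfty// lte_mul_pinfty// ?lee_fin.
Qed.

Lemma square_integrable_cst (c : R) : square_integrable (cst c).
Proof.
by split => //=; rewrite integral_cst// [X in (_ * X)%E](@probability_setT _ _ _ P) mule1 ltry.
Qed.

Lemma square_integrableD X Y : square_integrable X -> square_integrable Y ->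
  square_integrable (fun w => X w + Y w).
Proof.
move=> iX iY; apply: (square_integrable_le _ _ iX iY).
  by apply: measurable_funD; [case: iX|case: iY].
by move=> w; have := sqr_ge0 (X w - Y w); nra.
Qed.

Lemma square_integrableB X Y : square_integrable X -> square_integrable Y ->
  square_integrable (fun w => X w - Y w).
Proof.
move=> iX iY; apply: (square_integrable_le _ _ iX iY).
  by apply: measurable_funB; [case: iX|case: iY].
by move=> w; have := sqr_ge0 (X w + Y w); nra.
Qed.

Lemma square_integrable_bounded X c : square_integrable X ->
  measurable_fun setT c -> (exists C : R, forall w, `|c w| <= C) ->
  square_integrable (fun w => c w * X w).
Proof.
move=> [mX iX] mc [C cC]; split; first exact: measurable_funM.
apply: (@le_lt_trans _ _ (\int[P]_w ((C ^+ 2)%:E * ((X w) ^+ 2)%:E))%E).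
  apply: ge0_le_integral_nomeas => w _; first by rewrite lee_fin sqr_ge0.
  rewrite -EFinM lee_fin exprMn ler_wpM2r ?sqr_ge0// -real_normK ?num_real//.
  by rewrite ler_pXn2r// nnegrE// (le_trans _ (cC w)).
rewrite ge0_integralZl_EFin ?sqr_ge0//; last 2 first.
  by move=> w _; rewrite lee_fin sqr_ge0.
  by apply/measurable_EFinP; exact: measurable_funX.
by rewrite lte_mul_pinfty// lee_fin sqr_ge0.
Qed.

Lemma square_integrable_of_bounded c :
  measurable_fun setT c -> (exists C : R, forall w, `|c w| <= C) ->
  square_integrable c.
Proof.
move=> mc bc; have := square_integrable_bounded (square_integrable_cst 1) mc bc.
by under eq_fun do rewrite mulr1.
Qed.

Lemma square_integrable_integrable X : square_integrable X ->
  P.-integrable setT (EFin \o X).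
Proof.
move=> iX; have := square_integrable_mul iX (square_integrable_cst 1).
by apply: eq_integrable => // w _; rewrite /= mulr1.
Qed.

Lemma integral_sqrE X : square_integrable X ->
  (\int[P]_w ((X w) ^+ 2)%:E = (\int[P]_w (X w * X w))%:E)%E.
Proof.
move=> iX; rewrite /Rintegral fineK ?integrable_fin_num//.
exact: square_integrable_mul.
Qed.

End SquareIntegrable.

Section FiniteSums.
Context d (U : measurableType d) (R : realType).
Variable mu : {measure set U -> \bar R}.

Lemma integrable_sumr (I : Type) (r : seq I) (X : I -> U -> R) :
  (forall i, mu.-integrable setT (EFin \o X i)) ->
  mu.-integrable setT (fun w => (\sum_(i <- r) X i w)%:E).
Proof.
move=> iX; elim: r => [|i s IH].
  by under eq_fun do rewrite big_nil; exact: integrable0.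
under eq_fun do rewrite big_cons EFinD.
exact: (integrableD measurableT (iX i) IH).
Qed.

Lemma Rintegral_sum (I : Type) (r : seq I) (X : I -> U -> R) :
  (forall i, mu.-integrable setT (EFin \o X i)) ->
  \int[mu]_w (\sum_(i <- r) X i w) = \sum_(i <- r) \int[mu]_w X i w.
Proof.
move=> iX; elim: r => [|i r IH].
  under eq_Rintegral do rewrite big_nil.
  by rewrite big_nil /Rintegral integral0.
under eq_Rintegral do rewrite big_cons.
rewrite RintegralD//; last exact: integrable_sumr.
by rewrite big_cons -IH.
Qed.

Lemma ge0_integral_le_combination (D : set U) (k : R) (f g h : U -> \bar R) :
  measurable D -> 0 <= k ->
  (forall x, D x -> 0 <= f x)%E -> (forall x, D x -> 0 <= g x)%E ->
  (forall x, D x -> 0 <= h x)%E -> measurable_fun D g -> measurable_fun D h ->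
  (forall x, D x -> f x <= k%:E * (g x + h x))%E ->
  (\int[mu]_(x in D) f x <=
   k%:E * (\int[mu]_(x in D) g x + \int[mu]_(x in D) h x))%E.
Proof.
move=> mD k0 f0 g0 h0 mg mh fgh.
rewrite -ge0_integralD// -ge0_integralZl_EFin//.
- exact: ge0_le_integral_nomeas.
- by move=> x Dx; rewrite adde_ge0 ?g0 ?h0.
- exact: emeasurable_funD.
Qed.

End FiniteSums.

Section ParameterIntegral.
Context d (U : measurableType d) (R : realType) (P : probability U R).
Variables (D : set (measurableTypeR R)) (g : U * measurableTypeR R -> \bar R).
Hypothesis mD : measurable D.
Hypothesis mg : measurable_fun (setT `*` D) g.
Hypothesis g0 : forall w r, D r -> (0 <= g (w, r))%E.
Local Notation mu := (@lebesgue_measure R).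

Let mUD : measurable (setT `*` D : set (U * measurableTypeR R)).
Proof. exact: measurableX. Qed.

Let gD := g \_ (setT `*` D).

Let mgD : measurable_fun setT gD.
Proof. by apply/(measurable_restrictT _ mUD). Qed.

Let gD0 p : (0 <= gD p)%E.
Proof.
rewrite /gD patchE; case: ifPn => // /set_mem[_].
by case: p => w r Dr; exact: g0.
Qed.

Let gDE w r : gD (w, r) = ((fun r => g (w, r)) \_ D) r.
Proof.
rewrite /gD !patchE; congr (if _ then _ else _); apply/idP/idP => /set_mem h; apply/mem_set => //.
by case: h.
Qed.

Lemma measurable_section w : measurable_fun D (fun r => g (w, r)).
Proof.
apply/(measurable_restrictT _ mD).
have -> : (fun r => g (w, r)) \_ D = (fun r => gD (w, r)) by apply/funext => r; rewrite gDE.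
exact: measurable_fun_pair2.
Qed.

Lemma measurable_parameter_integral :
  measurable_fun setT (fun w => \int[mu]_(r in D) g (w, r))%E.
Proof.
have -> : (fun w => \int[mu]_(r in D) g (w, r))%E = fubini_F mu gD.
  apply/funext => w; rewrite /fubini_F [LHS]integral_mkcond.
  by apply: eq_integral => r _; rewrite gDE.
exact: measurable_fun_fubini_tonelli_F.
Qed.

Lemma measurable_expectation_section :
  measurable_fun D (fun r => \int[P]_w g (w, r))%E.
Proof.
apply/(measurable_restrictT _ mD).
have -> : (fun r => \int[P]_w g (w, r))%E \_ D = fubini_G P gD.
  apply/funext => r; rewrite /fubini_G patchE; case: ifPn => rD.
    by apply: eq_integral => w _; rewrite gDE patchE rD.
  rewrite integral0_eq// => w _; rewrite gDE patchE.
  by rewrite (negbTE rD).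
exact: measurable_fun_fubini_tonelli_G.
Qed.

Lemma expectation_parameter_integral :
  (\int[P]_w \int[mu]_(r in D) g (w, r) = \int[mu]_(r in D) \int[P]_w g (w, r))%E.
Proof.
transitivity (\int[P]_w \int[mu]_r gD (w, r))%E.
  apply: eq_integral => w _; rewrite [LHS]integral_mkcond.
  by apply: eq_integral => r _; rewrite gDE.
rewrite fubini_tonelli// [RHS]integral_mkcond.
apply: eq_integral => r _; rewrite patchE; case: ifPn => rD.
  by apply: eq_integral => w _; rewrite gDE patchE rD.
rewrite integral0_eq// => w _; rewrite gDE patchE.
by rewrite (negbTE rD).
Qed.

End ParameterIntegral.

(** * Increments of Brownian motion *)

Section NormalIntegrable.
Context (R : realType).

Lemma normal_integrable_sqr (s : R) : 0 < s ->
  (normal_prob 0 s).-integrable [set: measurableTypeR R] (fun x => (x ^+ 2)%:E).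
Proof.
move=> s0; apply/integrableP; split.
  by apply/measurable_EFinP; exact: measurable_funX.
apply: (@le_lt_trans _ _ (\int[normal_prob 0%R s]_x (x ^+ 2)%:E)%E).
  apply: ge0_le_integral_nomeas => x _; first exact: abse_ge0.
  by rewrite /= ger0_norm// sqr_ge0.
rewrite integral_normal_sqr// lte_mul_pinfty ?lee_fin ?sqr_ge0//.
exact: normal_moment2_lty.
Qed.

Lemma normal_integrable_id (s : R) : 0 < s ->
  (normal_prob 0 s).-integrable [set: measurableTypeR R] (fun x => x%:E).
Proof.
move=> s0.
have i1 := finite_measure_integrable_cst (normal_prob 0 s) 1 measurableT.
have i2 := integrableD measurableT i1 (normal_integrable_sqr s0).
apply: le_integrable i2 => //.
  by apply/measurable_EFinP; exact: measurable_id.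
move=> x _ /=; rewrite lee_fin [leRHS]ger0_norm ?addr_ge0 ?sqr_ge0//.
rewrite ler_norml; apply/andP; split; nra.
Qed.

(** The second moment of the standard normal law, kept symbolic: the estimates
    below hold up to constants, and use that it is positive and finite. *)
Definition gauss_variance : R := fine (normal_moment2 R).

Lemma gauss_varianceE : (normal_moment2 R = gauss_variance%:E)%E.
Proof.
rewrite /gauss_variance fineK// ge0_fin_numE ?normal_moment2_lty//.
exact/ltW/normal_moment2_gt0.
Qed.

Lemma gauss_variance_gt0 : 0 < gauss_variance.
Proof. by rewrite -lte_fin -gauss_varianceE; exact: normal_moment2_gt0. Qed.

End NormalIntegrable.

Section BrownianIncrements.
Context d (Omega : measurableType d) (R : realType) (P : probability Omega R) (T : R)
 (F : R -> set (set Omega)) (B : R -> Omega -> R).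
Hypothesis Ffil : filtration T F.
Hypothesis Bbm : brownian_motion P T F B.
Let k2 : R := gauss_variance R.
Definition incr u v (w : Omega) : R := B v w - B u w.

Lemma filtration_measurable u : 0 <= u <= T -> F u `<=` measurable.
Proof. by case: Ffil => _ + _; exact. Qed.

Lemma filtration_mono u v : 0 <= u -> u <= v -> v <= T -> F u `<=` F v.
Proof. by case: Ffil => _ _; exact. Qed.

Lemma measurable_wrt_B u v : 0 <= u -> u <= v -> v <= T -> measurable_wrt (F v) (B u).
Proof.
move=> u0 uv vT; apply: (measurable_wrt_sub (filtration_mono u0 uv vT)).
by case: Bbm => _ + _ _ _; apply; rewrite u0 (le_trans uv).
Qed.

Lemma measurable_B u : 0 <= u <= T -> measurable_fun setT (B u).
Proof. by case: Bbm => + _ _ _ _; apply. Qed.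

Lemma incr_id u : incr u u = cst 0.
Proof. by apply/funext => w; rewrite /incr subrr. Qed.

Lemma integral_mul_incr_fun u v (X : Omega -> R) (g : R -> R) :
  0 <= u -> u < v -> v <= T -> measurable_wrt (F u) X ->
  P.-integrable setT (EFin \o X) ->
  measurable_fun [set: measurableTypeR R] g ->
  (normal_prob 0 (Num.sqrt (v - u))).-integrable setT (EFin \o g) ->
  P.-integrable setT (fun w => (X w * g (incr u v w))%:E) /\
  (\int[P]_w (X w * g (incr u v w))%:E =
    \int[P]_w (X w)%:E * \int[normal_prob 0%R (Num.sqrt (v - u))]_x (g x)%:E)%E.
Proof.
move=> u0 uv vT mX iX mg ig.
have uT : 0 <= u <= T by rewrite u0 (le_trans (ltW uv)).
have v0T : 0 <= v <= T by rewrite vT (le_trans u0 (ltW uv)).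
have [_ _ _ _ law] := Bbm.
apply: (indep_integralM (G := F u)) => //.
- by case: Ffil => + _ _; apply.
- exact: filtration_measurable.
- by apply: measurable_funB; exact: measurable_B.
- by move=> C mC; have [] := law _ _ u0 uv vT C mC.
- by move=> A C FA mC; have [_ ] := law _ _ u0 uv vT C mC; apply.
Qed.

Lemma sqrt_incr_gt0 (u v : R) : u < v -> 0 < Num.sqrt (v - u).
Proof. by move=> uv; rewrite sqrtr_gt0 subr_gt0. Qed.

Lemma measurable_incr u v : 0 <= u -> u <= v -> v <= T -> measurable_fun setT (incr u v).
Proof.
move=> u0 uv vT; apply: measurable_funB; apply: measurable_B.
  by rewrite vT (le_trans u0).
by rewrite u0 (le_trans uv).
Qed.

Lemma square_integrable_incr u v : 0 <= u -> u <= v -> v <= T ->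
  square_integrable P (incr u v).
Proof.
move=> u0; rewrite le_eqVlt => /predU1P[<- _|uv vT].
  by rewrite incr_id; exact: square_integrable_cst.
split; first exact: measurable_incr (ltW uv) _.
have s0 := sqrt_incr_gt0 uv.
have [||||/integrableP[_ i2] _] := @integral_mul_incr_fun u v (cst 1) (fun x => x ^+ 2) u0 uv vT.
- exact: measurable_cst.
- exact: finite_measure_integrable_cst.
- exact: measurable_funX.
- exact: normal_integrable_sqr.
apply: le_lt_trans i2; apply: ge0_le_integral_nomeas => w _.
  by rewrite lee_fin sqr_ge0.
by rewrite /= mul1r ger0_norm ?sqr_ge0.
Qed.

Lemma expectation_mul_incr u v X : 0 <= u -> u <= v -> v <= T ->
  measurable_wrt (F u) X -> square_integrable P X ->
  \int[P]_w (X w * incr u v w) = 0.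
Proof.
move=> u0; rewrite le_eqVlt => /predU1P[<- _ _ _|uv vT mX iX].
  by rewrite incr_id; under eq_Rintegral do rewrite mulr0; rewrite Rintegral_cst// mul0r.
have s0 := sqrt_incr_gt0 uv.
have [|||_] := @integral_mul_incr_fun u v X id u0 uv vT mX.
- exact: square_integrable_integrable.
- exact: measurable_id.
- exact: normal_integrable_id.
by rewrite integral_normal_id// mule0 /Rintegral => ->.
Qed.

Lemma expectation_mul_incr_sqr u v X : 0 <= u -> u <= v -> v <= T ->
  measurable_wrt (F u) X -> P.-integrable setT (EFin \o X) ->
  \int[P]_w (X w * (incr u v w) ^+ 2) = k2 * (v - u) * \int[P]_w X w.
Proof.
move=> u0; rewrite le_eqVlt => /predU1P[<- _ _ _|uv vT mX iX].
  rewrite incr_id; under eq_Rintegral do rewrite expr0n mulr0.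
  by rewrite Rintegral_cst// mul0r subrr mulr0 mul0r.
have s0 := sqrt_incr_gt0 uv.
have [||_] := @integral_mul_incr_fun u v X (fun x => x ^+ 2) u0 uv vT mX iX.
- exact: measurable_funX.
- exact: normal_integrable_sqr.
rewrite integral_normal_sqr// sqr_sqrtr ?subr_ge0 ?ltW// gauss_varianceE.
rewrite /Rintegral => ->; rewrite -EFinM fineM//=.
  by rewrite mulrC [(v - u) * _]mulrC.
exact: integrable_fin_num.
Qed.

(** The longer increment is the shorter one plus an increment posterior to [v],
    which is centred and independent of everything known at time [v]. *)
Lemma expectation_mul_incr_incr u v v' X : 0 <= u -> u <= v -> v <= v' -> v' <= T ->
  measurable_wrt (F u) X -> (exists C : R, forall w, `|X w| <= C) ->
  \int[P]_w (X w * incr u v w * incr u v' w) = k2 * (v - u) * \int[P]_w X w.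
Proof.
move=> u0 uv vv' v'T mX bX.
have vT := le_trans vv' v'T; have v0 := le_trans u0 uv.
have mX' : measurable_fun setT X.
  by apply: measurable_wrtW mX; apply: filtration_measurable; rewrite u0 (le_trans uv).
have iX := square_integrable_of_bounded P mX' bX.
have iI := square_integrable_incr u0 uv vT.
have iXI := square_integrable_bounded iI mX' bX.
rewrite -expectation_mul_incr_sqr//; last exact: square_integrable_integrable.
transitivity (\int[P]_w (X w * (incr u v w) ^+ 2) +
    \int[P]_w (X w * incr u v w * incr v v' w)).
  rewrite -RintegralD//; last 2 first.
  - have := square_integrable_mul iXI iI.
    by apply: eq_integrable => // w _; rewrite /= expr2 mulrA.
  - exact: square_integrable_mul iXI (square_integrable_incr v0 vv' v'T).
  by apply: eq_Rintegral => w _; rewrite /incr; ring.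
rewrite [X in _ + X]expectation_mul_incr ?addr0//.
apply: measurable_funM.
  exact: measurable_wrt_sub (filtration_mono u0 uv vT) mX.
apply: measurable_funB; first exact: measurable_wrt_B.
exact: measurable_wrt_B.
Qed.

(** The length of the intersection of the two half-open intervals. *)
Definition overlap (s t s' t' : R) : R :=
  Num.max 0 (Num.min t t' - Num.max s s').

Lemma overlapC s t s' t' : overlap s t s' t' = overlap s' t' s t.
Proof. by rewrite /overlap minC maxC [Num.max s s']maxC [in RHS]maxC. Qed.

(** With [s <= s'], the part of the first increment before [s'] is known when the
    second one starts and contributes nothing; the rest starts at [s'] as well,
    where [expectation_mul_incr_incr] applies. *)
Lemma expectation_elementary s t s' t' (c c' : Omega -> R) :
  0 <= s -> s <= t -> t <= T -> 0 <= s' -> s' <= t' -> t' <= T ->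
  measurable_wrt (F s) c -> measurable_wrt (F s') c' ->
  (exists C : R, forall w, `|c w| <= C) -> (exists C : R, forall w, `|c' w| <= C) ->
  \int[P]_w ((c w * incr s t w) * (c' w * incr s' t' w)) =
  k2 * (overlap s t s' t' * \int[P]_w (c w * c' w)).
Proof.
wlog ss' : s t s' t' c c' / s <= s'.
  move=> H s0 st tT s'0 s't' t'T mc mc' bc bc'.
  have [ss'|/ltW s's] := leP s s'; first exact: H.
  rewrite overlapC; under eq_Rintegral do rewrite mulrC.
  by rewrite H//; under [in LHS]eq_Rintegral do rewrite mulrC.
move=> s0 st tT s'0 s't' t'T mc mc' bc bc'.
have mc1 : measurable_wrt (F s') c.
  by apply: measurable_wrt_sub mc; apply: filtration_mono => //; exact: le_trans t'T.
have s'T : 0 <= s' <= T by rewrite s'0 (le_trans s't').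
have mcT : measurable_fun setT c by apply: measurable_wrtW mc1; exact: filtration_measurable.
have mcT' : measurable_fun setT c' by apply: measurable_wrtW mc'; exact: filtration_measurable.
have mcc : measurable_wrt (F s') (fun w => c w * c' w) by exact: measurable_funM.
have bcc : exists C : R, forall w, `|c w * c' w| <= C.
  case: bc => C hC; case: bc' => C' hC'; exists (C * C') => w.
  by rewrite normrM ler_pM.
have mccT : measurable_fun setT (fun w => c w * c' w) by exact: measurable_funM.
have early v : s <= v -> v <= s' ->
    \int[P]_w (c w * incr s v w * (c' w * incr s' t' w)) = 0.
  move=> sv vs'.
  under eq_Rintegral do rewrite mulrA.
  apply: expectation_mul_incr => //.
    apply: measurable_funM => //; apply: measurable_funM => //.
    apply: measurable_funB; apply: measurable_wrt_B => //.
    - exact: le_trans sv.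
    - by case/andP: s'T.
    - by case/andP: s'T.
  have -> : (fun w => c w * incr s v w * c' w) = (fun w => c w * c' w * incr s v w).
    by apply/funext => w; rewrite mulrAC.
  apply: square_integrable_bounded => //.
  by apply: square_integrable_incr => //; rewrite (le_trans vs')//; case/andP: s'T.
have [ts'|/ltW s't] := leP t s'.
  rewrite early// /overlap (max_r ss') max_l ?mul0r ?mulr0//.
  by rewrite subr_le0 ge_min ts'.
have iI' := square_integrable_bounded (square_integrable_incr s'0 s't' t'T) mcT' bc'.
transitivity (\int[P]_w (c w * incr s s' w * (c' w * incr s' t' w)) +
    \int[P]_w (c w * c' w * incr s' t w * incr s' t' w)).
  rewrite -RintegralD//.
  - by apply: eq_Rintegral => w _; rewrite /incr; ring.
  - apply: square_integrable_mul iI'; apply: square_integrable_bounded => //.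
    by apply: square_integrable_incr => //; case/andP: s'T.
  - apply: square_integrable_mul; last exact: square_integrable_incr.
    by apply: square_integrable_bounded => //; exact: square_integrable_incr.
rewrite early// add0r /overlap (max_r ss').
have [tt'|/ltW t't] := leP t t'.
  by rewrite expectation_mul_incr_incr// max_r ?subr_ge0// mulrA.
under eq_Rintegral do rewrite mulrAC.
by rewrite expectation_mul_incr_incr// max_r ?subr_ge0// mulrA.
Qed.

End BrownianIncrements.

(** * Elementary stochastic integrals *)

Section Elementary.
Context d (Omega : measurableType d) (R : realType) (P : probability Omega R) (T : R)
 (F : R -> set (set Omega)) (B : R -> Omega -> R).
Hypothesis Ffil : filtration T F.
Hypothesis Bbm : brownian_motion P T F B.
Local Notation k2 := (gauss_variance R).
Local Notation mu := (@lebesgue_measure R).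

Lemma itvoc_setI (s t s' t' : R) :
  `]s, t] `&` `]s', t'] = `]Num.max s s', Num.min t t']%classic :> set R.
Proof.
apply/seteqP; split => x /=; rewrite !in_itv/= gt_max le_min.
  by move=> [/andP[-> ->] /andP[-> ->]].
by move=> /andP[/andP[-> ->] /andP[-> ->]].
Qed.

Lemma lebesgue_overlap (s t s' t' : R) :
  mu (`]s, t] `&` `]s', t']) = (overlap s t s' t')%:E.
Proof.
rewrite itvoc_setI lebesgue_measure_itv/= lte_fin /overlap.
case: ltP => h; first by rewrite [Num.max 0 _]max_r ?EFinB// subr_ge0 ltW.
by rewrite [Num.max 0 _]max_l// subr_le0.
Qed.

Variables (I : finType) (c : I -> Omega -> R) (s t : I -> R).

(** A sum of terms [c i * 1_(s i, t i]] over any finite type, the intervals being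
    allowed to overlap: the difference of two simple processes with unrelated
    grids has this form without a common refinement. *)
Record elementary_data : Prop := ElementaryData {
  elem_ge0 : forall i, 0 <= s i;
  elem_le : forall i, s i <= t i;
  elem_leT : forall i, t i <= T;
  elem_meas : forall i, measurable_wrt (F (s i)) (c i);
  elem_bnd : forall i, exists C : R, forall w, `|c i w| <= C }.

Hypothesis eld : elementary_data.

Definition elementary_integral w := \sum_i c i w * incr B (s i) (t i) w.
Definition elementary_value r w := \sum_i c i w * \1_(`]s i, t i]) r.

Let sT i : 0 <= s i <= T.
Proof.
by rewrite (elem_ge0 eld)/= (le_trans (elem_le eld i))// (elem_leT eld).
Qed.

Lemma elementary_coef_measurable i : measurable_fun setT (c i).
Proof.
apply: measurable_wrtW (@elem_meas eld i).
by apply: (filtration_measurable Ffil); exact: sT.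
Qed.

Lemma square_integrable_coef_incr i :
  square_integrable P (fun w => c i w * incr B (s i) (t i) w).
Proof.
apply: square_integrable_bounded (elementary_coef_measurable i) (elem_bnd eld i).
apply: (square_integrable_incr Ffil Bbm); first exact: (elem_ge0 eld).
  exact: (elem_le eld).
exact: (elem_leT eld).
Qed.

Lemma square_integrable_elementary : square_integrable P elementary_integral.
Proof.
rewrite /elementary_integral; elim: (index_enum I) => [|i r IH].
  by under eq_fun do rewrite big_nil; exact: square_integrable_cst.
under eq_fun do rewrite big_cons; apply: square_integrableD => //.
exact: square_integrable_coef_incr.
Qed.

Let integrable_coef i j : P.-integrable setT (fun w => (c i w * c j w)%:E).
Proof.
by apply: square_integrable_mul; apply: square_integrable_of_bounded;
  do ?[exact: elementary_coef_measurable | exact: elem_bnd].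
Qed.

Lemma elementary_integral_sqr :
  (\int[P]_w ((elementary_integral w) ^+ 2)%:E =
   (k2 * \sum_i \sum_j overlap (s i) (t i) (s j) (t j) * \int[P]_w (c i w * c j w))%:E)%E.
Proof.
rewrite integral_sqrE; last exact: square_integrable_elementary.
congr EFin.
under eq_Rintegral do rewrite /elementary_integral big_distrlr/=.
have ip i j : P.-integrable setT (EFin \o (fun w =>
    c i w * incr B (s i) (t i) w * (c j w * incr B (s j) (t j) w))).
  by apply: square_integrable_mul; exact: square_integrable_coef_incr.
rewrite Rintegral_sum; last by move=> i; exact: integrable_sumr.
rewrite mulr_sumr; apply: eq_bigr => i _.
rewrite Rintegral_sum// mulr_sumr; apply: eq_bigr => j _.
apply: (expectation_elementary Ffil Bbm);
  do ?[exact: (elem_ge0 eld) | exact: (elem_le eld) | exact: (elem_leT eld)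
      | exact: (elem_meas eld) | exact: (elem_bnd eld)].
Qed.

Lemma elementary_value_sqr w :
  (\int[mu]_r ((elementary_value r w) ^+ 2)%:E =
   (\sum_i \sum_j overlap (s i) (t i) (s j) (t j) * (c i w * c j w))%:E)%E.
Proof.
pose X i j (r : measurableTypeR R) : R := (c i w * c j w) * \1_(`]s i, t i] `&` `]s j, t j]) r.
have iX i j : mu.-integrable setT (EFin \o X i j).
  rewrite /X itvoc_setI; have := integrableZl measurableT (c i w * c j w)
    (@integrable_indic_itv R (Num.max (s i) (s j)) (Num.min (t i) (t j)) false false).
  by apply: eq_integrable => // r _; rewrite /= EFinM.
have E : (fun r => ((elementary_value r w) ^+ 2)%:E) = EFin \o (fun r => \sum_i \sum_j X i j r).
  apply/funext => r /=; congr EFin.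
  rewrite /elementary_value expr2 big_distrlr/=; apply: eq_bigr => i _; apply: eq_bigr => j _.
  by rewrite /X indicI /=; ring.
have iS : mu.-integrable setT (EFin \o (fun r => \sum_i \sum_j X i j r)).
  by apply: integrable_sumr => i; exact: integrable_sumr.
rewrite E -[LHS]fineK ?integrable_fin_num//; congr EFin.
rewrite -[LHS]/(\int[mu]_r (\sum_i \sum_j X i j r)).
rewrite Rintegral_sum; last by move=> i; exact: integrable_sumr.
apply: eq_bigr => i _; rewrite Rintegral_sum//; apply: eq_bigr => j _.
rewrite /X RintegralZl//.
  move: (congr1 fine (lebesgue_overlap (s i) (t i) (s j) (t j))); rewrite itvoc_setI => h.
  rewrite mulrC; congr (_ * _); rewrite /Rintegral integral_indic// setIT; exact: h.
by rewrite itvoc_setI; exact: integrable_indic_itv.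
Qed.

(** After expanding both squares, the term [(i, j)] is on each side a multiple of
    the overlap of the two intervals times [E(c i * c j)]. *)
Lemma elementary_isometry :
  (\int[P]_w ((elementary_integral w) ^+ 2)%:E =
   k2%:E * \int[P]_w \int[mu]_r ((elementary_value r w) ^+ 2)%:E)%E.
Proof.
rewrite elementary_integral_sqr.
under [X in (_ * X)%E]eq_integral do rewrite elementary_value_sqr.
have ic i j : P.-integrable setT (EFin \o (fun w =>
    overlap (s i) (t i) (s j) (t j) * (c i w * c j w))).
  by have := integrableZl measurableT (overlap (s i) (t i) (s j) (t j)) (integrable_coef i j).
rewrite EFinM; congr (_ * _)%E.
rewrite -[RHS]fineK; last first.
  apply: integrable_fin_num => //.
  by apply: integrable_sumr => i; exact: integrable_sumr.
congr EFin; rewrite -[RHS]/(\int[P]_w (\sum_i \sum_j overlap (s i) (t i) (s j) (t j) * (c i w * c j w))).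
rewrite Rintegral_sum; last by move=> i; exact: integrable_sumr.
apply: eq_bigr => i _; rewrite Rintegral_sum//; apply: eq_bigr => j _.
by rewrite RintegralZl//; exact: integrable_coef.
Qed.

(** An integral over times after [u] is orthogonal to whatever is known at time
    [u], so the cross term of the square vanishes. *)
Lemma elementary_orthogonal u (eta : Omega -> R) :
  0 <= u <= T -> (forall i, u <= s i) -> measurable_wrt (F u) eta ->
  square_integrable P eta ->
  (\int[P]_w ((eta w) ^+ 2)%:E <= \int[P]_w ((eta w + elementary_integral w) ^+ 2)%:E)%E.
Proof.
move=> /andP[u0 uT] us meta ieta.
have iS := square_integrable_elementary.
have iE := square_integrableD ieta iS.
have i1 := square_integrable_mul ieta ieta.
have i2 := square_integrable_mul iS iS.
have i3 := square_integrable_mul ieta iS.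
have cross : \int[P]_w (eta w * elementary_integral w) = 0.
  rewrite /elementary_integral; under eq_Rintegral do rewrite mulr_sumr.
  rewrite Rintegral_sum; last first.
    by move=> i; apply: square_integrable_mul => //; exact: square_integrable_coef_incr.
  apply: big1 => i _; under eq_Rintegral do rewrite mulrA.
  have mci := @elem_meas eld i.
  have FsM := filtration_mono Ffil u0 (us i) (le_trans (elem_le eld i) (elem_leT eld i)).
  apply: (expectation_mul_incr Ffil Bbm).
  - exact: (elem_ge0 eld).
  - exact: (elem_le eld).
  - exact: (elem_leT eld).
  - by apply: measurable_funM => //; exact: measurable_wrt_sub meta.
  - under eq_fun do rewrite mulrC.
    apply: square_integrable_bounded => //; first exact: elementary_coef_measurable.
    exact: (elem_bnd eld).
rewrite !integral_sqrE// lee_fin.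
rewrite [X in _ <= X](_ : _ = \int[P]_w (eta w * eta w) + \int[P]_w (elementary_integral w * elementary_integral w)).
  rewrite lerDl; apply: Rintegral_ge0 => w _; exact: sqr_ge0.
transitivity (\int[P]_w ((eta w * eta w + elementary_integral w * elementary_integral w) + 2 * (eta w * elementary_integral w))).
  by apply: eq_Rintegral => w _; ring.
have i3' := integrableZl measurableT 2 i3.
rewrite RintegralD//; last exact: (integrableD measurableT i1 i2).
by rewrite RintegralD// RintegralZl// cross mulr0 addr0.
Qed.

End Elementary.

(** * Joint measurability of processes *)

Section JointMeasurability.
Context d (Omega : measurableType d) (R : realType) (T : R)
 (F : R -> set (set Omega)).
Hypothesis Ffil : filtration T F.
Implicit Types X Y Z : R -> Omega -> R.

Definition jointly_measurable X :=
  measurable_fun (setT `*` `[0, T]) (fun p : Omega * measurableTypeR R => X p.2 p.1).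

(** The ascription on the pair in [predictable] leaves the product sigma-algebra
    of [Omega * R] in place, so both sides unfold to the same statement. *)
Lemma predictable_jointly_measurable Z : predictable T F Z -> jointly_measurable Z.
Proof. exact. Qed.

Lemma adapted_measurable Y u : adapted T F Y -> 0 <= u <= T -> measurable_fun setT (Y u).
Proof.
move=> aY uT; apply: measurable_wrtW (aY _ uT).
exact: (filtration_measurable Ffil).
Qed.

Lemma truncn_grid_itv (n : nat) (r : R) : 0 <= r ->
  (Num.truncn (n.+1%:R * r))%:R / n.+1%:R <= r < (Num.truncn (n.+1%:R * r)).+1%:R / n.+1%:R.
Proof.
move=> r0; rewrite ler_pdivrMr// ltr_pdivlMr// mulrC.
by apply: truncn_itv; rewrite mulr_ge0.
Qed.

(** The process is the limit of its values at the last point of a grid of mesh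
    [1 / n.+1], which are measurable grid cell by grid cell. *)
Lemma continuous_jointly_measurable Y :
  (forall u, 0 <= u <= T -> measurable_fun setT (Y u)) -> continuous_paths T Y ->
  jointly_measurable Y.
Proof.
move=> mY cY; rewrite /jointly_measurable.
pose a n (r : R) : R := (Num.truncn (n.+1%:R * r))%:R / n.+1%:R.
apply: (@measurable_fun_cvg _ _ _ _ (fun n (p : Omega * measurableTypeR R) => Y (a n p.2) p.1)).
- move=> n _ C mC.
  have -> : (setT `*` `[0, T]) `&` (fun p : Omega * measurableTypeR R => Y (a n p.2) p.1) @^-1` C
    = \bigcup_k ((Y (k%:R / n.+1%:R) @^-1` C) `*`
        (`[0, T] `&` `[k%:R / n.+1%:R, k.+1%:R / n.+1%:R[)).
    apply/seteqP; split => [[w r] /= [[_ rT] Cr]|[w r] /= [k _ [/= Cr [rT rk]]]].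
      exists (Num.truncn (n.+1%:R * r)) => //=; split => //; split => //.
      by rewrite in_itv/= truncn_grid_itv//; move: rT; rewrite in_itv/= => /andP[].
    split => //; rewrite /preimage/= /a; suff -> : Num.truncn (n.+1%:R * r) = k by [].
    apply: truncn_def; move: rk; rewrite in_itv/= => /andP[].
    by rewrite ler_pdivrMr// ltr_pdivlMr// mulrC => -> ->.
  apply: bigcupT_measurable => k; have [kT|Tk] := leP (k%:R / n.+1%:R) T.
    apply: measurableX; last exact: measurableI.
    by rewrite -[X in measurable X]setTI; apply: mY => //; rewrite kT divr_ge0.
  rewrite (_ : `[0, T] `&` _ = set0) ?setX0//.
  rewrite -subset0 => r /= []; rewrite !in_itv/= => /andP[_ rT] /andP[kr _].
  by have := lt_le_trans Tk (le_trans kr rT); rewrite ltxx.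
- move=> [w r] /= [_ rT].
  have /(_ r rT) cr := (subspace_continuousP _ _).1 (cY w).
  have r0 : 0 <= r by move: rT; rewrite in_itv/= => /andP[].
  apply: (@cvg_comp _ _ _ (fun n => a n r) (Y ^~ w) _ (within `[0, T] (nbhs r))) cr.
  move=> A; rewrite /within/= => -[e /= e0 eA].
  near=> n; apply: eA; last first.
    have := truncn_grid_itv n r0; rewrite -/(a n r) => /andP[ar _].
    move: rT; rewrite !in_itv/= => /andP[_ rT]; rewrite (le_trans ar rT) andbT.
    by rewrite divr_ge0.
  have /andP[ar ra] := truncn_grid_itv n r0; rewrite /ball/= ger0_norm ?subr_ge0//.
  rewrite ltrBlDr -ltrBlDl; apply: le_lt_trans (_ : _ <= r - n.+1%:R^-1) _; last first.
    move: ra; rewrite -[(Num.truncn _).+1%:R]natr1 mulrDl mul1r -/(a n r).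
    by rewrite ltrBlDr.
  rewrite lerB//; apply: ltW; near: n; exact: (near_infty_natSinv_lt (PosNum e0)).
Unshelve. all: by end_near. Qed.

End JointMeasurability.

(** * Tails of simple processes *)

Section SimpleTails.
Context d (Omega : measurableType d) (R : realType) (P : probability Omega R) (T : R)
 (F : R -> set (set Omega)) (B : R -> Omega -> R).
Hypothesis Ffil : filtration T F.
Variables (u : R).
Hypothesis uT : 0 <= u <= T.
Local Notation mu := (@lebesgue_measure R).

Section OneProcess.
Variable H : simple_process T F.

Lemma sp_time_max i : (i <= sp_size H)%N -> 0 <= Num.max (sp_time H i) u <= T.
Proof.
move=> iH; have /andP[t0 tT] := sp_time_itv (s:=H) iH.
by case/andP: uT => u0 uT'; rewrite le_max t0 ge_max tT uT'.
Qed.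

Lemma sp_coef_measurable i : (i < sp_size H)%N ->
  measurable_wrt (F (Num.max (sp_time H i) u)) (sp_coef H i).
Proof.
move=> iH; apply: measurable_wrt_sub (sp_coef_meas iH).
have /andP[t0 tT] := sp_time_itv (s:=H) (ltnW iH).
have /andP[_ mT] := sp_time_max (ltnW iH).
by apply: (filtration_mono Ffil) => //; rewrite le_max lexx.
Qed.

Lemma B_min_max x w : x <= T ->
  B (Num.min x T) w - B (Num.min x u) w = B (Num.max x u) w - B u w.
Proof.
move=> xT; rewrite (min_l xT); case: (leP x u) => // _.
by rewrite !subrr.
Qed.

(** The increment of the integral over [[u, T]] is again an elementary integral,
    with every time [t] of the grid replaced by [max t u]. *)
Lemma sp_integral_tail w :
  sp_integral B H T w - sp_integral B H u w =
  \sum_(i < sp_size H) sp_coef H i w *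
    incr B (Num.max (sp_time H i) u) (Num.max (sp_time H i.+1) u) w.
Proof.
rewrite /sp_integral -sumrB; apply: eq_bigr => i _; rewrite -mulrBr; congr (_ * _).
have /andP[_ t1] := sp_time_itv (s:=H) (ltnW (ltn_ord i)).
have /andP[_ t2] := sp_time_itv (s:=H) (ltn_ord i).
have h1 := B_min_max w t1; have h2 := B_min_max w t2.
rewrite /incr.
rewrite (_ : _ - _ = (B (Num.min (sp_time H i.+1) T) w - B (Num.min (sp_time H i.+1) u) w) -
   (B (Num.min (sp_time H i) T) w - B (Num.min (sp_time H i) u) w)); last by ring.
by rewrite h1 h2; ring.
Qed.

Lemma sp_val_tail r w : u < r ->
  sp_val H r w = \sum_(i < sp_size H) sp_coef H i w *
    \1_(`]Num.max (sp_time H i) u, Num.max (sp_time H i.+1) u]) r.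
Proof.
move=> ur; apply: eq_bigr => i _; congr (_ * _); rewrite !indicE; congr (_%:R).
congr nat_of_bool; apply/idP/idP => /set_mem/=; rewrite in_itv/= => h;
  apply/mem_set => /=; move: h; rewrite in_itv/= gt_max le_max ur andbT.
  by move=> /andP[-> ->].
by rewrite (leNgt r u) ur orbF.
Qed.

End OneProcess.

Variables H1 H2 : simple_process T F.
Local Notation I := ('I_(sp_size H1) + 'I_(sp_size H2))%type.

(** The restriction to [(u, T]] of the difference of two simple processes, indexed
    by the disjoint union of the two index sets. *)
Definition tail_coef (i : I) : Omega -> R :=
  match i with inl i => sp_coef H1 i | inr j => fun w => - sp_coef H2 j w end.
Definition tail_left (i : I) : R :=
  match i with inl i => Num.max (sp_time H1 i) u | inr j => Num.max (sp_time H2 j) u end.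
Definition tail_right (i : I) : R :=
  match i with inl i => Num.max (sp_time H1 i.+1) u | inr j => Num.max (sp_time H2 j.+1) u end.

Lemma tail_data : elementary_data T F tail_coef tail_left tail_right.
Proof.
split => [[i|i]|[i|i]|[i|i]|[i|i]|[i|i]] /=.
- by have /andP[] := sp_time_max (ltnW (ltn_ord i)).
- by have /andP[] := sp_time_max (ltnW (ltn_ord i)).
- by rewrite ge_max !le_max (sp_time_le (ltn_ord i)) lexx orbT.
- by rewrite ge_max !le_max (sp_time_le (ltn_ord i)) lexx orbT.
- by have /andP[] := sp_time_max (ltn_ord i).
- by have /andP[] := sp_time_max (ltn_ord i).
- exact: sp_coef_measurable.
- apply: measurable_funN; exact: sp_coef_measurable.
- exact: sp_coef_bnd.
- have [C hC] := sp_coef_bnd (s:=H2) (ltn_ord i).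
  by exists C => w; rewrite normrN.
Qed.

Lemma tail_left_ge i : u <= tail_left i.
Proof. by case: i => i /=; rewrite le_max lexx orbT. Qed.

Lemma tail_integralE w :
  elementary_integral B tail_coef tail_left tail_right w =
  (sp_integral B H1 T w - sp_integral B H1 u w) -
  (sp_integral B H2 T w - sp_integral B H2 u w).
Proof.
rewrite /elementary_integral big_sumType/= !sp_integral_tail; congr (_ + _).
by rewrite -sumrN; apply: eq_bigr => i _; rewrite mulNr.
Qed.

Lemma tail_valueE r w : u < r ->
  elementary_value tail_coef tail_left tail_right r w = sp_val H1 r w - sp_val H2 r w.
Proof.
move=> ur; rewrite /elementary_value big_sumType/= !(sp_val_tail _ _ ur); congr (_ + _).
by rewrite -sumrN; apply: eq_bigr => i _; rewrite mulNr.
Qed.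

End SimpleTails.

(** * Mean-square inequalities *)

Section CvgZero.
Context (R : realType).

Lemma cvge0_near_le (f : nat -> \bar R) (e : R) : f @ \oo --> 0%E -> 0 < e ->
  \forall n \near \oo, (f n <= e%:E)%E.
Proof.
move=> f0 e0; apply: (f0 [set x | (x <= e%:E)%E]).
exists e => // x /=; rewrite sub0r normrN => xe.
by rewrite lee_fin (le_trans (ler_norm _) (ltW xe)).
Qed.

(** The arbitrarily small error may be multiplied by any constant, so error terms
    need not be normalised in the limit arguments. *)
Lemma lee_addgt0_scaled (x y : \bar R) (k : R) :
  (forall e : R, 0 < e -> (x <= y + (k * e)%:E)%E) -> (x <= y)%E.
Proof.
move=> h; apply/lee_addgt0Pr => e e0.
have k0 : 0 < `|k| + 1 by rewrite ltr_wpDl.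
apply: le_trans (h (e / (`|k| + 1)) (divr_gt0 e0 k0)) _.
rewrite leeD2l// lee_fin mulrCA ler_piMr//; first exact: ltW.
by rewrite ler_pdivrMr// mul1r (le_trans (ler_norm k))// lerDl.
Qed.

End CvgZero.

Section MeanSquare.
Context d (U : measurableType d) (R : realType) (mu : {measure set U -> \bar R}).
Variable D : set U.
Hypothesis mD : measurable D.
Implicit Types X : U -> R.

Lemma measurable_sqr X : measurable_fun D X -> measurable_fun D (fun w => ((X w) ^+ 2)%:E).
Proof. by move=> mX; apply/measurable_EFinP; exact: measurable_funX. Qed.

Lemma sqrE_ge0 X w : D w -> (0 <= ((X w) ^+ 2)%:E)%E.
Proof. by rewrite lee_fin sqr_ge0. Qed.

Lemma mean_square_sum2 (k : R) X X1 X2 : 0 <= k ->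
  measurable_fun D X1 -> measurable_fun D X2 ->
  (forall w, D w -> (X w) ^+ 2 <= k * ((X1 w) ^+ 2 + (X2 w) ^+ 2)) ->
  (\int[mu]_(w in D) ((X w) ^+ 2)%:E <= k%:E *
    (\int[mu]_(w in D) ((X1 w) ^+ 2)%:E + \int[mu]_(w in D) ((X2 w) ^+ 2)%:E))%E.
Proof.
move=> k0 m1 m2 h; apply: ge0_integral_le_combination => //;
  do ?[exact: measurable_sqr | by move=> w Dw; exact: sqrE_ge0].
Qed.

Lemma mean_square_sum3 (k : R) X X1 X2 X3 : 0 <= k ->
  measurable_fun D X1 -> measurable_fun D X2 -> measurable_fun D X3 ->
  (forall w, D w -> (X w) ^+ 2 <= k * ((X1 w) ^+ 2 + ((X2 w) ^+ 2 + (X3 w) ^+ 2))) ->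
  (\int[mu]_(w in D) ((X w) ^+ 2)%:E <= k%:E *
    (\int[mu]_(w in D) ((X1 w) ^+ 2)%:E + (\int[mu]_(w in D) ((X2 w) ^+ 2)%:E +
     \int[mu]_(w in D) ((X3 w) ^+ 2)%:E)))%E.
Proof.
move=> k0 m1 m2 m3 h.
rewrite -[X in (_ * (_ + X))%E]ge0_integralD//;
  do ?[exact: measurable_sqr | by move=> w Dw; exact: sqrE_ge0].
apply: ge0_integral_le_combination => //;
  do ?[exact: measurable_sqr | by move=> w Dw; exact: sqrE_ge0].
- by move=> w Dw; rewrite adde_ge0// sqrE_ge0.
- by apply: emeasurable_funD; exact: measurable_sqr.
Qed.

Lemma mean_square_sum5 (k : R) X X1 X2 X3 X4 X5 : 0 <= k ->
  measurable_fun D X1 -> measurable_fun D X2 -> measurable_fun D X3 ->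
  measurable_fun D X4 -> measurable_fun D X5 ->
  (forall w, D w -> (X w) ^+ 2 <= k * ((X1 w) ^+ 2 + (((X2 w) ^+ 2 + (X3 w) ^+ 2)
     + ((X4 w) ^+ 2 + (X5 w) ^+ 2)))) ->
  (\int[mu]_(w in D) ((X w) ^+ 2)%:E <= k%:E *
    (\int[mu]_(w in D) ((X1 w) ^+ 2)%:E + ((\int[mu]_(w in D) ((X2 w) ^+ 2)%:E +
     \int[mu]_(w in D) ((X3 w) ^+ 2)%:E) + (\int[mu]_(w in D) ((X4 w) ^+ 2)%:E +
     \int[mu]_(w in D) ((X5 w) ^+ 2)%:E))))%E.
Proof.
move=> k0 m1 m2 m3 m4 m5 h.
have s0 (Y Y' : U -> R) w : D w -> (0 <= ((Y w) ^+ 2)%:E + ((Y' w) ^+ 2)%:E)%E.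
  by move=> Dw; rewrite adde_ge0// sqrE_ge0.
have ms (Y Y' : U -> R) : measurable_fun D Y -> measurable_fun D Y' ->
    measurable_fun D (fun w => ((Y w) ^+ 2)%:E + ((Y' w) ^+ 2)%:E)%E.
  by move=> mY mY'; apply: emeasurable_funD; exact: measurable_sqr.
rewrite -[X in (_ * (_ + (X + _)))%E]ge0_integralD//;
  do ?[exact: measurable_sqr | by move=> w Dw; exact: sqrE_ge0].
rewrite -[X in (_ * (_ + (_ + X)))%E]ge0_integralD//;
  do ?[exact: measurable_sqr | by move=> w Dw; exact: sqrE_ge0].
rewrite -[X in (_ * (_ + X))%E]ge0_integralD//;
  do ?[exact: ms | by move=> w Dw; exact: s0].
apply: ge0_integral_le_combination => //;
  do ?[exact: measurable_sqr | by move=> w Dw; exact: sqrE_ge0].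
- by move=> w Dw; rewrite adde_ge0// s0.
- by apply: emeasurable_funD; exact: ms.
Qed.

End MeanSquare.

(** * A priori estimates for the Ito integral *)

Section ItoEstimate.
Context d (Omega : measurableType d) (R : realType) (P : probability Omega R) (T : R)
 (F : R -> set (set Omega)) (B : R -> Omega -> R).
Hypothesis Ffil : filtration T F.
Hypothesis Bbm : brownian_motion P T F B.
Local Notation k2 := (gauss_variance R).
Local Notation mu := (@lebesgue_measure R).
Local Notation "`N[ X ]" := (\int[P]_w (X w ^+ 2)%:E)%E (at level 0, X at level 99).

Lemma measurable_sp_val (H : simple_process T F) (D : set (measurableTypeR R)) :
  measurable D ->
  measurable_fun (setT `*` D) (fun p : Omega * measurableTypeR R => sp_val H p.2 p.1).
Proof.
move=> mD; apply: measurable_funTS; apply: measurable_sum => i.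
apply: measurable_funM.
  apply: measurableT_comp => //.
  apply: measurable_wrtW (sp_coef_meas (ltn_ord i)).
  by apply: (filtration_measurable Ffil); apply: sp_time_itv; exact: ltnW.
by apply: (measurableT_comp (f := \1_(`]sp_time H i, sp_time H i.+1]) : measurableTypeR R -> R)).
Qed.

Lemma measurable_sp_integral (H : simple_process T F) (u : R) :
  0 <= u <= T -> measurable_fun setT (sp_integral B H u).
Proof.
move=> /andP[u0 uT]; apply: measurable_sum => i.
have /andP[a0 aT] := sp_time_itv (s:=H) (ltnW (ltn_ord i)).
have /andP[b0 bT] := sp_time_itv (s:=H) (ltn_ord i).
apply: measurable_funM.
  apply: measurable_wrtW (sp_coef_meas (ltn_ord i)).
  by apply: (filtration_measurable Ffil); rewrite a0.
by apply: measurable_funB; apply: (measurable_B Bbm); rewrite le_min ge_min ?a0 ?b0 ?u0 ?aT ?bT.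
Qed.

Variables (Z1 Z2 M1 M2 : R -> Omega -> R).
Hypothesis mZ1 : jointly_measurable T Z1.
Hypothesis mZ2 : jointly_measurable T Z2.
Hypothesis iM1 : ito_integral P T F B Z1 M1.
Hypothesis iM2 : ito_integral P T F B Z2 M2.

(** The integral of [Z1 - Z2] over [[u, T]]. *)
Definition ito_incr u w : R := (M1 T w - M1 u w) - (M2 T w - M2 u w).

(** The crude constants lost in the approximation by simple processes: [5] from
    [approx_tail], and [60 = 3 * 4 * 5] from [approx_value],
    [approx_integral] and [approx_tail]. *)
Definition ito_const : R := Num.max 5 (60 / k2).

Section FixedTime.
Variables (u : R) (eta : Omega -> R).
Hypothesis uT : 0 <= u <= T.
Hypothesis meta : measurable_wrt (F u) eta.
Hypothesis ieta : square_integrable P eta.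

Section Approximation.
Variables (H1 H2 : simple_process T F) (e : R).

Hypothesis eT1 : (`N[fun w => (sp_integral B H1 T w - M1 T w)%R] <= e%:E)%E.
Hypothesis eu1 : (`N[fun w => (sp_integral B H1 u w - M1 u w)%R] <= e%:E)%E.
Hypothesis eT2 : (`N[fun w => (sp_integral B H2 T w - M2 T w)%R] <= e%:E)%E.
Hypothesis eu2 : (`N[fun w => (sp_integral B H2 u w - M2 u w)%R] <= e%:E)%E.
Hypothesis eZ1 : (\int[P]_w \int[mu]_(r in `[0%R, T]) ((sp_val H1 r w - Z1 r w) ^+ 2)%:E <= e%:E)%E.
Hypothesis eZ2 : (\int[P]_w \int[mu]_(r in `[0%R, T]) ((sp_val H2 r w - Z2 r w) ^+ 2)%:E <= e%:E)%E.

Let TT : 0 <= T <= T.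
Proof. by case/andP: uT => u0 uT'; rewrite lexx (le_trans u0). Qed.

Let S := elementary_integral B (tail_coef (H1:=H1) (H2:=H2))
   (tail_left u (H1:=H1) (H2:=H2)) (tail_right u (H1:=H1) (H2:=H2)).
Let V := elementary_value (tail_coef (H1:=H1) (H2:=H2))
   (tail_left u (H1:=H1) (H2:=H2)) (tail_right u (H1:=H1) (H2:=H2)).
Let tails_data := tail_data Ffil uT H1 H2.

Let mM1 v : 0 <= v <= T -> measurable_fun setT (M1 v).
Proof. by case: iM1 => + _ _; exact: adapted_measurable. Qed.
Let mM2 v : 0 <= v <= T -> measurable_fun setT (M2 v).
Proof. by case: iM2 => + _ _; exact: adapted_measurable. Qed.
Let meta' : measurable_fun setT eta. Proof. by case: ieta. Qed.
Let mdM : measurable_fun setT (ito_incr u).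
Proof. by apply: measurable_funB; apply: measurable_funB; do ?[exact: mM1 | exact: mM2]. Qed.
Let mX : measurable_fun setT (fun w => eta w + ito_incr u w).
Proof. exact: measurable_funD. Qed.

(** [eta + S] is [eta + ito_incr u] plus four approximation errors, and the square
    of a sum of five terms is at most five times the sum of the squares. *)
Lemma approx_tail :
  (`N[fun w => (eta w + S w)%R] <= 5%:E * (`N[fun w => (eta w + ito_incr u w)%R] + (4 * e)%:E))%E.
Proof.
have ms (H : simple_process T F) v : 0 <= v <= T -> measurable_fun setT (sp_integral B H v) by exact: measurable_sp_integral.
apply: (@le_trans _ _ (5%:E * (`N[fun w => (eta w + ito_incr u w)%R] +
  ((`N[fun w => (sp_integral B H1 T w - M1 T w)%R] + `N[fun w => (sp_integral B H1 u w - M1 u w)%R]) +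
   (`N[fun w => (sp_integral B H2 T w - M2 T w)%R] + `N[fun w => (sp_integral B H2 u w - M2 u w)%R])))))%E.
  apply: mean_square_sum5 => //.
  - by apply: measurable_funB; [exact: ms|exact: mM1].
  - by apply: measurable_funB; [exact: ms|exact: mM1].
  - by apply: measurable_funB; [exact: ms|exact: mM2].
  - by apply: measurable_funB; [exact: ms|exact: mM2].
  - move=> w _; rewrite /S tail_integralE /ito_incr.
    set x := eta w + (M1 T w - M1 u w - (M2 T w - M2 u w)); set a := _ - M1 T w; set b := _ - M1 u w; set c := _ - M2 T w; set f := _ - M2 u w.
    rewrite (_ : eta w + _ = x + a - b - c + f); last by rewrite /x /a /b /c /f; ring.
    have := sqr_ge0 (x - a); have := sqr_ge0 (x + b); have := sqr_ge0 (x + c); have := sqr_ge0 (x - f).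
    have := sqr_ge0 (a + b); have := sqr_ge0 (a + c); have := sqr_ge0 (a - f).
    have := sqr_ge0 (b - c); have := sqr_ge0 (b + f); have := sqr_ge0 (c + f).
    lra.
rewrite lee_wpmul2l ?lee_fin// leeD2l//.
rewrite (_ : (4 * e)%:E = ((e%:E + e%:E) + (e%:E + e%:E))%E); last by rewrite -!EFinD; congr EFin; ring.
by apply: leeD; apply: leeD.
Qed.

Lemma approx_eta : (`N[eta] <= `N[fun w => (eta w + S w)%R])%E.
Proof.
apply: (elementary_orthogonal Ffil Bbm tails_data uT) => // i.
exact: tail_left_ge.
Qed.

(** [S = (eta + S) - eta], and [eta] is controlled by [approx_eta]. *)
Lemma approx_integral : (`N[S] <= 4%:E * `N[fun w => (eta w + S w)%R])%E.
Proof.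
have [mS _] := square_integrable_elementary Ffil Bbm tails_data.
apply: (@le_trans _ _ (2%:E * (`N[fun w => (eta w + S w)%R] + `N[eta]))%E).
  apply: mean_square_sum2 => //; first exact: measurable_funD.
  by move=> w _; have := sqr_ge0 (eta w *+ 2 + S w); nra.
apply: (@le_trans _ _ (2%:E * (`N[fun w => (eta w + S w)%R] + `N[fun w => (eta w + S w)%R]))%E).
  by rewrite lee_wpmul2l ?lee_fin// leeD2l// approx_eta.
rewrite (_ : 4%:E = 2%:E * 2%:E :> \bar R)%E; last by rewrite -EFinM; congr EFin; ring.
by rewrite -muleA [X in (_ <= _ * X)%E]mule_natl mule2n.
Qed.

Let mV (D : set (measurableTypeR R)) : measurable D ->
  measurable_fun (setT `*` D) (fun p : Omega * measurableTypeR R => V p.2 p.1).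
Proof.
move=> mD; apply: measurable_funTS; rewrite /V /elementary_value.
apply: measurable_sum => i; apply: measurable_funM.
  apply: measurableT_comp => //.
  exact: (elementary_coef_measurable Ffil tails_data).
exact: (measurableT_comp (f := \1_(`]tail_left u i, tail_right u i]) : measurableTypeR R -> R)).
Qed.

Lemma approx_value :
  (\int[P]_w \int[mu]_(r in `[u, T]) ((Z1 r w - Z2 r w) ^+ 2)%:E <=
   3%:E * (\int[P]_w \int[mu]_r ((V r w) ^+ 2)%:E + (2 * e)%:E))%E.
Proof.
have /andP[u0 uT'] := uT.
have sub : (`]u, T] : set R) `<=` `[0, T].
  move=> r /=; rewrite !in_itv/= => /andP[ur ->]; by rewrite (le_trans u0 (ltW ur)).
have mE1 : measurable_fun (setT `*` `[0, T]) (fun p : Omega * measurableTypeR R => sp_val H1 p.2 p.1 - Z1 p.2 p.1).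
  by apply: measurable_funB => //; exact: measurable_sp_val.
have mE2 : measurable_fun (setT `*` `[0, T]) (fun p : Omega * measurableTypeR R => sp_val H2 p.2 p.1 - Z2 p.2 p.1).
  by apply: measurable_funB => //; exact: measurable_sp_val.
have sqm D (X : R -> Omega -> R) : measurable_fun (setT `*` D) (fun p : Omega * measurableTypeR R => X p.2 p.1) ->
    measurable_fun (setT `*` D) (fun p : Omega * measurableTypeR R => ((X p.2 p.1) ^+ 2)%:E).
  by move=> mXX; apply/measurable_EFinP; exact: measurable_funX.
have secm (D : set (measurableTypeR R)) (X : R -> Omega -> R) w : measurable D ->
    measurable_fun (setT `*` D) (fun p : Omega * measurableTypeR R => X p.2 p.1) ->
    measurable_fun D (fun r : measurableTypeR R => X r w).
  move=> mD mXX; apply/measurable_EFinP.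
  by apply: (@measurable_section _ _ _ D (fun p => (X p.2 p.1)%:E)) => //; exact/measurable_EFinP.
have parm (D : set (measurableTypeR R)) (X : R -> Omega -> R) : measurable D ->
    measurable_fun (setT `*` D) (fun p : Omega * measurableTypeR R => X p.2 p.1) ->
    measurable_fun setT (fun w => \int[mu]_(r in D) ((X r w) ^+ 2)%:E)%E.
  move=> mD mXX.
  apply: (@measurable_parameter_integral _ _ _ D (fun p => ((X p.2 p.1) ^+ 2)%:E)) => //.
    exact: sqm.
  by move=> w r _; rewrite lee_fin sqr_ge0.
have mI : measurable (`[0, T] : set (measurableTypeR R)) by exact: measurable_itv.
pose J1 w := (\int[mu]_(r in `[0%R, T]) ((sp_val H1 r w - Z1 r w) ^+ 2)%:E)%E.
pose J2 w := (\int[mu]_(r in `[0%R, T]) ((sp_val H2 r w - Z2 r w) ^+ 2)%:E)%E.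
pose J0 w := (\int[mu]_r ((V r w) ^+ 2)%:E)%E.
have mJ0 : measurable_fun setT J0.
  by apply: parm => //; exact: mV.
have mJ1 : measurable_fun setT J1.
  exact: (parm `[0, T]%classic (fun r w => sp_val H1 r w - Z1 r w) mI mE1).
have mJ2 : measurable_fun setT J2.
  exact: (parm `[0, T]%classic (fun r w => sp_val H2 r w - Z2 r w) mI mE2).
have J00 w : (0 <= J0 w)%E by apply: integral_ge0 => r _; rewrite lee_fin sqr_ge0.
have J10 w : (0 <= J1 w)%E by apply: integral_ge0 => r _; rewrite lee_fin sqr_ge0.
have J20 w : (0 <= J2 w)%E by apply: integral_ge0 => r _; rewrite lee_fin sqr_ge0.
apply: (@le_trans _ _ (3%:E * (\int[P]_w J0 w + \int[P]_w (J1 w + J2 w)))%E); last first.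
  rewrite lee_wpmul2l ?lee_fin// leeD2l// ge0_integralD//.
  by rewrite mulr_natl mulr2n EFinD; apply: leeD.
apply: ge0_integral_le_combination => //.
- by move=> w _; apply: integral_ge0 => r _; rewrite lee_fin sqr_ge0.
- by move=> w _; rewrite adde_ge0.
- exact: emeasurable_funD.
move=> w _.
have mZZ : measurable_fun `]u, T] (fun r : measurableTypeR R => ((Z1 r w - Z2 r w) ^+ 2)%:E).
  apply/measurable_EFinP; apply: measurable_funX.
  exact: (measurable_funS mI sub (secm `[0, T]%classic (fun r w => Z1 r w - Z2 r w) w mI
    (measurable_funB mZ1 mZ2))).
rewrite -integral_itv_obnd_cbnd//.
apply: (@le_trans _ _ (3%:E * (\int[mu]_(r in `]u, T]) ((V r w) ^+ 2)%:E + (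
   \int[mu]_(r in `]u, T]) ((sp_val H1 r w - Z1 r w) ^+ 2)%:E +
   \int[mu]_(r in `]u, T]) ((sp_val H2 r w - Z2 r w) ^+ 2)%:E)))%E).
  apply: mean_square_sum3 => //.
  - by apply: secm => //; exact: mV.
  - exact: (measurable_funS mI sub (secm `[0, T]%classic (fun r w => sp_val H1 r w - Z1 r w) w mI mE1)).
  - exact: (measurable_funS mI sub (secm `[0, T]%classic (fun r w => sp_val H2 r w - Z2 r w) w mI mE2)).
  - move=> r /=; rewrite in_itv/= => /andP[ur _]; rewrite /V tail_valueE//.
    set x := sp_val H1 r w; set y := sp_val H2 r w; set z := Z1 r w; set z' := Z2 r w.
    have := sqr_ge0 (x - y + (x - z)); have := sqr_ge0 (x - y - (y - z')).
    have := sqr_ge0 ((x - z) + (y - z')).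
    by lra.
have mono (X : R -> R) (D : set (measurableTypeR R)) : `]u, T]%classic `<=` D ->
    (\int[mu]_(r in `]u, T]) ((X r) ^+ 2)%:E <= \int[mu]_(r in D) ((X r) ^+ 2)%:E)%E.
  by move=> uD; apply: ge0_subset_integral_nomeas => // r; rewrite lee_fin sqr_ge0.
rewrite lee_wpmul2l ?lee_fin//; apply: leeD; first exact: mono.
by apply: leeD; [exact: (mono (fun r => sp_val H1 r w - Z1 r w))|exact: (mono (fun r => sp_val H2 r w - Z2 r w))].
Qed.

End Approximation.

Lemma approximation_exists (e : R) : 0 < e -> exists H1 H2 : simple_process T F,
  [/\ (`N[fun w => (sp_integral B H1 T w - M1 T w)%R] <= e%:E)%E,
      (`N[fun w => (sp_integral B H1 u w - M1 u w)%R] <= e%:E)%E,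
      (`N[fun w => (sp_integral B H2 T w - M2 T w)%R] <= e%:E)%E &
      (`N[fun w => (sp_integral B H2 u w - M2 u w)%R] <= e%:E)%E] /\
  (\int[P]_w \int[mu]_(r in `[0%R, T]) ((sp_val H1 r w - Z1 r w) ^+ 2)%:E <= e%:E)%E /\
  (\int[P]_w \int[mu]_(r in `[0%R, T]) ((sp_val H2 r w - Z2 r w) ^+ 2)%:E <= e%:E)%E.
Proof.
move=> e0; have TT : 0 <= T <= T by case/andP: uT => u0 uT'; rewrite lexx (le_trans u0).
case: iM1 => _ _ [G1 [cZ1 cI1]]; case: iM2 => _ _ [G2 [cZ2 cI2]].
have [n [[nT1 nu1] nZ1]] := filter_ex (filterI (filterI (cvge0_near_le (cI1 T TT) e0)
  (cvge0_near_le (cI1 u uT) e0)) (cvge0_near_le cZ1 e0)).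
have [m [[mT2 mu2] mZ]] := filter_ex (filterI (filterI (cvge0_near_le (cI2 T TT) e0)
  (cvge0_near_le (cI2 u uT) e0)) (cvge0_near_le cZ2 e0)).
by exists (G1 n), (G2 m).
Qed.

Lemma ito_estimate_eta :
  (`N[eta] <= ito_const%:E * `N[fun w => (eta w + ito_incr u w)%R])%E.
Proof.
have N0 X : (0 <= `N[X])%E by apply: integral_ge0 => w _; rewrite lee_fin sqr_ge0.
apply: (@le_trans _ _ (5%:E * `N[fun w => (eta w + ito_incr u w)%R])%E); last first.
  by rewrite lee_wpmul2r// lee_fin le_max lexx.
apply: (@lee_addgt0_scaled _ _ _ 20) => e e0.
have [H1 [H2 [[eT1 eu1 eT2 eu2] [eZ1 eZ2]]]] := approximation_exists e0.
apply: (le_trans (approx_eta H1 H2)).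
apply: le_trans (approx_tail eT1 eu1 eT2 eu2) _.
rewrite ge0_muleDr//; last by rewrite lee_fin mulr_ge0// ltW.
by rewrite leeD2l// -EFinM lee_fin mulrA -natrM.
Qed.

Lemma ito_estimate_integrand :
  (\int[P]_w \int[mu]_(r in `[u, T]) ((Z1 r w - Z2 r w) ^+ 2)%:E <=
   ito_const%:E * `N[fun w => (eta w + ito_incr u w)%R])%E.
Proof.
have N0 X : (0 <= `N[X])%E by apply: integral_ge0 => w _; rewrite lee_fin sqr_ge0.
have k0 := gauss_variance_gt0 R.
apply: (@le_trans _ _ ((60 / k2)%:E * `N[fun w => (eta w + ito_incr u w)%R])%E); last first.
  by rewrite lee_wpmul2r// lee_fin le_max lexx orbT.
apply: (@lee_addgt0_scaled _ _ _ (240 / k2 + 6)) => e e0.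
have [H1 [H2 [[eT1 eu1 eT2 eu2] [eZ1 eZ2]]]] := approximation_exists e0.
apply: (le_trans (approx_value eZ1 eZ2)).
have iso := elementary_isometry Ffil Bbm (tail_data Ffil uT H1 H2).
set V := (\int[P]_w \int[mu]_r _)%E in iso *.
have V0 : (0 <= V)%E.
  by apply: integral_ge0 => w _; apply: integral_ge0 => r _; rewrite lee_fin sqr_ge0.
have kV : (k2%:E * V <= 20%:E * (`N[fun w => (eta w + ito_incr u w)%R] + (4 * e)%:E))%E.
  rewrite -iso; apply: le_trans (approx_integral H1 H2) _.
  rewrite (_ : 20%:E = 4%:E * 5%:E :> \bar R)%E; last by rewrite -EFinM -natrM.
  rewrite -muleA lee_wpmul2l// ?lee_fin//.
  exact: approx_tail eT1 eu1 eT2 eu2.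
have {}kV : (V <= (20 / k2)%:E * (`N[fun w => (eta w + ito_incr u w)%R] + (4 * e)%:E))%E.
  by rewrite mulrC EFinM -muleA lee_pdivlMl.
set X := `N[fun w => (eta w + ito_incr u w)%R] in kV *.
have X0 : (0 <= X)%E by exact: N0.
have e4 : (0 <= (4 * e)%:E)%E by rewrite lee_fin mulr_ge0// ltW.
have e2 : (0 <= (2 * e)%:E)%E by rewrite lee_fin mulr_ge0// ltW.
have c0 : (0 <= (20 / k2)%:E)%E by rewrite lee_fin divr_ge0// ltW.
apply: (@le_trans _ _ (3%:E * ((20 / k2)%:E * (X + (4 * e)%:E) + (2 * e)%:E))%E).
  by rewrite lee_wpmul2l ?lee_fin// leeD2r.
rewrite ge0_muleDr//; last by rewrite mule_ge0// adde_ge0.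
rewrite muleA ge0_muleDr// -!EFinM -addeA -EFinD.
rewrite (_ : 3 * (20 / k2) = 60 / k2); last by rewrite mulrA -natrM.
rewrite leeD2l// lee_fin le_eqVlt; apply/orP; left; apply/eqP; field.
by rewrite gt_eqF.
Qed.

End FixedTime.
End ItoEstimate.

(** * Energy of paths on a time interval *)

Section CauchySchwarz.
Context (R : realType).
Local Notation mu := (@lebesgue_measure R).
Variables (a b : R) (g : R -> R).
Hypothesis ab : a <= b.
Hypothesis mg : measurable_fun `[a, b] g.
Hypothesis ig : (\int[mu]_(r in `[a, b]) ((g r) ^+ 2)%:E < +oo)%E.

Let mI : measurable (`[a, b] : set (measurableTypeR R)).
Proof. exact: measurable_itv. Qed.

Lemma lebesgue_measure_itvcc : mu `[a, b] = (b - a)%:E.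
Proof.
rewrite lebesgue_measure_itv/= lte_fin; case: ltP => // ba.
have -> : b = a by apply/eqP; rewrite eq_le ba ab.
by rewrite subrr.
Qed.

Lemma integrable_itv_cst (c : R) : mu.-integrable `[a, b] (EFin \o cst c).
Proof.
apply/integrableP; split; first exact/measurable_EFinP/measurable_cst.
by rewrite (eq_integral (cst `|c|%:E))// integral_cst// [X in (_ * X)%E]lebesgue_measure_itvcc -EFinM ltry.
Qed.

Lemma integrable_sqr_itv : mu.-integrable `[a, b] (fun r => ((g r) ^+ 2)%:E).
Proof.
apply/integrableP; split; first by apply/measurable_EFinP; exact: measurable_funX.
apply: le_lt_trans ig; apply: ge0_le_integral_nomeas => r _; first exact: abse_ge0.
by rewrite /= ger0_norm// sqr_ge0.
Qed.

Lemma integrable_of_sqr : mu.-integrable `[a, b] (EFin \o g).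
Proof.
have := integrableD mI (integrable_itv_cst 1) integrable_sqr_itv.
apply: le_integrable => //; first exact/measurable_EFinP.
move=> x _ /=; rewrite lee_fin [leRHS]ger0_norm ?addr_ge0 ?sqr_ge0//.
rewrite ler_norml; apply/andP; split; nra.
Qed.

(** The Cauchy-Schwarz inequality, read off from the integral of the square of
    the deviation of [g] from its mean value over the interval. *)
Lemma sqr_Rintegral_le :
  (\int[mu]_(r in `[a, b]) g r) ^+ 2 <= (b - a) * \int[mu]_(r in `[a, b]) (g r) ^+ 2.
Proof.
move: ab; rewrite le_eqVlt => /predU1P[E|altb].
  by rewrite -E set_itv1 !Rintegral_set1 mulr0 expr0n.
have ba0 : 0 < b - a by rewrite subr_gt0.
set A := \int[mu]_(r in _) g r; set Q := \int[mu]_(r in _) (g r) ^+ 2.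
pose k := A / (b - a).
have i1 := integrable_of_sqr; have i2 := integrable_sqr_itv; have i3 := integrable_itv_cst (k ^+ 2).
have i1' := integrableZl mI (2 * k) i1.
have : 0 <= \int[mu]_(r in `[a, b]) (g r - k) ^+ 2 by apply: Rintegral_ge0 => r _; exact: sqr_ge0.
have -> : \int[mu]_(r in `[a, b]) (g r - k) ^+ 2 = Q - 2 * k * A + k ^+ 2 * (b - a).
  transitivity (\int[mu]_(r in `[a, b]) ((g r ^+ 2 - 2 * k * g r) + k ^+ 2)).
    by apply: eq_Rintegral => r _; ring.
  rewrite RintegralD//; last exact: (integrableB mI i2 i1').
  rewrite RintegralB// RintegralZl// Rintegral_cst//.
  by congr (_ + _ * _); exact: (congr1 fine lebesgue_measure_itvcc).
rewrite (_ : Q - _ + _ = Q - A ^+ 2 / (b - a)); last first.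
  by rewrite /k; field; rewrite gt_eqF.
by rewrite subr_ge0 ler_pdivrMr// mulrC.
Qed.

End CauchySchwarz.

Section JointSections.
Context d (Omega : measurableType d) (R : realType) (P : probability Omega R) (T : R).
Local Notation mu := (@lebesgue_measure R).
Variable X : R -> Omega -> R.
Hypothesis mX : jointly_measurable T X.
Variables a b : R.
Hypothesis a0 : 0 <= a.
Hypothesis bT : b <= T.

Lemma subset_itv_horizon : `[a, b]%classic `<=` (`[0, T]%classic : set (measurableTypeR R)).
Proof.
by move=> r /=; rewrite !in_itv/= => /andP[ar rb]; rewrite (le_trans a0 ar) (le_trans rb bT).
Qed.

Let mI : measurable (`[a, b] : set (measurableTypeR R)).
Proof. exact: measurable_itv. Qed.

Lemma jointly_measurableS :
  measurable_fun (setT `*` `[a, b]) (fun p : Omega * measurableTypeR R => X p.2 p.1).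
Proof.
apply: (@measurable_funS _ _ _ _ (setT `*` `[0, T])) => //.
  exact: measurableX.
by move=> [w r] [_ /subset_itv_horizon].
Qed.

Lemma jointly_measurable_section w : measurable_fun `[a, b] (fun r : measurableTypeR R => X r w).
Proof.
apply/measurable_EFinP.
apply: (@measurable_section _ _ _ _ (fun p => (X p.2 p.1)%:E)) => //.
by apply/measurable_EFinP; exact: jointly_measurableS.
Qed.

Let mX2 : measurable_fun (setT `*` `[a, b]) (fun p : Omega * measurableTypeR R => ((X p.2 p.1) ^+ 2)%:E).
Proof. by apply/measurable_EFinP; apply: measurable_funX; exact: jointly_measurableS. Qed.

Lemma measurable_energy : measurable_fun setT (fun w => \int[mu]_(r in `[a, b]) ((X r w) ^+ 2)%:E)%E.
Proof.
apply: (@measurable_parameter_integral _ _ _ _ (fun p => ((X p.2 p.1) ^+ 2)%:E)) => //.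
by move=> w r _; rewrite lee_fin sqr_ge0.
Qed.

Lemma measurable_mean_square : measurable_fun (`[a, b] : set (measurableTypeR R))
   (fun r => \int[P]_w ((X r w) ^+ 2)%:E)%E.
Proof.
apply: (@measurable_expectation_section _ _ _ _ _ (fun p => ((X p.2 p.1) ^+ 2)%:E)) => //.
by move=> w r _; rewrite lee_fin sqr_ge0.
Qed.

Lemma energy_mean_square :
  (\int[P]_w \int[mu]_(r in `[a, b]) ((X r w) ^+ 2)%:E =
   \int[mu]_(r in `[a, b]) \int[P]_w ((X r w) ^+ 2)%:E)%E.
Proof.
apply: (@expectation_parameter_integral _ _ _ _ _ (fun p => ((X p.2 p.1) ^+ 2)%:E)) => //.
by move=> w r _; rewrite lee_fin sqr_ge0.
Qed.

End JointSections.

(** * Uniqueness for Lipschitz backward equations *)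

(** Steps of length at most [h] reach [0] from [T] in finitely many stages. *)
Lemma backward_induction (R : realType) (T h : R) (Q : R -> Prop) :
  0 <= T -> 0 < h -> Q T ->
  (forall t u, 0 <= t -> t <= u -> u <= T -> u - t <= h -> Q u -> Q t) -> Q 0.
Proof.
move=> T0 h0 QT step.
have H (n : nat) : forall t, 0 <= t -> t <= T -> T - t <= n%:R * h -> Q t.
  elim: n => [|n IH] t t0 tT.
    by rewrite mul0r subr_le0 => Tt; have -> : t = T by apply/eqP; rewrite eq_le tT Tt.
  rewrite -natr1 mulrDl mul1r => tn.
  pose u := Num.min (t + h) T.
  have tu : t <= u by rewrite le_min tT lerDl ltW.
  apply: (step t u) => //; first by rewrite ge_min lexx orbT.
    by rewrite lerBlDl ge_min lexx.
  apply: IH; first exact: le_trans tu.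
    by rewrite ge_min lexx orbT.
  rewrite lerBlDr /u; case: (leP (t + h) T) => _; first by lra.
  by rewrite lerDr mulr_ge0// ltW.
apply: (H (Num.truncn (T / h)).+1) => //; rewrite subr0 -ler_pdivrMr//.
by apply/ltW; have /andP[] := truncn_itv (divr_ge0 T0 (ltW h0)).
Qed.

Lemma sqrD_le (R : realType) (x y : R) : (x + y) ^+ 2 <= 2 * x ^+ 2 + 2 * y ^+ 2.
Proof. by have := sqr_ge0 (x - y); nra. Qed.

Section LipschitzUniqueness.
Context d (Omega : measurableType d) (R : realType) (P : probability Omega R) (T : R)
 (F : R -> set (set Omega)) (B : R -> Omega -> R).
Hypothesis T0 : 0 <= T.
Hypothesis Ffil : filtration T F.
Hypothesis Bbm : brownian_motion P T F B.
Local Notation mu := (@lebesgue_measure R).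
Local Notation "`N[ X ]" := (\int[P]_w (X w ^+ 2)%:E)%E (at level 0, X at level 99).

Variables (Z1 Z2 M1 M2 V : R -> Omega -> R) (m : R -> R) (L Cb : R).
Hypothesis mZ1 : jointly_measurable T Z1.
Hypothesis mZ2 : jointly_measurable T Z2.
Hypothesis iM1 : ito_integral P T F B Z1 M1.
Hypothesis iM2 : ito_integral P T F B Z2 M2.
Hypothesis Zfin : (\int[P]_w \int[mu]_(r in `[0%R, T]) ((Z1 r w - Z2 r w) ^+ 2)%:E < +oo)%E.
Hypothesis mV : jointly_measurable T V.
Hypothesis aV : adapted T F V.
Hypothesis bV : forall t, 0 <= t <= T -> (`N[V t] <= Cb%:E)%E.
Hypothesis L0 : 0 <= L.
Hypothesis centered : forall t, 0 <= t <= T -> (`N[V t] <= `N[fun w => (V t w - m t)%R])%E.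
Let g r w : R := `|V r w| + `|Z1 r w - Z2 r w|.
Hypothesis bound : forall t, 0 <= t <= T -> {ae P, forall w,
  mu.-integrable `[t, T] (fun r => (g r w)%:E) ->
  `|V t w - m t + ito_incr T M1 M2 t w| <= L * \int[mu]_(r in `[t, T]) g r w}.

Let D r w : R := Z1 r w - Z2 r w.
Let mD : jointly_measurable T D.
Proof. exact: measurable_funB. Qed.
Let mg : jointly_measurable T g.
Proof.
by apply: measurable_funD; apply: measurableT_comp => //; exact: mD.
Qed.

Let C : R := ito_const R.
Let C0 : 0 < C.
Proof. by rewrite lt_max ltr0n. Qed.

(* G t is the energy of the gap and of the integrands on [t, T]; Q t is the mean
   square of the drift, that is of the residual of the equation. *)
Let G t := (\int[P]_w \int[mu]_(r in `[t, T]) ((g r w) ^+ 2)%:E)%E.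
Let Q t := (`N[fun w => (V t w - m t + ito_incr T M1 M2 t w)%R])%E.

Let mM v : 0 <= v <= T -> measurable_fun setT (ito_incr T M1 M2 v).
Proof.
move=> vT; have TT : 0 <= T <= T by rewrite lexx T0.
case: iM1 => a1 _ _; case: iM2 => a2 _ _.
by apply: measurable_funB; apply: measurable_funB; apply: (adapted_measurable Ffil).
Qed.

Let mVt v : 0 <= v <= T -> measurable_fun setT (V v).
Proof. exact: (adapted_measurable Ffil aV). Qed.

Lemma path_energy_mono (X : R -> Omega -> R) a b w : a <= b ->
  (\int[mu]_(r in `[b, T]) ((X r w) ^+ 2)%:E <= \int[mu]_(r in `[a, T]) ((X r w) ^+ 2)%:E)%E.
Proof.
move=> ab; apply: ge0_subset_integral_nomeas => r; last by rewrite lee_fin sqr_ge0.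
by rewrite /= !in_itv/= => /andP[br ->]; rewrite (le_trans ab br).
Qed.

Lemma energy_tail_mono a b : a <= b -> (G b <= G a)%E.
Proof.
move=> ab; apply: ge0_le_integral_nomeas => w _; last exact: path_energy_mono.
by apply: integral_ge0 => r _; rewrite lee_fin sqr_ge0.
Qed.

Lemma energy_tail_ge0 t : (0 <= G t)%E.
Proof.
apply: integral_ge0 => w _; apply: integral_ge0 => r _; by rewrite lee_fin sqr_ge0.
Qed.

Lemma energy_tail_le t : 0 <= t -> (G t <= 2%:E *
  (\int[mu]_(r in `[t, T]) `N[V r] + \int[P]_w \int[mu]_(r in `[t, T]) ((Z1 r w - Z2 r w) ^+ 2)%:E))%E.
Proof.
move=> t0; rewrite -(energy_mean_square P mV t0 (lexx T)).
apply: ge0_integral_le_combination => //.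
- by move=> w _; apply: integral_ge0 => r _; rewrite lee_fin sqr_ge0.
- by move=> w _; apply: integral_ge0 => r _; rewrite lee_fin sqr_ge0.
- by move=> w _; apply: integral_ge0 => r _; rewrite lee_fin sqr_ge0.
- exact: (measurable_energy mV t0 (lexx T)).
- exact: (measurable_energy mD t0 (lexx T)).
- move=> w _; apply: mean_square_sum2 => //.
  + exact: (jointly_measurable_section mV t0 (lexx T)).
  + exact: (jointly_measurable_section mD t0 (lexx T)).
  + move=> r _; rewrite /g -[V r w ^+ 2]real_normK ?num_real// -[(_ - _) ^+ 2]real_normK ?num_real//.
    by have := sqr_ge0 (`|V r w| - `|Z1 r w - Z2 r w|); nra.
Qed.

Lemma energy_tail_lty t : 0 <= t -> (G t < +oo)%E.
Proof.
move=> t0; apply: le_lt_trans (energy_tail_mono t0) _; apply: le_lt_trans (energy_tail_le (lexx 0)) _.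
apply: lte_mul_pinfty => //; apply: lte_add_pinfty => //.
apply: (@le_lt_trans _ _ (\int[mu]_(r in `[0%R, T]) (Cb%:E))%E).
  apply: ge0_le_integral_nomeas => r /=; rewrite in_itv/= => rT; last exact: bV.
  by apply: integral_ge0 => w _; rewrite lee_fin sqr_ge0.
by rewrite integral_cst ?[X in (_ * X)%E](lebesgue_measure_itvcc T0) ?ltry//; exact: measurable_itv.
Qed.

(** Square the Lipschitz bound of the equation and apply the Cauchy-Schwarz
    inequality on [[t, u]] and [[u, T]] separately: the early part gains the
    small factor [u - t], the late part only involves [G u]. *)
Lemma residual_le t u : 0 <= t -> t <= u -> u <= T ->
  (Q t <= (L ^+ 2)%:E * ((2 * (u - t))%:E * G t + (2 * (T - u))%:E * G u))%E.
Proof.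
move=> t0 tu uT; have tT := le_trans tu uT; have u0 := le_trans t0 tu.
pose J a w := (\int[mu]_(r in `[a, T]) ((g r w) ^+ 2)%:E)%E.
have J0 a w : (0 <= J a w)%E by apply: integral_ge0 => r _; rewrite lee_fin sqr_ge0.
have mJ a : 0 <= a -> measurable_fun setT (J a) by move=> a0; exact: (measurable_energy mg a0 (lexx T)).
have c1 : (0 <= (2 * (u - t))%:E)%E by rewrite lee_fin mulr_ge0// subr_ge0.
have c2 : (0 <= (2 * (T - u))%:E)%E by rewrite lee_fin mulr_ge0// subr_ge0.
have cL : (0 <= (L ^+ 2)%:E)%E by rewrite lee_fin sqr_ge0.
have m1 : measurable_fun setT (fun w => (2 * (u - t))%:E * J t w)%E.
  by apply: measurable_funeM; exact: mJ.
have m2 : measurable_fun setT (fun w => (2 * (T - u))%:E * J u w)%E.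
  by apply: measurable_funeM; exact: mJ.
rewrite /Q -[G t]/(\int[P]_w J t w)%E -[G u]/(\int[P]_w J u w)%E.
rewrite -[X in (_ <= _ * (X + _))%E]ge0_integralZl_EFin//; last exact: mJ.
rewrite -[X in (_ <= _ * (_ + X))%E]ge0_integralZl_EFin//; last exact: mJ.
have n1 w : setT w -> (0 <= (2 * (u - t))%:E * J t w)%E by move=> _; exact: mule_ge0.
have n2 w : setT w -> (0 <= (2 * (T - u))%:E * J u w)%E by move=> _; exact: mule_ge0.
rewrite -ge0_integralD//.
rewrite -ge0_integralZl_EFin ?sqr_ge0//; last 2 first.
  by move=> w ?; rewrite adde_ge0// ?n1 ?n2.
  exact: emeasurable_funD.
have t0T : 0 <= t <= T by rewrite t0.
apply: ae_ge0_le_integral => //.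
- by move=> w _; rewrite lee_fin sqr_ge0.
- apply: measurable_sqr => //; apply: measurable_funD; last exact: mM.
  by apply: measurable_funB => //; exact: mVt.
- by move=> w ?; apply: mule_ge0 => //; rewrite adde_ge0// ?n1 ?n2.
- by apply: measurable_funeM; exact: emeasurable_funD.
have iJ : P.-integrable setT (J t).
  apply/integrableP; split; first exact: mJ.
  under eq_integral do rewrite gee0_abs//.
  exact: energy_tail_lty.
have fJ := integrable_ae measurableT iJ.
apply: filterS2 fJ (bound t0T) => w fw bw _.
have {}fw : (J t w < +oo)%E by rewrite -ge0_fin_numE//; exact: fw.
have fu : (J u w < +oo)%E by apply: le_lt_trans (path_energy_mono g w tu) _.
have ms a b : 0 <= a -> b <= T -> measurable_fun `[a, b] (fun r : measurableTypeR R => g r w).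
  by move=> a0 bT; exact: (jointly_measurable_section mg a0 bT).
have itT := integrable_of_sqr tT (ms _ _ t0 (lexx T)) fw.
have iuT := integrable_of_sqr uT (ms _ _ u0 (lexx T)) fu.
have fI : (\int[mu]_(r in `[t, u]) ((g r w) ^+ 2)%:E <= J t w)%E.
  apply: ge0_subset_integral_nomeas => r; last by rewrite lee_fin sqr_ge0.
  by rewrite /= !in_itv/= => /andP[-> ru]; rewrite (le_trans ru uT).
have ftu := le_lt_trans fI fw.
have itu := integrable_of_sqr tu (ms _ _ t0 uT) ftu.
have {}bw := bw itT.
have split_int : \int[mu]_(r in `[t, T]) g r w = \int[mu]_(r in `[t, u]) g r w + \int[mu]_(r in `[u, T]) g r w.
  have := @Rintegral_itvB _ (fun r => g r w) (BLeft t) (BRight T) u itT.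
  rewrite !bnd_simp => /(_ tu uT) E.
  rewrite -[X in _ = _ + X]Rintegral_itv_obnd_cbnd -?E; first by ring.
  apply: (integrableS _ _ _ iuT); do ?exact: measurable_itv.
  by move=> r /=; rewrite !in_itv/= => /andP[/ltW -> ->].
have cs1 := sqr_Rintegral_le tu (ms _ _ t0 uT) ftu.
have cs2 := sqr_Rintegral_le uT (ms _ _ u0 (lexx T)) fu.
have fin1 : (\int[mu]_(r in `[t, u]) ((g r w) ^+ 2)%:E)%E \is a fin_num.
  by rewrite ge0_fin_numE//; apply: integral_ge0 => r _; rewrite lee_fin sqr_ge0.
have E1 : \int[mu]_(r in `[t, u]) (g r w) ^+ 2 <= fine (J t w).
  by rewrite /Rintegral fine_le// ge0_fin_numE.
rewrite -(fineK (_ : J t w \is a fin_num)); last by rewrite ge0_fin_numE.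
rewrite -(fineK (_ : J u w \is a fin_num)); last by rewrite ge0_fin_numE.
rewrite -!EFinM lee_fin -real_normK ?num_real//.
move: cs2; rewrite -[\int[mu]_(r in `[u, T]) g r w ^+ 2]/(fine (J u w)) => cs2.
set A := \int[mu]_(r in `[t, u]) g r w in cs1 split_int.
set A' := \int[mu]_(r in `[u, T]) g r w in cs2 split_int.
apply: (@le_trans _ _ ((L * (A + A')) ^+ 2)).
  rewrite -split_int ler_pXn2r// nnegrE//.
  by rewrite mulr_ge0// Rintegral_ge0// => r _; rewrite /g addr_ge0.
rewrite exprMn ler_wpM2l ?sqr_ge0//.
apply: le_trans (sqrD_le A A') _; rewrite -!mulrA lerD// ler_wpM2l//.
by apply: le_trans cs1 _; rewrite ler_wpM2l// subr_ge0.
Qed.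

Lemma shifted_gap_le s : 0 <= s <= T -> (`N[fun w => (V s w - m s)%R] <= C%:E * Q s)%E.
Proof.
move=> sT.
apply: (@ito_estimate_eta _ _ _ P T F B Ffil Bbm Z1 Z2 M1 M2 iM1 iM2 s (fun w => V s w - m s) sT).
  apply: measurable_funB; [exact: aV|exact: measurable_cst].
apply: square_integrableB; last exact: square_integrable_cst.
by split; [exact: mVt|apply: le_lt_trans (bV sT) _; exact: ltry].
Qed.

(** Since [V s] is centred, subtracting the unknown constant [m s] can only
    increase its mean square. *)
Lemma gap_le s : 0 <= s <= T -> (`N[V s] <= C%:E * Q s)%E.
Proof. by move=> sT; apply: le_trans (centered sT) (shifted_gap_le sT). Qed.

Lemma integrand_gap_le s : 0 <= s <= T ->
  (\int[P]_w \int[mu]_(r in `[s, T]) ((Z1 r w - Z2 r w) ^+ 2)%:E <= C%:E * Q s)%E.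
Proof.
move=> sT; apply: (@ito_estimate_integrand _ _ _ P T F B Ffil Bbm Z1 Z2 M1 M2 mZ1 mZ2 iM1 iM2 s (fun w => V s w - m s) sT).
  apply: measurable_funB; [exact: aV|exact: measurable_cst].
apply: square_integrableB; last exact: square_integrable_cst.
by split; [exact: mVt|apply: le_lt_trans (bV sT) _; exact: ltry].
Qed.

(** If the energy vanishes from [u] on, [residual_le] bounds the mean squares on
    [[t, u]] by [2 C L ^ 2 (u - t) G t]; adding up the contributions of [V] and
    of the integrands gives [G t <= 8 C L ^ 2 (u - t) G t <= G t / 2]. *)
Lemma energy_tail_step t u : 0 <= t -> t <= u -> u <= T -> u - t <= 1 ->
  16 * C * L ^+ 2 * (u - t) <= 1 -> G u = 0%E -> G t = 0%E.
Proof.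
move=> t0 tu uT tu1 small Gu; have tT := le_trans tu uT; have u0 := le_trans t0 tu.
pose K := 2 * L ^+ 2 * (u - t).
have K0 : 0 <= K by rewrite !mulr_ge0 ?sqr_ge0// subr_ge0.
have Qs s : t <= s -> s <= u -> (Q s <= K%:E * G t)%E.
  move=> ts su; have s0 := le_trans t0 ts.
  apply: le_trans (residual_le s0 su uT) _; rewrite Gu mule0 adde0 muleA -EFinM.
  apply: lee_pmul => //; last exact: energy_tail_mono.
  - by rewrite lee_fin mulr_ge0 ?sqr_ge0// mulr_ge0// subr_ge0.
  - exact: energy_tail_ge0.
  - rewrite lee_fin /K mulrCA mulrA ler_wpM2l ?mulr_ge0 ?sqr_ge0//.
    by rewrite lerD2l lerN2.
have Gf : (G t \is a fin_num)%E by rewrite ge0_fin_numE ?energy_tail_ge0 ?energy_tail_lty.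
have Qfin s : t <= s -> s <= u -> (Q s <= (K * fine (G t))%:E)%E.
  by move=> ts su; rewrite EFinM fineK// Qs.
have est s : t <= s -> s <= u -> (`N[V s] <= (C * (K * fine (G t)))%:E)%E.
  move=> ts su; apply: le_trans (gap_le _) _.
    by rewrite (le_trans t0 ts) (le_trans su uT).
  by rewrite EFinM lee_wpmul2l ?lee_fin ?(ltW C0)//; exact: Qfin.
have zeta : (\int[P]_w \int[mu]_(r in `[t, T]) ((Z1 r w - Z2 r w) ^+ 2)%:E <= (C * (K * fine (G t)))%:E)%E.
  apply: le_trans (integrand_gap_le _) _; first by rewrite t0.
  by rewrite EFinM lee_wpmul2l ?lee_fin ?(ltW C0)//; exact: Qfin.
have N0 r : (0 <= `N[V r])%E by apply: integral_ge0 => w _; rewrite lee_fin sqr_ge0.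
have late : (\int[mu]_(r in `[u, T]) `N[V r] <= 0)%E.
  rewrite -(energy_mean_square P mV u0 (lexx T)) -Gu.
  apply: ge0_le_integral_nomeas => w _.
    by apply: integral_ge0 => r _; rewrite lee_fin sqr_ge0.
  apply: ge0_le_integral_nomeas => r _; first by rewrite lee_fin sqr_ge0.
  rewrite lee_fin -[leLHS]real_normK ?num_real// ler_pXn2r// ?nnegrE// /g ?addr_ge0//.
  by rewrite lerDl.
have early : (\int[mu]_(r in `[t, u]) `N[V r] <= (C * (K * fine (G t)))%:E)%E.
  apply: (@le_trans _ _ (\int[mu]_(r in `[t, u]) (C * (K * fine (G t)))%:E)%E).
    apply: ge0_le_integral_nomeas => r /=; rewrite in_itv/= => /andP[tr ru] //.
    exact: est.
  rewrite integral_cst; last exact: measurable_itv.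
  rewrite [X in (_ * X)%E](lebesgue_measure_itvcc tu) -EFinM lee_fin ler_piMr//.
  by rewrite mulr_ge0 ?(ltW C0)// mulr_ge0// fine_ge0// energy_tail_ge0.
have whole : (\int[mu]_(r in `[t, T]) `N[V r] <= (C * (K * fine (G t)))%:E)%E.
  have mN : measurable_fun (`[t, T] : set (measurableTypeR R)) (fun r => `N[V r])%E.
    exact: (measurable_mean_square P mV t0 (lexx T)).
  have E : `[t, u]%classic `|` `]u, T]%classic = `[t, T]%classic :> set (measurableTypeR R).
    apply/seteqP; split => r /=; rewrite !in_itv/=.
      by move=> [/andP[-> ru]|/andP[ur ->]]; rewrite ?(le_trans ru uT) ?(le_trans tu (ltW ur)).
    by move=> /andP[-> ->]; rewrite andbT; case: (leP r u) => ?; [left|right].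
  have mN' : measurable_fun (`]u, T] : set (measurableTypeR R)) (fun r => `N[V r])%E.
    by apply: measurable_funS mN => //; rewrite -E; exact: subsetUr.
  rewrite -E ge0_integral_setU//=.
  - rewrite -[leRHS]adde0; apply: leeD; first exact: early.
    by rewrite integral_itv_obnd_cbnd.
  - by rewrite E.
  - rewrite disj_set2E; apply/eqP; rewrite -subset0 => r /=; rewrite !in_itv/=.
    by move=> [/andP[_ ru] /andP[]]; rewrite ltNge ru.
have : (G t <= (2 * (2 * (C * (K * fine (G t)))))%:E)%E.
  apply: le_trans (energy_tail_le t0) _; rewrite [leRHS]EFinM lee_wpmul2l ?lee_fin//.
  by rewrite mulr_natl mulr2n EFinD; apply: leeD.
rewrite -[in X in (X <= _)%E](fineK Gf) lee_fin => h.
have g0 : 0 <= fine (G t) by rewrite fine_ge0// energy_tail_ge0.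
suff : fine (G t) = 0 by move=> E; rewrite -(fineK Gf) E.
apply/eqP; rewrite eq_le g0 andbT.
have : 4 * C * K * 2 * fine (G t) <= fine (G t).
  rewrite -[leRHS]mul1r ler_wpM2r// (le_trans _ small)// /K le_eqVlt; apply/orP; left; apply/eqP; ring.
move: h g0; move: (fine (G t)) => x h g0 h'.
nra.
Qed.

(** A backward equation with Lipschitz drift, no terminal value and a
    deterministic forcing [m] has only the zero solution among processes that
    are centred in the sense of [centered]; then [m] vanishes as well. *)
Lemma lipschitz_uniqueness t : 0 <= t <= T ->
  `N[V t] = 0%E /\ `N[fun w => (V t w - m t)%R] = 0%E.
Proof.
move=> /andP[t0 tT].
have G0 : G 0 = 0%E.
  pose h := Num.min 1 (16 * C * L ^+ 2 + 1)^-1.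
  have a0 : 0 <= 16 * C * L ^+ 2 by rewrite !mulr_ge0 ?sqr_ge0// ltW.
  have h0 : 0 < h by rewrite lt_min ltr01 invr_gt0 ltr_wpDl.
  apply: (backward_induction T0 h0 (Q := fun t => G t = 0%E)).
    rewrite /G set_itv1; apply: integral0_eq => w _; exact: integral_set1.
  move=> s u s0 su uT; rewrite le_min => /andP[h1 h2]; apply: energy_tail_step => //.
  apply: le_trans (ler_wpM2l a0 h2) _.
  by rewrite ler_pdivrMr ?ltr_wpDl// mul1r lerDl.
have Gt : G t = 0%E by apply/eqP; rewrite eq_le energy_tail_ge0 andbT -G0 energy_tail_mono.
have GT : G T = 0%E by apply/eqP; rewrite eq_le energy_tail_ge0 andbT -G0 energy_tail_mono.
have Qt : (Q t <= 0)%E.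
  by apply: le_trans (residual_le t0 tT (lexx T)) _; rewrite Gt GT !mule0 adde0 mule0.
have t0T : 0 <= t <= T by rewrite t0.
have CQ : (C%:E * Q t <= 0)%E.
  by rewrite -(mule0 C%:E) lee_wpmul2l// lee_fin ltW.
by split; apply/eqP; rewrite eq_le integral_ge0 ?andbT;
  do ?[by move=> w _; rewrite lee_fin sqr_ge0];
  apply: le_trans CQ; [exact: gap_le|exact: shifted_gap_le].
Qed.

End LipschitzUniqueness.

(** * Generators along the paths of a solution *)

Lemma rat_close (R : realType) (x e : R) : 0 < e -> exists q : rat, `|x - ratr q| < e.
Proof.
move=> e0; have /rat_in_itvoo[q] : x - e < x + e by lra.
rewrite in_itv/= => /andP[h1 h2]; exists q; rewrite ltr_norml; apply/andP; split; lra.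
Qed.

Section Superposition.
Context d (U : measurableType d) (R : realType).
Variables (D : set U) (f : U -> R -> R -> R) (y z : U -> R) (lambda : R).
Hypothesis lambda0 : 0 < lambda.
Hypothesis mf : forall a b, measurable_fun D (fun s => f s a b).
Hypothesis my : measurable_fun D y.
Hypothesis mz : measurable_fun D z.
Hypothesis lipf : forall s a a' b b', D s ->
  `|f s a b - f s a' b'| <= lambda * (`|a - a'| + `|b - b'|).

(** By the Lipschitz property [f s (y s) (z s)] is the supremum over rational
    [q], [r] of [f s q r - lambda * (|y s - q| + |z s - r|)], a countable family
    of measurable functions. *)
Lemma measurable_lipschitz_superposition : measurable_fun D (fun s => f s (y s) (z s)).
Proof.
move=> mD; apply: (measurability _ (RGenOInfty.measurableE R)) => //.
move=> /= _ [_ [c ->] <-]; rewrite preimage_itvoy.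
pose h (q r : rat) s := f s (ratr q) (ratr r) - lambda * (`|y s - ratr q| + `|z s - ratr r|).
have mh q r : measurable_fun D (h q r).
  apply: measurable_funB; first exact: mf.
  apply: measurable_funM; first exact: measurable_cst.
  apply: measurable_funD; apply: measurableT_comp => //; apply: measurable_funB => //.
rewrite [X in measurable X](_ : _ = \bigcup_(q : rat) \bigcup_(r : rat)
   (D `&` [set s | c < h q r s])).
  apply: bigcupT_measurable_rat => q; apply: bigcupT_measurable_rat => r.
  by rewrite -preimage_itvoy; apply: mh => //; exact: measurable_itv.
apply/seteqP; split => [s /= [Ds cs]|s /= [q _ [r _ [Ds cs]]]].
  (* Rational points within e lose less than 2 * lambda * e in f, and as much
     again in the penalty. *)
  have [e [e0 le]] : exists e, 0 < e /\ lambda * (4 * e) = f s (y s) (z s) - c.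
    exists ((f s (y s) (z s) - c) / (4 * lambda)); split.
      by rewrite divr_gt0 ?mulr_gt0// subr_gt0.
    by field; rewrite gt_eqF.
  have [q hq] := rat_close (y s) e0; have [r hr] := rat_close (z s) e0.
  exists q => //; exists r => //; split => //; rewrite /= /h.
  have := lipf (y s) (ratr q) (z s) (ratr r) Ds; rewrite ler_norml => /andP[_ hl].
  have : lambda * (`|y s - ratr q| + `|z s - ratr r|) < lambda * (2 * e).
    by rewrite ltr_pM2l// mulr_natl mulr2n ltrD.
  by lra.
split => //=; have := lipf (y s) (ratr q) (z s) (ratr r) Ds; rewrite ler_norml => /andP[hl _].
by move: cs; rewrite /= /h => cs; rewrite /=; lra.
Qed.

End Superposition.

Section PathwiseGenerator.
Context (R : realType).
Local Notation mu := (@lebesgue_measure R).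
Variables (T lambda : R) (f : R -> R -> R -> R).
Hypothesis lambda0 : 0 < lambda.
Hypothesis mf : forall a b, measurable_fun (`[0, T] : set (measurableTypeR R)) (fun s => f s a b).
Hypothesis f0 : (\int[mu]_(s in `[0%R, T]) ((f s 0 0) ^+ 2)%:E < +oo)%E.
Hypothesis lipf : forall s a a' b b', 0 <= s <= T ->
  `|f s a b - f s a' b'| <= lambda * (`|a - a'| + `|b - b'|).
Variables (y z : R -> R) (t : R).
Hypothesis tT : 0 <= t <= T.
Hypothesis my : measurable_fun (`[0, T] : set (measurableTypeR R)) y.
Hypothesis mz : measurable_fun (`[0, T] : set (measurableTypeR R)) z.
Hypothesis iy : (\int[mu]_(s in `[0%R, T]) ((y s) ^+ 2)%:E < +oo)%E.
Hypothesis iz : (\int[mu]_(s in `[0%R, T]) ((z s) ^+ 2)%:E < +oo)%E.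

Let T0 : 0 <= T. Proof. by case/andP: tT => t0; exact: le_trans. Qed.

Lemma integrable_tail (g : R -> R) : mu.-integrable `[0, T] (EFin \o g) ->
  mu.-integrable `[t, T] (EFin \o g).
Proof.
apply: integrableS; do ?exact: measurable_itv.
move=> r /=; rewrite !in_itv/= => /andP[tr ->]; rewrite andbT.
by apply: le_trans tr; case/andP: tT.
Qed.

Lemma generator_integrable : mu.-integrable `[t, T] (EFin \o (fun s => f s (y s) (z s))).
Proof.
apply: integrable_tail.
have i0 := integrable_norm (integrable_of_sqr T0 (mf 0 0) f0).
have i1 := integrable_norm (integrable_of_sqr T0 my iy).
have i2 := integrable_norm (integrable_of_sqr T0 mz iz).
have mI : measurable (`[0, T] : set (measurableTypeR R)) by exact: measurable_itv.
have i3 := integrableZl mI lambda (integrableD mI i1 i2).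
apply: le_integrable (integrableD mI i0 i3) => //.
  by apply/measurable_EFinP; apply: (@measurable_lipschitz_superposition _ _ _ _ f y z lambda) => //.
move=> s /=; rewrite in_itv/= => sT; rewrite lee_fin.
have h := lipf (y s) 0 (z s) 0 sT; rewrite !subr0 in h.
have r0 : 0 <= `|f s 0 0| + lambda * (`|y s| + `|z s|).
  by apply: addr_ge0 => //; apply: mulr_ge0; [exact: ltW|exact: addr_ge0].
rewrite (ger0_norm r0); apply: le_trans (_ : _ <= `|f s 0 0| + `|f s (y s) (z s) - f s 0 0|) _.
  by apply: le_trans (ler_normD _ _); rewrite addrC subrK.
by rewrite lerD2l.
Qed.

End PathwiseGenerator.

Lemma Rintegral_diff_bound (R : realType) (t T L : R) (p1 p2 q g : R -> R) :
  let mu := @lebesgue_measure R in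
  mu.-integrable `[t, T] (EFin \o p1) -> mu.-integrable `[t, T] (EFin \o p2) ->
  mu.-integrable `[t, T] (EFin \o q) -> mu.-integrable `[t, T] (EFin \o g) ->
  (forall s, t <= s <= T -> `|p1 s - p2 s - q s| <= L * g s) ->
  `|\int[mu]_(s in `[t, T]) p1 s - \int[mu]_(s in `[t, T]) p2 s - \int[mu]_(s in `[t, T]) q s|
    <= L * \int[mu]_(s in `[t, T]) g s.
Proof.
move=> mu i1 i2 iq ig h.
have mI : measurable (`[t, T] : set (measurableTypeR R)) by exact: measurable_itv.
have i12 := integrableB mI i1 i2; have i := integrableB mI i12 iq.
have iL := integrableZl mI L ig.
rewrite -RintegralB// -RintegralB// -RintegralZl//.
apply: le_trans (le_normr_Rintegral mI i) _.
by apply: le_Rintegral => //; exact: integrable_norm.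
Qed.

Lemma ae_and d (U : measurableType d) (R : realType) (mu : {measure set U -> \bar R})
  (A B : U -> Prop) :
  {ae mu, forall w, A w} -> {ae mu, forall w, B w} -> {ae mu, forall w, A w /\ B w}.
Proof. by move=> hA hB; apply: filterS2 hA hB => w. Qed.

Section Solutions.
Context d (Omega : measurableType d) (R : realType) (P : probability Omega R) (T : R)
 (F : R -> set (set Omega)).
Hypothesis T0 : 0 <= T.
Hypothesis Ffil : filtration T F.
Local Notation mu := (@lebesgue_measure R).
Local Notation "`N[ X ]" := (\int[P]_w (X w ^+ 2)%:E)%E (at level 0, X at level 99).

Lemma S2_jointly_measurable Y : S2 P T F Y -> jointly_measurable T Y.
Proof.
move=> [aY cY _]; apply: continuous_jointly_measurable => // u uT.
exact: adapted_measurable aY uT.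
Qed.

Lemma S2_mean_square Y : S2 P T F Y ->
  exists C : R, forall t, 0 <= t <= T -> (`N[Y t] <= C%:E)%E.
Proof.
move=> [aY cY sY]; set S := (X in (X < +oo)%E) in sY.
have le t : 0 <= t <= T -> (`N[Y t] <= S)%E.
  move=> tT; apply: ge0_le_integral_nomeas => w _; first by rewrite lee_fin sqr_ge0.
  by apply: ereal_sup_ubound; exists t => //=; rewrite in_itv.
have S0 : (0 <= S)%E.
  apply: le_trans (le 0 _); last by rewrite lexx.
  by apply: integral_ge0 => w _; rewrite lee_fin sqr_ge0.
exists (fine S) => t /le; rewrite fineK//.
by rewrite ge0_fin_numE.
Qed.

Lemma S2_square_integrable Y t : S2 P T F Y -> 0 <= t <= T -> square_integrable P (Y t).
Proof.
move=> sY tT; split; first by case: (sY) => aY _ _; exact: (adapted_measurable Ffil aY tT).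
have [C hC] := S2_mean_square sY.
by apply: le_lt_trans (hC t tT) _; exact: ltry.
Qed.

Lemma energy_lty (X : R -> Omega -> R) (C : R) : jointly_measurable T X ->
  (forall t, 0 <= t <= T -> (`N[X t] <= C%:E)%E) ->
  (\int[P]_w \int[mu]_(r in `[0%R, T]) ((X r w) ^+ 2)%:E < +oo)%E.
Proof.
move=> mX hC; rewrite (energy_mean_square P mX (lexx 0) (lexx T)).
apply: (@le_lt_trans _ _ (\int[mu]_(r in `[0%R, T]) (C%:E))%E).
  apply: ge0_le_integral_nomeas => r /=; rewrite in_itv/= => rT; last exact: hC.
  by apply: integral_ge0 => w _; rewrite lee_fin sqr_ge0.
by rewrite integral_cst ?[X in (_ * X)%E](lebesgue_measure_itvcc T0) ?ltry//; exact: measurable_itv.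
Qed.

Lemma ae_path_energy_lty (X : R -> Omega -> R) : jointly_measurable T X ->
  (\int[P]_w \int[mu]_(r in `[0%R, T]) ((X r w) ^+ 2)%:E < +oo)%E ->
  {ae P, forall w, (\int[mu]_(r in `[0%R, T]) ((X r w) ^+ 2)%:E < +oo)%E}.
Proof.
move=> mX fX.
have J0 w : (0 <= \int[mu]_(r in `[0%R, T]) ((X r w) ^+ 2)%:E)%E.
  by apply: integral_ge0 => r _; rewrite lee_fin sqr_ge0.
have iJ : P.-integrable setT (fun w => \int[mu]_(r in `[0%R, T]) ((X r w) ^+ 2)%:E)%E.
  apply/integrableP; split; first exact: (measurable_energy mX (lexx 0) (lexx T)).
  by under eq_integral do rewrite gee0_abs//.
apply: filterS (integrable_ae measurableT iJ) => w /(_ I).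
by rewrite ge0_fin_numE.
Qed.

Lemma H2_jointly_measurable Z : H2 P T F Z -> jointly_measurable T Z.
Proof. by case=> pZ _; exact: predictable_jointly_measurable pZ. Qed.

Lemma S2_ae_path Y : S2 P T F Y ->
  {ae P, forall w, (\int[mu]_(r in `[0%R, T]) ((Y r w) ^+ 2)%:E < +oo)%E}.
Proof.
move=> sY; have [C hC] := S2_mean_square sY; have mY := S2_jointly_measurable sY.
exact: ae_path_energy_lty (energy_lty mY hC).
Qed.

Lemma H2_ae_path Z : H2 P T F Z ->
  {ae P, forall w, (\int[mu]_(r in `[0%R, T]) ((Z r w) ^+ 2)%:E < +oo)%E}.
Proof.
by move=> hZ; apply: ae_path_energy_lty; [exact: H2_jointly_measurable hZ|case: hZ].
Qed.

Lemma progressive_jointly_measurable X : progressive T F X -> jointly_measurable T X.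
Proof.
have TT : 0 <= T <= T by rewrite T0 lexx.
move=> /(_ T TT) pX; have mI := filtration_measurable Ffil TT.
pose GT := g_sigma_algebraType (F T).
pose i (p : Omega * measurableTypeR R) : GT * measurableTypeR R := (p.1 : GT, p.2).
have mi : measurable_fun setT i.
  apply: measurable_fun_pair => //.
  exact: (measurableT_comp (measurable_id_sub mI) measurable_fst).
apply: (@measurable_comp _ _ _ _ _ _ _ _ _ i _ _ pX (measurable_funTS mi)).
- by apply: measurableX => //; exact: measurable_itv.
- by move=> _ [p [_ pT] <-]; split => //; exact: pT.
Qed.

(** The properties of a generator that are used path by path.  They are shared by
    a progressively measurable Lipschitz generator and by the deterministic
    generator of the g-expectation. *)
Definition pathwise_generator (lambda : R) (f : Omega -> R -> R -> R -> R) : Prop :=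
  [/\ forall y z w, measurable_fun (`[0, T] : set (measurableTypeR R)) (fun t => f w t y z),
      {ae P, forall w, forall t y y' z z', 0 <= t <= T ->
         `|f w t y z - f w t y' z'| <= lambda * (`|y - y'| + `|z - z'|)} &
      {ae P, forall w, (\int[mu]_(t in `[0%R, T]) ((f w t 0 0) ^+ 2)%:E < +oo)%E}].

Lemma lipschitz_generator_pathwise lambda f :
  lipschitz_generator P T F lambda f -> pathwise_generator lambda f.
Proof.
move=> [pf lf if0]; split => //.
  move=> y z w; exact: (jointly_measurable_section (progressive_jointly_measurable (pf y z)) (lexx 0) (lexx T)).
exact: (ae_path_energy_lty (progressive_jointly_measurable (pf 0 0)) if0).
Qed.

Lemma ae_generator_integrable lambda f Y Z : 0 < lambda -> pathwise_generator lambda f ->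
  S2 P T F Y -> H2 P T F Z -> {ae P, forall w, forall t, 0 <= t <= T ->
    mu.-integrable `[t, T] (EFin \o (fun s => f w s (Y s w) (Z s w)))}.
Proof.
move=> l0 [mf lf if0] sY hZ.
have mY := S2_jointly_measurable sY; have mZ := H2_jointly_measurable hZ.
have h := ae_and (ae_and lf if0) (ae_and (S2_ae_path sY) (H2_ae_path hZ)).
apply: filterS h => w [[lfw if0w] [iY iZ]] t tT.
apply: (@generator_integrable _ T lambda (f w) l0 _ if0w lfw (Y^~ w) (Z ^~ w)) => //.
- exact: (jointly_measurable_section mY (lexx 0) (lexx T)).
- exact: (jointly_measurable_section mZ (lexx 0) (lexx T)).
Qed.

End Solutions.

(** * Two solutions that differ by a deterministic function *)

Section AlmostSure.
Context d (Omega : measurableType d) (R : realType) (P : probability Omega R).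

Lemma ae_eq0_of_mean_square (X : Omega -> R) : measurable_fun setT X ->
  (\int[P]_w ((X w) ^+ 2)%:E = 0)%E -> {ae P, forall w, X w = 0}.
Proof.
move=> mX X0; pose Y w := ((X w) ^+ 2)%:E.
have mY : measurable_fun setT Y by exact: measurable_sqr.
have : (\int[P]_w `|Y w| = 0)%E.
  by under eq_integral do rewrite gee0_abs ?lee_fin ?sqr_ge0//.
move/(ae_eq_integral_abs P measurableT mY).1; apply: filterS => w /(_ I).
by move=> /eqP; rewrite eqe sqrf_eq0 => /eqP.
Qed.

Lemma ae_constant (A : Prop) : {ae P, forall w : Omega, A} -> A.
Proof.
move=> [N [mN N0 sN]]; apply: contrapT => nA.
have : P setT = 0%E.
  apply/eqP; rewrite eq_le measure_ge0 andbT -N0 le_measure ?inE//.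
  by move=> w _; apply: sN.
by rewrite probability_setT => /eqP; rewrite onee_eq0.
Qed.

End AlmostSure.

Section Difference.
Context d (Omega : measurableType d) (R : realType) (P : probability Omega R) (T : R)
 (F : R -> set (set Omega)) (B : R -> Omega -> R).
Hypothesis T0 : 0 <= T.
Hypothesis Ffil : filtration T F.
Hypothesis Bbm : brownian_motion P T F B.
Local Notation mu := (@lebesgue_measure R).
Local Notation "`N[ X ]" := (\int[P]_w (X w ^+ 2)%:E)%E (at level 0, X at level 99).

Variables (lambda L c CD : R) (f : Omega -> R -> R -> R -> R) (X1 X2 : Omega -> R)
  (Y1 Z1 Y2 Z2 : R -> Omega -> R) (K1 K2 D p : R -> R).
Hypothesis lambda0 : 0 < lambda.
Hypothesis L0 : 0 <= L.
Hypothesis pf : pathwise_generator P T lambda f.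
Hypothesis X12 : forall w, X1 w = X2 w + c.
Hypothesis sol1 : bsde_solution P T F B X1 f K1 Y1 Z1.
Hypothesis sol2 : bsde_solution P T F B X2 f K2 Y2 Z2.
Hypothesis mD : measurable_fun (`[0, T] : set (measurableTypeR R)) D.
Hypothesis bD : forall t, 0 <= t <= T -> `|D t| <= CD.
Hypothesis ip : mu.-integrable `[0, T] (EFin \o p).
Hypothesis lip : {ae P, forall w, forall t y y' z z', 0 <= t <= T ->
  `|f w t y z - f w t y' z' - p t| <= L * (`|y - y' - D t| + `|z - z'|)}.

(** The deterministic terms of the equation of [Y1 - Y2], minus [D]: it vanishes
    exactly when [D] solves the deterministic part of that equation. *)
Definition drift_gap t : R :=
  c + (K1 T - K1 t) - (K2 T - K2 t) + \int[mu]_(s in `[t, T]) p s - D t.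

Let V t w : R := Y1 t w - Y2 t w - D t.

Hypothesis centered : forall t, 0 <= t <= T ->
  (`N[V t] <= `N[fun w => (V t w - drift_gap t)%R])%E.

(** Subtracting the two equations, [Y1 - Y2 - D] satisfies a Lipschitz backward
    equation with forcing [drift_gap], whose solution is zero by
    [lipschitz_uniqueness].  The process [p] stands for the effect of the shift
    [D] on the generator; with [c], [D], [p] and [K1 - K2] all zero this is the
    uniqueness of the solution. *)
Lemma bsde_difference t : 0 <= t <= T ->
  {ae P, forall w, Y1 t w - Y2 t w = D t} /\ drift_gap t = 0.
Proof.
move=> tT; case: sol1 => sY1 hZ1 [M1 iM1 eq1]; case: sol2 => sY2 hZ2 [M2 iM2 eq2].
have mY1 := S2_jointly_measurable Ffil sY1; have mY2 := S2_jointly_measurable Ffil sY2.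
have mZ1 := H2_jointly_measurable hZ1; have mZ2 := H2_jointly_measurable hZ2.
have mV : jointly_measurable T V.
  apply: measurable_funB; first exact: measurable_funB.
  apply: (@measurable_comp _ _ _ (Omega * measurableTypeR R)%type (measurableTypeR R) _ _ _ _
    snd _ _ mD (measurable_funTS measurable_snd)); first exact: measurable_itv.
  by move=> _ [q [_ qT] <-].
have aV : adapted T F V.
  case: sY1 => aY1 _ _; case: sY2 => aY2 _ _ u uT.
  apply: measurable_funB; last exact: measurable_cst.
  by apply: measurable_funB; [exact: aY1|exact: aY2].
have [C1 hC1] := S2_mean_square T0 sY1; have [C2 hC2] := S2_mean_square T0 sY2.
have mYt (Y : R -> Omega -> R) u : S2 P T F Y -> 0 <= u <= T -> measurable_fun setT (Y u).
  by move=> [aY _ _]; exact: (adapted_measurable Ffil aY).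
have bV u : 0 <= u <= T -> (`N[V u] <= (3 * (C1 + (C2 + CD ^+ 2)))%:E)%E.
  move=> uT; apply: (@le_trans _ _ (3%:E * (`N[Y1 u] + (`N[Y2 u] + `N[fun=> D u])))%E).
    apply: mean_square_sum3 => //; [exact: mYt sY1 uT|exact: mYt sY2 uT|].
    move=> w _; rewrite /V; set x := Y1 u w; set y := Y2 u w; set z := D u.
    have := sqr_ge0 (x + y); have := sqr_ge0 (x + z); have := sqr_ge0 (y - z); lra.
  rewrite [leRHS]EFinM lee_wpmul2l ?lee_fin// [leRHS]EFinD; apply: leeD; first exact: hC1.
  rewrite [leRHS]EFinD; apply: leeD; first exact: hC2.
  rewrite integral_cst// [X in (_ * X)%E](@probability_setT _ _ _ P) mule1 lee_fin.
  by rewrite -real_normK ?num_real// ler_pXn2r ?nnegrE ?bD// (le_trans _ (bD uT)).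
have Zfin : (\int[P]_w \int[mu]_(r in `[0%R, T]) ((Z1 r w - Z2 r w) ^+ 2)%:E < +oo)%E.
  apply: (@le_lt_trans _ _ (2%:E * (\int[P]_w \int[mu]_(r in `[0%R, T]) ((Z1 r w) ^+ 2)%:E +
     \int[P]_w \int[mu]_(r in `[0%R, T]) ((Z2 r w) ^+ 2)%:E))%E); last first.
    case: hZ1 => _ h1; case: hZ2 => _ h2.
    by apply: lte_mul_pinfty => //; exact: lte_add_pinfty.
  have n0 (Z : R -> Omega -> R) w : setT w -> (0 <= \int[mu]_(r in `[0%R, T]) ((Z r w) ^+ 2)%:E)%E.
    by move=> _; apply: integral_ge0 => r _; rewrite lee_fin sqr_ge0.
  apply: ge0_integral_le_combination => //.
  - exact: (n0 (fun r w => Z1 r w - Z2 r w)).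
  - exact: n0.
  - exact: n0.
  - exact: (measurable_energy mZ1 (lexx 0) (lexx T)).
  - exact: (measurable_energy mZ2 (lexx 0) (lexx T)).
  - move=> w _; apply: mean_square_sum2 => //.
    + exact: (jointly_measurable_section mZ1 (lexx 0) (lexx T)).
    + exact: (jointly_measurable_section mZ2 (lexx 0) (lexx T)).
    + by move=> r _; have := sqrD_le (Z1 r w) (- Z2 r w); rewrite sqrrN; lra.
have bound u : 0 <= u <= T -> {ae P, forall w,
    mu.-integrable `[u, T] (fun r => (`|V r w| + `|Z1 r w - Z2 r w|)%:E) ->
    `|V u w - drift_gap u + ito_incr T M1 M2 u w| <=
      L * \int[mu]_(r in `[u, T]) (`|V r w| + `|Z1 r w - Z2 r w|)}.
  move=> uT.
  have i1 := ae_generator_integrable T0 Ffil lambda0 pf sY1 hZ1.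
  have i2 := ae_generator_integrable T0 Ffil lambda0 pf sY2 hZ2.
  have h := ae_and (ae_and (ae_and i1 i2) lip) (ae_and (eq1 u uT) (eq2 u uT)).
  apply: filterS h => w [[[i1w i2w] lw] [e1 e2]] ig.
  have u0 : 0 <= u by case/andP: uT.
  rewrite (_ : V u w - _ + _ = \int[mu]_(s in `[u, T]) f w s (Y1 s w) (Z1 s w) -
    \int[mu]_(s in `[u, T]) f w s (Y2 s w) (Z2 s w) - \int[mu]_(s in `[u, T]) p s); last first.
    by rewrite /V e1 e2 X12 /drift_gap /ito_incr; ring.
  apply: Rintegral_diff_bound => //; [exact: i1w|exact: i2w| |].
    by apply: integrable_tail uT _ ip.
  move=> s /andP[us sT]; have sT' : 0 <= s <= T by rewrite (le_trans u0 us).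
  exact: lw.
have [V0 Vm0] := lipschitz_uniqueness T0 Ffil Bbm mZ1 mZ2 iM1 iM2 Zfin mV aV bV L0 centered bound tT.
have mVt : measurable_fun setT (V t) by exact: (adapted_measurable Ffil aV tT).
have h1 := ae_eq0_of_mean_square mVt V0.
have mVm : measurable_fun setT (fun w => V t w - drift_gap t) by exact: measurable_funB.
have h2 := ae_eq0_of_mean_square mVm Vm0.
split.
  by apply: filterS h1 => w /eqP; rewrite /V subr_eq0 => /eqP.
apply: (@ae_constant _ _ _ P); apply: filterS2 h1 h2 => w -> /eqP.
by rewrite sub0r oppr_eq0 => /eqP.
Qed.

End Difference.

(** * The g-expectation of a constant *)

Section ExpIntegral.
Context (R : realType).
Local Notation mu := (@lebesgue_measure R).

Lemma is_derive_expR_affine (k c T x : R) :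
  is_derive x (1 : R) (fun s : R => c * expR (k * (s - T))) (k * (c * expR (k * (x - T)))).
Proof.
have h1 : is_derive x (1 : R) (fun s : R => k * (s - T)) k.
  apply: is_derive_eq; rewrite -/(GRing.scale _ _) /= ?scaler0 ?subr0 ?add0r ?addr0.
  by rewrite /GRing.scale/= mulr1.
have h2 := @is_derive1_comp _ expR (fun s : R => k * (s - T)) x _ _ (is_derive_expR _) h1.
have h3 := @is_deriveZ _ _ _ _ c x 1 _ h2.
apply: is_derive_eq h3 _; rewrite /GRing.scale/=; ring.
Qed.

Lemma Rintegral_expR_affine (k c t T : R) : t <= T ->
  \int[mu]_(s in `[t, T]) (k * (c * expR (k * (s - T)))) = c - c * expR (k * (t - T)).
Proof.
rewrite le_eqVlt => /predU1P[->|tT].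
  by rewrite set_itv1 Rintegral_set1 subrr mulr0 expR0 mulr1 subrr.
pose E (s : R) := c * expR (k * (s - T)).
have dE x : is_derive x (1 : R) E (k * E x) by exact: is_derive_expR_affine.
have cE : continuous E.
  by move=> x; apply: differentiable_continuous; apply/derivable1_diffP; case: (dE x).
rewrite /Rintegral (@continuous_FTC2 _ _ E)//.
- by rewrite /= /E subrr mulr0 expR0 mulr1.
- apply: continuous_subspaceT => x; apply: cvgM; first exact: cvg_cst.
  exact: cE.
- split.
  + by move=> x _; case: (dE x).
  + exact/cvg_at_right_filter/cE.
  + exact/cvg_at_left_filter/cE.
- by move=> x _; rewrite derive1E; case: (dE x).
Qed.

End ExpIntegral.

Section ConstantGexp.
Context d (Omega : measurableType d) (R : realType) (P : probability Omega R) (T : R)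
 (F : R -> set (set Omega)) (B : R -> Omega -> R).
Hypothesis T0 : 0 <= T.
Hypothesis Ffil : filtration T F.
Hypothesis Bbm : brownian_motion P T F B.
Local Notation mu := (@lebesgue_measure R).
Variable kappa : R.
Hypothesis kappa0 : 0 < kappa.

Let fk (_ : Omega) (_ y z : R) : R := kappa * (`|y| + `|z|).

Lemma gexp_generator_lipschitz (y y' z z' : R) :
  `|kappa * (`|y| + `|z|) - kappa * (`|y'| + `|z'|)| <= kappa * (`|y - y'| + `|z - z'|).
Proof.
rewrite -mulrBr normrM gtr0_norm// ler_wpM2l ?(ltW kappa0)//.
rewrite (_ : _ - _ = (`|y| - `|y'|) + (`|z| - `|z'|)); last by ring.
by apply: le_trans (ler_normD _ _) _; rewrite lerD// ler_dist_dist.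
Qed.

Lemma gexp_generator_pathwise : pathwise_generator P T kappa fk.
Proof.
split.
- by move=> y z w; exact: measurable_cst.
- by apply: aeW => w t y y' z z' _; exact: gexp_generator_lipschitz.
- apply: aeW => w; rewrite integral0_eq ?ltry// => t _.
  by rewrite /fk normr0 addr0 mulr0 expr0n.
Qed.

Lemma gexp_solution_unique (X : Omega -> R) Y Z Y' Z' :
  bsde_solution P T F B X fk (fun=> 0) Y Z -> bsde_solution P T F B X fk (fun=> 0) Y' Z' ->
  {ae P, forall w, Y 0 w = Y' 0 w}.
Proof.
move=> s1 s2; have TT : 0 <= (0 : R) <= T by rewrite lexx.
have [||||||h _] := @bsde_difference _ _ _ P T F B T0 Ffil Bbm kappa kappa 0 0 fk X X Y Z Y' Z'
  (fun=> 0) (fun=> 0) (fun=> 0) (fun=> 0) kappa0 (ltW kappa0) gexp_generator_pathwise _ s1 s2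
  _ _ _ _ _ _ TT.
- by move=> w; rewrite addr0.
- exact: measurable_cst.
- by move=> t _; rewrite normr0.
- exact: (integrable_itv_cst T0 0).
- apply: aeW => w t y y' z z' _; rewrite !subr0; exact: gexp_generator_lipschitz.
- move=> t tT; rewrite le_eqVlt; apply/orP; left; apply/eqP; apply: eq_integral => w _.
  rewrite /drift_gap !subrr !subr0 !add0r.
  by rewrite Rintegral_cst ?mul0r ?subr0//; exact: measurable_itv.
- by apply: filterS h => w /eqP; rewrite subr_eq0 => /eqP.
Qed.

Definition empty_simple_process : simple_process T F.
Proof.
refine (@SimpleProcess _ _ _ T F 0 (fun=> 0) (fun _ _ => 0) _ _ _ _) => //.
by move=> i _; rewrite lexx.
Defined.

Lemma ito_integral0 : ito_integral P T F B (fun _ _ => 0) (fun _ _ => 0).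
Proof.
split.
- by move=> t _; exact: measurable_cst.
- by move=> w; apply: continuous_subspaceT => x; exact: cvg_cst.
exists (fun=> empty_simple_process); split.
  under eq_fun do (rewrite integral0_eq; last by move=> w _; rewrite integral0_eq// => r _;
    rewrite /sp_val big_ord0 subrr expr0n).
  exact: cvg_cst.
move=> t _; under eq_fun do (rewrite integral0_eq; last by move=> w _;
    rewrite /sp_integral big_ord0 subrr expr0n).
exact: cvg_cst.
Qed.

(** For the terminal value [- delta <= 0] the solution is deterministic with
    [z = 0], of absolute value [delta * exp (kappa * (t - T))], and by
    uniqueness it is the one that [gexp] selects. *)
Lemma gexp_constant (delta : R) : 0 <= delta ->
  gexp P T F B kappa (fun=> - delta) = - (delta * expR (kappa * (0 - T))).
Proof.
move=> d0; pose y (t : R) := - (delta * expR (kappa * (t - T))).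
have yle t : 0 <= t <= T -> (y t) ^+ 2 <= delta ^+ 2.
  move=> /andP[_ tT]; rewrite /y sqrrN ler_pXn2r ?nnegrE ?mulr_ge0 ?expR_ge0//.
  rewrite ler_piMr// -expR0 ler_expR.
  by rewrite mulr_ge0_le0 ?(ltW kappa0)// subr_le0.
have cy : continuous y.
  move=> x; have [dx _] := is_derive_expR_affine kappa delta T x.
  have := (derivable1_diffP _ _).1 dx; move/differentiable_continuous => cx.
  exact: (cvgN cx).
have sol : bsde_solution P T F B (fun=> - delta) fk (fun=> 0) (fun t _ => y t) (fun _ _ => 0).
  split.
  - split.
    + by move=> t _; exact: measurable_cst.
    + by move=> w; exact: continuous_subspaceT.
    + apply: (@le_lt_trans _ _ (\int[P]_w (delta ^+ 2)%:E)%E).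
        apply: ge0_le_integral_nomeas => w _.
          apply: le_trans (_ : ((y 0) ^+ 2)%:E <= _)%E; first by rewrite lee_fin sqr_ge0.
          by apply: ereal_sup_ubound; exists 0 => //=; rewrite in_itv/= lexx.
        apply: ge_ereal_sup => _ [r /= rT <-]; rewrite lee_fin; apply: yle.
        by move: rT; rewrite in_itv.
      by rewrite integral_cst// [X in (_ * X)%E](@probability_setT _ _ _ P) mule1 ltry.
  - split; first exact: measurable_cst.
    by rewrite integral0_eq ?ltry// => w _; rewrite integral0_eq// => r _; rewrite expr0n.
  - exists (fun _ _ => 0); first exact: ito_integral0.
    move=> t /andP[_ tT]; apply: aeW => w; rewrite !subrr subr0 addr0.
    under eq_Rintegral => s _ do rewrite /fk normr0 addr0 /y normrN ger0_norm ?mulr_ge0 ?expR_ge0//.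
    by rewrite Rintegral_expR_affine// addrA addNr add0r.
rewrite /gexp; apply: xget_unique.
  by exists (fun t _ => y t), (fun _ _ => 0); split => //; exact: aeW.
move=> y0 [Y [Z [solY Y0]]].
apply: (@ae_constant _ _ _ P).
by apply: filterS2 (gexp_solution_unique solY sol) Y0 => w -> <-.
Qed.

End ConstantGexp.

(** * Losses, nonlinear expectations and the constraint *)

Section Losses.
Context d (Omega : measurableType d) (R : realType) (P : probability Omega R) (T : R)
 (F : R -> set (set Omega)) (B : R -> Omega -> R).
Hypothesis T0 : 0 <= T.
Hypothesis Ffil : filtration T F.
Hypothesis Bbm : brownian_motion P T F B.

Let TT : 0 <= T <= T. Proof. by rewrite T0 lexx. Qed.

Lemma loss_measurable l t (X : Omega -> R) : loss_function P T F l -> 0 <= t <= T ->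
  measurable_wrt (F T) X -> measurable_wrt (F T) (fun w => l w t (X w)).
Proof.
move=> [ml _ _ _ _] tT mX.
pose GT := g_sigma_algebraType (F T).
pose i (w : GT) : GT * measurableTypeR R * measurableTypeR R := ((w, t), X w).
have mi : measurable_fun setT i.
  apply: measurable_fun_pair => //; apply: measurable_fun_pair => //.
apply: (@measurable_comp _ _ _ _ _ _ _ _ _ i _ _ ml mi).
- apply: measurableX => //; apply: measurableX => //; exact: measurable_itv.
- by move=> _ [w _ <-] /=; split => //; split => //=; rewrite in_itv.
Qed.

Lemma L2_square_integrable X : L2 P (F T) X -> square_integrable P X.
Proof.
by move=> [mX iX]; split => //; apply: measurable_wrtW mX; exact: (filtration_measurable Ffil).
Qed.

Lemma loss_L2 l t (X : Omega -> R) : loss_function P T F l -> 0 <= t <= T ->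
  L2 P (F T) X -> L2 P (F T) (fun w => l w t (X w)).
Proof.
move=> ll tT X2; have [mX iX] := X2.
have ml := loss_measurable ll tT mX.
have ml0 : measurable_wrt (F T) (fun w => l w t 0).
  by apply: (loss_measurable ll tT (X := cst 0)); exact: measurable_cst.
have FM := filtration_measurable Ffil TT.
have [_ _ sl _ [c [C [c0 cC bl]]]] := ll.
have C0 : 0 <= C by exact: ltW (lt_trans c0 cC).
have i0 : square_integrable P (fun w => l w t 0).
  split; first exact: measurable_wrtW ml0.
  apply: le_lt_trans sl; apply: ge0_le_integral_nomeas => w _.
    by rewrite lee_fin sqr_ge0.
  by apply: ereal_sup_ubound; exists t => //=; rewrite in_itv.
have iC : square_integrable P (fun w => C * X w).
  apply: square_integrable_bounded; [exact: L2_square_integrable|exact: measurable_cst|].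
  by exists `|C|.
split => //; suff [] : square_integrable P (fun w => l w t (X w)) by [].
apply: (square_integrable_le _ _ i0 iC).
- exact: measurable_wrtW ml.
- move=> w; have /andP[_] := bl w t (X w) 0 tT; rewrite subr0 => h.
  have h2 : (l w t (X w) - l w t 0) ^+ 2 <= (C * X w) ^+ 2.
    rewrite -[leLHS]real_normK ?num_real// -[leRHS]real_normK ?num_real//.
    by rewrite ler_pXn2r ?nnegrE// normrM (ger0_norm C0).
  have := sqrD_le (l w t 0) (l w t (X w) - l w t 0); rewrite addrC subrK => h3.
  by apply: le_trans h3 _; rewrite lerD2l ler_wpM2l.
Qed.

(** The exceptional set depends on [x]; a single one serves all rational [x], and
    the Lipschitz continuity of the losses extends the inequality to all real
    ones, in particular to the random value [X w]. *)
Lemma loss_ae_le l1 l2 t (X : Omega -> R) :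
  loss_function P T F l1 -> loss_function P T F l2 -> 0 <= t <= T ->
  (forall x, {ae P, forall w, l1 w t x <= l2 w t x}) ->
  {ae P, forall w, l1 w t (X w) <= l2 w t (X w)}.
Proof.
move=> [_ _ _ _ [c1 [C1 [c10 cC1 b1]]]] [_ _ _ _ [c2 [C2 [c20 cC2 b2]]]] tT l12.
have hq : {ae P, forall w, forall n : nat, if unpickle n is Some q
    then l1 w t (ratr q) <= l2 w t (ratr q) else true}.
  apply: ae_foralln => n; case: (unpickle n) => [q|]; first exact: l12.
  exact: aeW.
apply: filterS hq => w hw.
have {}hw (q : rat) : l1 w t (ratr q) <= l2 w t (ratr q).
  by have := hw (pickle q); rewrite pickleK.
apply/ler_addgt0Pr => e e0.
have C0 : 0 < C1 + C2 by rewrite addr_gt0 ?(lt_trans _ cC1) ?(lt_trans _ cC2).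
have [q hqe] := rat_close (X w) (divr_gt0 e0 C0).
have /andP[_] := b1 w t (X w) (ratr q) tT; rewrite ler_norml => /andP[_ h1].
have /andP[_] := b2 w t (X w) (ratr q) tT; rewrite ler_norml => /andP[h2 _].
have hC : (C1 + C2) * `|X w - ratr q| <= e.
  by rewrite mulrC -ler_pdivlMr// ltW.
have := hw q; lra.
Qed.

(** Domination bounds [E (X - delta) - E X] by the g-expectation of the constant
    [- delta], which is a negative multiple of [delta]. *)
Lemma expectation_shift kappa (E : (Omega -> R) -> R) : 0 < kappa ->
  nonlinear_expectation P T F B kappa E ->
  exists2 r : R, 0 < r & forall (delta : R) X, 0 <= delta -> L2 P (F T) X ->
    E (fun w => X w - delta) + r * delta <= E X.
Proof.
move=> k0 [_ [M M0 EM]]; exists (M * expR (kappa * (0 - T))); first by rewrite mulr_gt0 ?expR_gt0.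
move=> delta X d0 X2.
have X2' : L2 P (F T) (fun w => X w - delta).
  have [mX iX] := X2; split.
    by apply: measurable_funB; [exact: mX|exact: measurable_cst].
  by have [] := square_integrableB (L2_square_integrable X2) (square_integrable_cst P delta).
have := EM _ _ X2' X2.
rewrite (_ : (fun w => X w - delta - X w) = fun=> - delta); last by apply/funext => w; ring.
rewrite (gexp_constant T0 Ffil Bbm k0 d0) => h.
rewrite -lerBrDr; move: h; lra.
Qed.

(** The chain is
    [0 <= E1 (l1 X1) <= E1 (l2 X1) <= E2 (l2 X1) <= E2 (l2 X2 - c * delta)],
    where [c * delta] is the least growth of [l2] over an increment [delta];
    [expectation_shift] turns the subtracted constant into a strict gain. *)
Lemma constraint_slack kappa (E1 E2 : (Omega -> R) -> R) l1 l2 :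
  0 < kappa -> nonlinear_expectation P T F B kappa E1 ->
  nonlinear_expectation P T F B kappa E2 ->
  loss_function P T F l1 -> loss_function P T F l2 ->
  (forall t x, 0 <= t <= T -> {ae P, forall w, l1 w t x <= l2 w t x}) ->
  (forall X, L2 P (F T) X -> E1 X <= E2 X) ->
  exists2 r : R, 0 < r & forall t X1 X2 (delta : R), 0 <= t <= T -> 0 <= delta ->
    L2 P (F T) X1 -> L2 P (F T) X2 ->
    {ae P, forall w, X1 w + delta = X2 w} ->
    0 <= E1 (fun w => l1 w t (X1 w)) ->
    r * delta <= E2 (fun w => l2 w t (X2 w)).
Proof.
move=> k0 E1e E2e ll1 ll2 l12 E12.
have [_ _ _ hl [c [C [c0 cC bl]]]] := ll2.
have [r r0 hr] := expectation_shift k0 E2e.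
exists (r * c); first by rewrite mulr_gt0.
move=> t X1 X2 delta tT d0 X1L X2L X12 pos.
have [E1m _] := E1e; have [E2m _] := E2e.
have l1X1 := loss_L2 ll1 tT X1L; have l2X1 := loss_L2 ll2 tT X1L; have l2X2 := loss_L2 ll2 tT X2L.
have cd0 : 0 <= c * delta by rewrite mulr_ge0// ltW.
have l2X2' : L2 P (F T) (fun w => l2 w t (X2 w) - c * delta).
  have [mX iX] := l2X2; split.
    by apply: measurable_funB; [exact: mX|exact: measurable_cst].
  by have [] := square_integrableB (L2_square_integrable l2X2) (square_integrable_cst P (c * delta)).
apply: le_trans (hr _ _ cd0 l2X2); rewrite mulrA lerDr.
apply: (le_trans pos); apply: le_trans (E1m _ _ l1X1 l2X1 _) _.
  by apply: loss_ae_le => // x; exact: l12.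
apply: (le_trans (E12 _ l2X1)); apply: E2m => //.
apply: filterS X12 => w <-; rewrite lerBrDr.
move: d0; rewrite le_eqVlt => /predU1P[<-|d0]; first by rewrite mulr0 !addr0.
have inc : l2 w t (X1 w) < l2 w t (X1 w + delta) by apply: hl => //; rewrite ltrDl.
have /andP[+ _] := bl w t (X1 w + delta) (X1 w) tT.
rewrite addrC addKr (ger0_norm (ltW d0)) ger0_norm ?subr_ge0 ?(ltW inc)//.
by rewrite lerBrDl.
Qed.

End Losses.

(** * Flatness of the reflection and sign of the gap *)

Section Stieltjes.
Context (R : realType).
Variables (T : R) (K phi : R -> R).
Hypothesis Kmono : forall s t, 0 <= s -> s <= t -> t <= T -> K s <= K t.

Lemma lebesgue_stieltjes_itv_oc (k : cumulative R R) (a b : R) : a <= b ->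
  lebesgue_stieltjes_measure k `]a, b] = (k b - k a)%:E.
Proof.
move=> ab; rewrite /lebesgue_stieltjes_measure /measure_extension/=.
by rewrite measurable_mu_extE/= ?wlength_itv_bnd//; exact: is_ocitv.
Qed.

(** A nonnegative integrand with zero integral against [dK] that is at least
    [eta] on [[s, t]] leaves no mass of [dK] there. *)
Lemma stieltjes_flat (s t eta : R) : 0 <= s -> s <= t -> t <= T -> 0 < eta ->
  stieltjes_integral_is T K phi 0%E ->
  (forall r, 0 <= r <= T -> 0 <= phi r) ->
  (forall r, s <= r <= t -> eta <= phi r) -> K t = K s.
Proof.
move=> s0 st tT eta0 [k kE int0] phi0 phie.
have sT := le_trans st tT; have t0 := le_trans s0 st.
have kK r : 0 <= r -> r <= T -> k r = K r by move=> r0 rT; rewrite kE max_r// min_l.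
apply/eqP; rewrite eq_le; apply/andP; split; last exact: Kmono.
suff : (eta%:E * (K t - K s)%:E <= 0)%E by rewrite -EFinM lee_fin pmulr_rle0// subr_le0.
rewrite -(kK t t0 tT) -(kK s s0 sT) -(lebesgue_stieltjes_itv_oc k st) -int0.
rewrite -[leLHS]integral_cst; last exact: measurable_itv.
rewrite [leLHS]integral_mkcond [leRHS]integral_mkcond.
apply: ge0_le_integral_nomeas => r _; rewrite !patchE.
  by case: ifPn => // _; rewrite lee_fin ltW.
case: ifPn => [/set_mem/=|_]; last first.
  by case: ifPn => // /set_mem/=; rewrite in_itv/= lee_fin; exact: phi0.
rewrite in_itv/= => /andP[sr rt]; rewrite mem_set ?lee_fin ?phie ?(ltW sr)//=.
by rewrite in_itv/= (le_trans s0 (ltW sr)) (le_trans rt).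
Qed.

End Stieltjes.

Section ComparisonODE.
Context (R : realType).
Local Notation mu := (@lebesgue_measure R).

Lemma within_continuous_lt (a b t y : R) (f : R -> R) :
  {within `[a, b], continuous f} -> a <= t <= b -> f t < y ->
  exists2 e : R, 0 < e & forall s, a <= s <= b -> `|t - s| < e -> f s < y.
Proof.
move=> cf tab fy; have tI : `[a, b]%classic t by rewrite /= in_itv.
have /(_ t tI) cft := (subspace_continuousP _ _).1 cf.
have := cft _ (lt_nbhsl fy).
rewrite /within/= => -[e /= e0 he]; exists e => // s sab ts.
by apply: he => //=; rewrite in_itv.
Qed.

Variables (T A c : R) (D p K1 K2 : R -> R).
Hypothesis T0 : 0 <= T.
Hypothesis A0 : 0 <= A.
Hypothesis c0 : 0 <= c.
Hypothesis K1mono : forall s t, 0 <= s -> s <= t -> t <= T -> K1 s <= K1 t.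
Hypothesis K1c : {within `[0, T], continuous K1}.
Hypothesis K2c : {within `[0, T], continuous K2}.
Hypothesis ip : mu.-integrable `[0, T] (EFin \o p).
Hypothesis pD : forall s, 0 <= s <= T -> `|p s| <= A * `|D s|.
Hypothesis eqD : forall t, 0 <= t <= T ->
  D t = c + (K1 T - K1 t) - (K2 T - K2 t) + \int[mu]_(s in `[t, T]) p s.
Hypothesis flat : forall s t eta, 0 <= s -> s <= t -> t <= T -> 0 < eta ->
  (forall r, s <= r <= t -> D r <= - eta) -> K2 t = K2 s.

Let ipS s t : 0 <= s -> t <= T -> mu.-integrable `[s, t] (EFin \o p).
Proof.
move=> s0 tT; apply: integrableS ip; do ?exact: measurable_itv.
by move=> r /=; rewrite !in_itv/= => /andP[sr rt]; rewrite (le_trans s0) ?(le_trans rt).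
Qed.

Lemma Rintegral_tail_split s t : 0 <= s -> s <= t -> t <= T ->
  \int[mu]_(r in `[s, T]) p r = \int[mu]_(r in `[s, t]) p r + \int[mu]_(r in `[t, T]) p r.
Proof.
move=> s0 st tT; have := @Rintegral_itvB _ p (BLeft s) (BRight T) t (ipS s0 (lexx T)).
rewrite !bnd_simp => /(_ st tT) E.
rewrite -[X in _ = _ + X]Rintegral_itv_obnd_cbnd -?E; first by ring.
apply: integrableS (ipS (le_trans s0 st) (lexx T)); do ?exact: measurable_itv.
by move=> r /=; rewrite !in_itv/= => /andP[/ltW -> ->].
Qed.

Lemma gap_between s t : 0 <= s -> s <= t -> t <= T ->
  D s = D t + (K1 t - K1 s) - (K2 t - K2 s) + \int[mu]_(r in `[s, t]) p r.
Proof.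
move=> s0 st tT; rewrite eqD ?s0 ?(le_trans st)// (eqD (t := t)) ?tT ?(le_trans s0)//.
by rewrite (Rintegral_tail_split s0 st tT); ring.
Qed.

Lemma gap_continuous : {within `[0, T], continuous D}.
Proof.
have cI := @parameterized_integral_continuous R 0 T p T0 ip.
apply: (@subspace_eq_continuous _ _ _ (fun t =>
  (c + K1 T - K2 T + \int[mu]_(s in `[0, T]) p s) - K1 t + K2 t - \int[mu]_(s in `[0, t]) p s)).
  move=> t; rewrite inE/= in_itv/= => /andP[t0 tT].
  rewrite -[RHS]/(D t) (@eqD t) ?t0// (Rintegral_tail_split (lexx 0) t0 tT); ring.
move=> t; apply: cvgB; last exact: cI.
by apply: cvgD; [apply: cvgB; [exact: cvg_cst|exact: K1c]|exact: K2c].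
Qed.

(** Were [D t] negative, let [t1] be the first later time where [D] is
    nonnegative.  On [[t, t1]] the function [K2] is constant and [K1] helps, so
    [- D s] is at most [A] times the integral of [|D|] over [[s, t1]]; at a
    minimum point of [D] close to [t1] this is impossible. *)
Lemma gap_nonneg t : 0 <= t <= T -> 0 <= D t.
Proof.
move=> /andP[t0 tT]; rewrite leNgt; apply/negP => Dneg.
have aux (Ds Dt k1 k1' k2 k2' k2t I J : R) :
    Ds = Dt + (k1' - k1) - (k2' - k2) + I -> 0 <= Dt -> k1 <= k1' -> k2 = k2t ->
    k2' <= k2t -> - J <= I -> - Ds <= J by lra.
have DT : 0 <= D T.
  by rewrite eqD ?T0 ?lexx// set_itv1 Rintegral_set1 !subrr subr0 !addr0.
pose S := [set s | t <= s <= T /\ 0 <= D s].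
have ST : S T by split => //; rewrite tT lexx.
have lbS : lbound S t by move=> s [/andP[]].
have hS : has_inf S by split; [exists T|exists t].
pose t1 := inf S.
have tt1 : t <= t1 by apply: lb_le_inf => //; exists T.
have t1T : t1 <= T by apply: inf_lbound => //; exists t.
have t10 := le_trans t0 tt1.
(* t1 is the first time after t at which the gap is nonnegative. *)
have below s : t <= s -> s < t1 -> D s < 0.
  move=> ts st1; rewrite ltNge; apply/negP => Ds.
  have : t1 <= s by apply: inf_lbound; [exists t|split => //; rewrite ts (le_trans (ltW st1))].
  by rewrite leNgt st1.
have Dt1 : 0 <= D t1.
  rewrite leNgt; apply/negP => Dt1.
  have [e e0 he] := within_continuous_lt gap_continuous (introT andP (conj t10 t1T)) Dt1.
  have [s Ss ss] := inf_adherent e0 hS.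
  have t1s : t1 <= s by apply: inf_lbound => //; exists t.
  case: Ss => /andP[ts sT] Ds.
  have := he s; rewrite (le_trans t0 ts) sT distrC ger0_norm ?subr_ge0// ltrBlDl => /(_ erefl ss).
  by rewrite ltNge Ds.
have tlt : t < t1.
  by rewrite lt_neqAle tt1 andbT; apply/eqP => E; move: Dneg; rewrite E ltNge Dt1.
(* On each compact piece [t, s] before t1 the maximum of D is still negative;
   continuity of K2 then reaches t1 itself. *)
have flat1 s : t <= s -> s < t1 -> K2 s = K2 t.
  move=> ts st1; have sT := ltW (lt_le_trans st1 t1T).
  have sub : `[t, s]%classic `<=` (`[0, T]%classic : set R).
    by move=> r /=; rewrite !in_itv/= => /andP[tr rs]; rewrite (le_trans t0 tr) (le_trans rs sT).
  have cD := continuous_subspaceW sub gap_continuous.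
  have [m + hm] := EVT_max ts cD; rewrite in_itv/= => /andP[tm ms].
  have Dm : D m < 0 by apply: below => //; exact: le_lt_trans st1.
  apply: (@flat t s (- D m)) => //; first by rewrite oppr_gt0.
  by move=> r /andP[tr rs]; rewrite opprK; apply: hm; rewrite in_itv/= tr.
have flat2 : K2 t1 <= K2 t.
  rewrite leNgt; apply/negP => lt; rewrite -ltrN2 in lt.
  have cN : {within `[0, T], continuous (fun s => - K2 s)} by move=> x; apply: cvgN; exact: K2c.
  have [e e0 he] := within_continuous_lt cN (introT andP (conj t10 t1T)) lt.
  pose s := Num.max t (t1 - e / 2).
  have ts : t <= s by rewrite le_max lexx.
  have st1 : s < t1 by rewrite gt_max tlt/= ltrBlDr ltrDl divr_gt0.
  have st1e : `|t1 - s| < e.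
    rewrite ger0_norm ?subr_ge0 ?(ltW st1)// ltrBlDr -ltrBlDl.
    by rewrite lt_max; apply/orP; right; lra.
  have := he s; rewrite (le_trans t0 ts) (le_trans (ltW st1) t1T) => /(_ erefl st1e).
  by rewrite (flat1 s ts st1) ltxx.
have gronwall s : t <= s -> s < t1 -> - D s <= A * \int[mu]_(r in `[s, t1]) `|D r|.
  move=> ts st1; have s0 := le_trans t0 ts.
  have ips := ipS s0 t1T.
  have K12 := K1mono s0 (ltW st1) t1T.
  have E := gap_between s0 (ltW st1) t1T.
  have sub : `[s, t1]%classic `<=` (`[0, T]%classic : set R).
    by move=> r /=; rewrite !in_itv/= => /andP[tr rs]; rewrite (le_trans s0 tr) (le_trans rs t1T).
  have mI : measurable (`[s, t1] : set (measurableTypeR R)) by exact: measurable_itv.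
  have iD : mu.-integrable `[s, t1] (EFin \o (fun r => `|D r|)).
    apply: continuous_compact_integrable; first exact: segment_compact.
    move=> x; apply: cvg_norm; exact: (continuous_subspaceW sub gap_continuous).
  have : `|\int[mu]_(r in `[s, t1]) p r| <= A * \int[mu]_(r in `[s, t1]) `|D r|.
    rewrite -RintegralZl//; apply: le_trans (le_normr_Rintegral mI ips) _.
    apply: le_Rintegral => //; first exact: integrable_norm.
      exact: (integrableZl mI A iD).
    by move=> r /sub/=; rewrite in_itv/=; exact: pD.
  have f1 := flat1 s ts st1.
  rewrite ler_norml => /andP[h _]; exact: aux E Dt1 K12 f1 flat2 h.
(* On an interval of length at most h / 2 the factor A times the length is less
   than 1, so at a minimum point m of D there the bound of the previous step
   reads - D m < - D m. *)
pose h := (A + 1)^-1.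
have h0 : 0 < h by rewrite invr_gt0 ltr_wpDl.
pose s := Num.max t (t1 - h / 2).
have ts : t <= s by rewrite le_max lexx.
have st1 : s < t1 by rewrite gt_max tlt/= ltrBlDr ltrDl divr_gt0.
have s0 := le_trans t0 ts.
have sub : `[s, t1]%classic `<=` (`[0, T]%classic : set R).
  by move=> r /=; rewrite !in_itv/= => /andP[tr rs]; rewrite (le_trans s0 tr) (le_trans rs t1T).
have [m + hm] := EVT_min (ltW st1) (continuous_subspaceW sub gap_continuous).
rewrite in_itv/= => /andP[sm mt1].
have Dm : D m < 0.
  by apply: le_lt_trans (hm s _) (below s ts st1); rewrite in_itv/= lexx ltW.
have mlt : m < t1.
  rewrite lt_neqAle mt1 andbT; apply/eqP => E; move: Dm; rewrite E ltNge Dt1//.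
have Dabs r : m <= r -> r < t1 -> `|D r| <= - D m.
  move=> mr rt1; rewrite ltr0_norm ?below ?(le_trans ts (le_trans sm mr))//.
  by rewrite lerN2; apply: hm; rewrite in_itv/= (le_trans sm mr) ltW.
have G := gronwall m (le_trans ts sm) mlt.
have m0 := le_trans s0 sm.
have sub' : `[m, t1]%classic `<=` (`[0, T]%classic : set R).
  by move=> r /=; rewrite !in_itv/= => /andP[tr rs]; rewrite (le_trans m0 tr) (le_trans rs t1T).
have iD : mu.-integrable `[m, t1] (EFin \o (fun r => `|D r|)).
  apply: continuous_compact_integrable; first exact: segment_compact.
  move=> x; apply: cvg_norm; exact: (continuous_subspaceW sub' gap_continuous).
have mI : measurable (`[m, t1[ : set (measurableTypeR R)) by exact: measurable_itv.
have iDo : mu.-integrable `[m, t1[ (EFin \o (fun r => `|D r|)).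
  apply: integrableS iD; do ?exact: measurable_itv.
  by move=> r /=; rewrite !in_itv/= => /andP[-> /ltW ->].
have ic : mu.-integrable `[m, t1[ (EFin \o (fun=> - D m)).
  apply: integrableS (integrable_itv_cst (ltW mlt) (- D m)); do ?exact: measurable_itv.
  by move=> r /=; rewrite !in_itv/= => /andP[-> /ltW ->].
have H : \int[mu]_(r in `[m, t1]) `|D r| <= (- D m) * (t1 - m).
  rewrite -Rintegral_itv_bndo_bndc//.
  apply: le_trans (_ : _ <= \int[mu]_(r in `[m, t1[) (- D m)) _.
    by apply: le_Rintegral => // r /=; rewrite in_itv/= => /andP[mr rt1]; exact: Dabs.
  rewrite Rintegral_itv_bndo_bndc// Rintegral_cst//.
  by rewrite le_eqVlt; apply/orP; left; apply/eqP; congr (_ * _); exact: (congr1 fine (lebesgue_measure_itvcc (ltW mlt))).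
have tm : t1 - m <= h / 2.
  have : t1 - h / 2 <= m by apply: le_trans sm; rewrite le_max lexx orbT.
  by rewrite lerBlDr lerBlDl addrC.
have x0 : 0 < - D m by rewrite oppr_gt0.
have : A * (- D m * (t1 - m)) < - D m.
  rewrite mulrCA -[ltRHS]mulr1 ltr_pM2l//.
  apply: le_lt_trans (ler_wpM2l A0 tm) _; rewrite mulrA /h.
  apply: (@le_lt_trans _ _ (1 / 2)); last by rewrite ltr_pdivrMr ?mul1r ?ltr1n.
  by rewrite ler_wpM2r// ler_pdivrMr ?ltr_wpDl// mul1r lerDl.
rewrite ltNge => /negP; apply; apply: (le_trans G).
by rewrite ler_wpM2l.
Qed.

End ComparisonODE.

(** * The comparison theorem *)

Section MeanGap.
Context d (Omega : measurableType d) (R : realType) (P : probability Omega R) (T : R)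
 (F : R -> set (set Omega)).
Hypothesis T0 : 0 <= T.
Hypothesis Ffil : filtration T F.
Local Notation mu := (@lebesgue_measure R).
Local Notation "`N[ X ]" := (\int[P]_w (X w ^+ 2)%:E)%E (at level 0, X at level 99).
Variables (W : R -> Omega -> R).
Hypothesis iW : forall t, 0 <= t <= T -> square_integrable P (W t).
Hypothesis jW : jointly_measurable T W.

Definition mean_path t : R := \int[P]_w W t w.

(** Expectations of squares depend measurably on time by Tonelli's theorem, and
    polarization, [4 E(W) = E((W + 1)^2) - E((W - 1)^2)], reduces to them. *)
Lemma mean_path_measurable : measurable_fun (`[0, T] : set (measurableTypeR R)) mean_path.
Proof.
pose N (s : R) t := (\int[P]_w ((W t w + s) ^+ 2)%:E)%E.
have mN s : measurable_fun (`[0, T] : set (measurableTypeR R)) (fun t => fine (N s t)).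
  apply: (@measurableT_comp _ _ _ _ _ _ fine); first exact: (fine_measurable measurableT).
  apply: (@measurable_mean_square _ _ _ P T (fun t w => W t w + s) _ 0 T (lexx 0) (lexx T)).
  by apply: measurable_funD => //; exact: measurable_cst.
have E : {in `[0, T]%classic, (fun t => 4^-1 * (fine (N 1 t) - fine (N (-1) t))) =1 mean_path}.
  move=> t; rewrite inE/= in_itv/= => tT; rewrite /N /mean_path.
  have i1 := square_integrableD (iW tT) (square_integrable_cst P 1).
  have i2 := square_integrableD (iW tT) (square_integrable_cst P (-1)).
  have iWt := square_integrable_integrable (iW tT).
  rewrite (integral_sqrE i1) (integral_sqrE i2)/= -RintegralB//; last 2 first.
  - exact: square_integrable_mul.
  - exact: square_integrable_mul.
  rewrite (_ : \int[P]_w (_ - _) = \int[P]_w (4 * W t w)); last first.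
    by apply: eq_Rintegral => w _ /=; ring.
  by rewrite RintegralZl// mulrA mulVf ?mul1r.
apply: (eq_measurable_fun _ E).
apply: measurable_funM; first exact: measurable_cst.
by apply: measurable_funB; exact: mN.
Qed.

Lemma mean_path_bounded (C : R) : (forall t, 0 <= t <= T -> (`N[W t] <= C%:E)%E) ->
  forall t, 0 <= t <= T -> `|mean_path t| <= 1 + C.
Proof.
move=> hC t tT; have iWt := iW tT.
have i1 := square_integrable_integrable iWt; have i2 := square_integrable_mul iWt iWt.
apply: le_trans (le_normr_Rintegral measurableT i1) _.
have i0 := finite_measure_integrable_cst P 1 measurableT.
apply: le_trans (_ : _ <= \int[P]_w (1 + W t w * W t w)) _.
  apply: le_Rintegral => //; first exact: integrable_norm.
    exact: (integrableD measurableT i0 i2).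
  by move=> w _; rewrite ler_norml; apply/andP; split; nra.
rewrite RintegralD// lerD//.
  rewrite Rintegral_cst// mul1r.
  by rewrite (_ : fine _ = 1)// [X in fine X](@probability_setT _ _ _ P).
by have := hC t tT; rewrite integral_sqrE// lee_fin.
Qed.

(** The expectation is the best constant approximation in mean square. *)
Lemma mean_path_centered (m t : R) : 0 <= t <= T ->
  (`N[fun w => (W t w - mean_path t)%R] <= `N[fun w => (W t w - mean_path t - m)%R])%E.
Proof.
move=> tT; pose V w := W t w - mean_path t.
have iV : square_integrable P V.
  by apply: square_integrableB; [exact: iW|exact: square_integrable_cst].
have iVm : square_integrable P (fun w => V w - m).
  by apply: square_integrableB => //; exact: square_integrable_cst.
have iV1 := square_integrable_integrable iV.
have EV : \int[P]_w V w = 0.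
  rewrite RintegralB//; last 2 first.
  - exact: square_integrable_integrable (iW tT).
  - exact: finite_measure_integrable_cst.
  rewrite Rintegral_cst// [X in _ * fine X](@probability_setT _ _ _ P) mulr1 subrr//.
have iVV := square_integrable_mul iV iV.
rewrite -/(V _) !integral_sqrE// lee_fin.
have iZ := integrableZl measurableT (2 * m) iV1.
have ic := finite_measure_integrable_cst P (m ^+ 2) measurableT.
rewrite [leRHS](_ : _ = \int[P]_w (V w * V w) + m ^+ 2); first by rewrite lerDl sqr_ge0.
transitivity (\int[P]_w ((V w * V w - 2 * m * V w) + m ^+ 2)).
  by apply: eq_Rintegral => w _; rewrite /V; ring.
rewrite RintegralD//; last exact: (integrableB measurableT iVV iZ).
rewrite RintegralB// RintegralZl// EV mulr0 subr0 Rintegral_cst//.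
by rewrite [X in _ * fine X](@probability_setT _ _ _ P) mulr1.
Qed.

End MeanGap.

Theorem proposition3p14 (R : realType) (d : measure_display)
    (Omega : measurableType d) (P : probability Omega R) (T : R)
    (F : R -> set (set Omega)) (B : R -> Omega -> R)
    (kappa lambda : R) (a : R -> R) (h : Omega -> R -> R -> R)
    (f : Omega -> R -> R -> R -> R)
    (l1 l2 : Omega -> R -> R -> R) (E1 E2 : (Omega -> R) -> R)
    (xi : Omega -> R) (c1 c2 : R)
    (Y1 Z1 Y2 Z2 : R -> Omega -> R) (K1 K2 : R -> R)
    (T_gt0 : 0 < T)
    (F_usual : usual_conditions P T F)
    (F_aug : forall t, 0 <= t <= T -> F t = augmented_filtration P B t)
    (B_bm : brownian_motion P T F B)
    (kappa_gt0 : 0 < kappa)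
    (a_meas : measurable_fun `[0, T] a)
    (a_bnd : exists A : R, forall t, 0 <= t <= T -> `|a t| <= A)
    (f_def : forall w t y z, 0 <= t <= T -> f w t y z = a t * y + h w t z)
    (lambda_gt0 : 0 < lambda)
    (f_gen : lipschitz_generator P T F lambda f)
    (l1_loss : loss_function P T F l1)
    (l2_loss : loss_function P T F l2)
    (E1_exp : nonlinear_expectation P T F B kappa E1)
    (E2_exp : nonlinear_expectation P T F B kappa E2)
    (xi_L2 : L2 P (F T) xi)
    (c12 : c2 <= c1)
    (term1 : 0 <= E1 (fun w => l1 w T (xi w + c1)))
    (term2 : 0 <= E2 (fun w => l2 w T (xi w + c2)))
    (sol1 : mean_reflected_solution P T F B
              (fun w => xi w + c1) f E1 l1 Y1 Z1 K1)
    (sol2 : mean_reflected_solution P T F B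
              (fun w => xi w + c2) f E2 l2 Y2 Z2 K2)
    (l12 : forall t x, 0 <= t <= T -> {ae P, forall w, l1 w t x <= l2 w t x})
    (E12 : forall X, L2 P (F T) X -> E1 X <= E2 X) :
  forall t, 0 <= t <= T -> {ae P, forall w, Y2 t w <= Y1 t w}.
Proof.
have T0 := ltW T_gt0.
have [_ Ffil _ _] := F_usual.
have [bsde1 pos1 [K1c K1mono _] _] := sol1.
have [bsde2 pos2 [K2c K2mono _] flat2] := sol2.
have [sY1 _ _] := bsde1; have [sY2 _ _] := bsde2.
have [A hA] := a_bnd.
have A0 : 0 <= A by apply: le_trans (hA 0 _); rewrite ?normr_ge0 ?lexx.
pose W t w := Y1 t w - Y2 t w.
have iY1 t (tT : 0 <= t <= T) := S2_square_integrable T0 Ffil sY1 tT.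
have iY2 t (tT : 0 <= t <= T) := S2_square_integrable T0 Ffil sY2 tT.
have iW t : 0 <= t <= T -> square_integrable P (W t).
  by move=> tT; apply: square_integrableB; [exact: iY1|exact: iY2].
have jW : jointly_measurable T W.
  by apply: measurable_funB; [exact: (S2_jointly_measurable Ffil sY1)|exact: (S2_jointly_measurable Ffil sY2)].
have [C1 hC1] := S2_mean_square T0 sY1; have [C2 hC2] := S2_mean_square T0 sY2.
have hCW t : 0 <= t <= T -> (\int[P]_w ((W t w) ^+ 2)%:E <= (2 * (C1 + C2))%:E)%E.
  move=> tT; apply: (@le_trans _ _ (2%:E * (\int[P]_w ((Y1 t w) ^+ 2)%:E + \int[P]_w ((Y2 t w) ^+ 2)%:E))%E).
    apply: mean_square_sum2 => //; [by have [] := iY1 t tT|by have [] := iY2 t tT|].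
    by move=> w _; have := sqrD_le (Y1 t w) (- Y2 t w); rewrite sqrrN /W; lra.
  by rewrite [leRHS]EFinM lee_wpmul2l ?lee_fin// [leRHS]EFinD; apply: leeD; [exact: hC1|exact: hC2].
pose D := mean_path P W.
have mD : measurable_fun (`[0, T] : set (measurableTypeR R)) D by exact: (mean_path_measurable iW jW).
have bD := mean_path_bounded iW hCW.
have mI : measurable (`[0, T] : set (measurableTypeR R)) by exact: measurable_itv.
(* The effect on the generator of a deterministic shift of y by D: once it is
   removed, the remaining difference is Lipschitz in the centred gap and in z. *)
pose p s := a s * D s.
have pD s : 0 <= s <= T -> `|p s| <= A * `|D s|.
  by move=> sT; rewrite normrM ler_wpM2r// hA.
have ip : (@lebesgue_measure R).-integrable `[0, T] (EFin \o p).
  apply: le_integrable (integrable_itv_cst T0 (A * (1 + 2 * (C1 + C2)))) => //.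
    by apply/measurable_EFinP; exact: measurable_funM.
  move=> s /=; rewrite in_itv/= => sT; rewrite lee_fin; apply: le_trans (pD s sT) _.
  apply: le_trans (ler_norm _); by rewrite ler_wpM2l// bD.
have lip : {ae P, forall w, forall t y y' z z', 0 <= t <= T ->
    `|f w t y z - f w t y' z' - p t| <= Num.max A lambda * (`|y - y' - D t| + `|z - z'|)}.
  have [_ lf _] := f_gen; apply: filterS lf => w lw t y y' z z' tT.
  have := lw t 0 0 z z' tT; rewrite !f_def// !mulr0 !add0r oppr0 normr0 add0r => hz.
  rewrite (_ : _ - _ = a t * (y - y' - D t) + (h w t z - h w t z')); last by rewrite /p; ring.
  apply: le_trans (ler_normD _ _) _; rewrite normrM mulrDr lerD//.
    by rewrite ler_wpM2r// le_max hA.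
  by apply: le_trans hz _; rewrite ler_wpM2r// le_max lexx orbT.
have X12 w : xi w + c1 = xi w + c2 + (c1 - c2) by ring.
have L0 : 0 <= Num.max A lambda by rewrite le_max A0.
have gap := @bsde_difference _ _ _ P T F B T0 Ffil B_bm lambda (Num.max A lambda) (c1 - c2)
  (1 + 2 * (C1 + C2)) f _ _ Y1 Z1 Y2 Z2 K1 K2 D p lambda_gt0 L0
  (lipschitz_generator_pathwise T0 Ffil f_gen) X12 bsde1 bsde2 mD bD ip lip
  (fun t tT => mean_path_centered iW (drift_gap T (c1 - c2) K1 K2 D p t) tT).
have eqD t : 0 <= t <= T -> D t = c1 - c2 + (K1 T - K1 t) - (K2 T - K2 t) +
    \int[@lebesgue_measure R]_(s in `[t, T]) p s.
  by move=> tT; have [_ /eqP] := gap t tT; rewrite subr_eq0 eq_sym => /eqP.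
have LT (Y : R -> Omega -> R) t : S2 P T F Y -> 0 <= t <= T -> L2 P (F T) (Y t).
  move=> sY tT; have [_ ?] := S2_square_integrable T0 Ffil sY tT; split => //.
  have [aY _ _] := sY; apply: measurable_wrt_sub (aY t tT).
  by have /andP[t0 tT'] := tT; exact: (filtration_mono Ffil).
have [r r0 hr] := constraint_slack T0 Ffil B_bm kappa_gt0 E1_exp E2_exp l1_loss l2_loss l12 E12.
(* A gap of at most - eta leaves a slack r * eta in the constraint of Y2. *)
have flat s t eta : 0 <= s -> s <= t -> t <= T -> 0 < eta ->
    (forall q, s <= q <= t -> D q <= - eta) -> K2 t = K2 s.
  move=> s0 st tT eta0 Deta.
  refine (@stieltjes_flat _ T K2 _ K2mono s t (r * eta) s0 st tT _ flat2 pos2 _).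
    by rewrite mulr_gt0.
  move=> q sqt; have qT : 0 <= q <= T.
    by have /andP[sq qt] := sqt; rewrite (le_trans s0 sq) (le_trans qt tT).
  have Dq := Deta q sqt.
  apply: (@le_trans _ _ (r * - D q)); first by rewrite ler_pM2l// lerNr.
  apply: (hr q (Y1 q) (Y2 q)) => //; [|exact: LT|exact: LT| |exact: pos1].
    by rewrite oppr_ge0 (le_trans Dq)// oppr_le0 ltW.
  have [gq _] := gap q qT; apply: filterS gq => w <-; ring.
have Dpos := gap_nonneg T0 A0 (_ : 0 <= c1 - c2) K1mono K1c K2c ip pD eqD flat.
move=> t tT; have [gt _] := gap t tT; apply: filterS gt => w e.
rewrite -subr_ge0 e; apply: Dpos => //.
by rewrite subr_ge0.
Qed.
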